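(* (Stability.) There is a universal constant $\Lambda_1>0$ and there is $\delta_0>0$ such that for all $\mathcal T\in\mathbb T(\delta_0)$ and all $\widehat{\mathcal T}\in\mathbb T(\mathcal T)$, $$\big|\widehat\eta(\mathcal T\cap\widehat{\mathcal T})-\eta(\mathcal T\cap\widehat{\mathcal T})\big|\le\Lambda_1\,\mathrm d(\mathcal T,\widehat{\mathcal T}).$$
   Context: Setting. $\Omega\subset\mathbb R^2$ is a bounded polygonal Lipschitz domain, $V:=H^2_0(\Omega)$; $\|\cdot\|$ and $(\cdot,\cdot)$ are the norm and inner product of $L^2(\Omega)$. $\mathcal Z\subset\Omega$ is a finite set of $n$ points. Fixed data: $\alpha>0$, $y_d\in L^2(\Omega)$, reals $a_z\le b_z$, $U_{ad}:=\{\mathbf u=\{u_z\}_{z\in\mathcal Z}\in\mathbb R^n: a_z\le u_z\le b_z\ \forall z\in\mathcal Z\}$. Meshes. All triangulations are regular triangulations of $\Omega$ with uniform shape regularity, obtained from an initial triangulation by newest-vertex bisection; $\mathbb T(\mathcal T)$ is the set of admissible refinements of $\mathcal T$; $\mathbb T(\delta)$ is the set of such triangulations with $\max_Th_T\le\delta$, $h_T:=|T|^{1/2}$. Discretisation on $\mathcal T$. The Morley space $V_M$ consists of all piecewise quadratic polynomials on $\mathcal T$ that are continuous at interior vertices with normal derivative continuous at midpoints of interior edges, and that vanish at boundary vertices with normal derivative vanishing at midpoints of boundary edges. $D^m_{pw}$ is the piecewise $m$-th derivative, $a_{pw}(v,w):=\sum_{T}\int_T D^2_{pw}v:D^2_{pw}w\,dx$,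 $|||v|||_{pw}:=\|D^2_{pw}v\|$. $J:V_M\to V$ is the companion operator, the standard linear conforming smoother with values in $V_{HCT}+(\mathcal P_5(\mathcal T)\cap V)$ ($V_{HCT}$ the Hsieh–Clough–Tocher space), which preserves values at vertices and satisfies $|||Jv_M|||_{pw}\le C_J|||v_M|||_{pw}$. The discrete solution $(\bar y_M,\bar p_M,\bar{\mathbf u}_h)\in V_M\times V_M\times U_{ad}$, $\bar{\mathbf u}_h=\{\bar u_{z,h}\}$, satisfies $a_{pw}(\bar y_M,\phi_M)=\sum_{z\in\mathcal Z}\bar u_{z,h}J\phi_M(z)$, $a_{pw}(\phi_M,\bar p_M)=(\bar y_M-y_d,\phi_M)$ for all $\phi_M\in V_M$, and $\sum_{z\in\mathcal Z}(J\bar p_M(z)+\alpha\bar u_{z,h})(w_z-\bar u_{z,h})\ge0$ for all $\{w_z\}\in U_{ad}$. Quantities with a hat, $(\widehat{\bar y}_M,\widehat{\bar p}_M,\widehat{\bar{\mathbf u}}_h)$ and $\widehat\eta$, are the corresponding objects for $\widehat{\mathcal T}$ (piecewise derivatives then refer to $\widehat{\mathcal T}$). Distance: $\mathrm d(\mathcal T,\widehat{\mathcal T}):=\big(\|\widehat{\bar{\mathbf u}}_h-\bar{\mathbf u}_h\|_{\mathbb R^n}^2+|||\widehat{\bar y}_M-\bar y_M|||_{pw}^2+|||\widehat{\bar p}_M-\bar p_M|||_{pw}^2\big)^{1/2}$. Estimator. For $T\in\mathcal T$, $\eta^2(T):=\eta_{S,T}^2+\eta_{S,\mathcal E(T)}^2+\eta_{A,T}^2+\eta_{A,\mathcal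 E(T)}^2$ with $\eta_{S,T}^2:=\sum_{z\in\mathcal Z\cap T}\lambda_T(z)h_T^2|\bar u_{z,h}|^2$ ($\lambda_T(z)=0$ if $z$ is a vertex of $T$, $1$ otherwise), $\eta_{A,T}^2:=h_T^4\|\bar y_M-y_d\|^2_{L^2(T)}$, $\eta_{S,\mathcal E(T)}^2:=\sum_{E\in\mathcal E(T)}h_T\|[D^2_{pw}\bar y_M]_E\tau_E\|^2_{L^2(E)}$, $\eta_{A,\mathcal E(T)}^2:=\sum_{E\in\mathcal E(T)}h_T\|[D^2_{pw}\bar p_M]_E\tau_E\|^2_{L^2(E)}$; $\mathcal E(T)$ are the edges of $T$, $\tau_E$ a unit tangent, $[\cdot]_E$ the jump (the trace on boundary edges). For a subset $\mathcal M$ of the triangulation, $\eta(\mathcal M):=(\sum_{T\in\mathcal M}\eta^2(T))^{1/2}$. ''Universal'' means independent of the mesh-size and of $\mathcal T,\widehat{\mathcal T}$. *)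

(* Defs.v *)
From HB Require Import structures.
From mathcomp Require Import all_boot all_order all_algebra finmap.
From mathcomp Require Import all_classical all_reals all_analysis.

Set Implicit Arguments.
Unset Strict Implicit.
Unset Printing Implicit Defensive.

Import Order.TTheory GRing.Theory Num.Theory numFieldNormedType.Exports.

Local Open Scope classical_set_scope.
Local Open Scope ring_scope.

Notation pt R := (R * R)%type.

(* (a, b, c) is the triangle conv{a, b, c} with refinement edge ab and newest
   vertex c. *)
Notation tri R := (pt R * pt R * pt R)%type.

Notation leb2 R := (@lebesgue_measure R \x @lebesgue_measure R)%E.

Section Geometry.
Variable R : realType.
Implicit Types (Omega : set (pt R)) (t k : tri R) (E F : pt R * pt R).

Definition coord (i : 'I_2) (x : pt R) : R := if i == ord0 then x.1 else x.2.

Definition basis_vec (i : 'I_2) : pt R := if i == ord0 then (1, 0) else (0, 1).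

Definition verts t : seq (pt R) := [:: t.1.1; t.1.2; t.2].

Definition edges t : seq (pt R * pt R) :=
  [:: (t.1.1, t.1.2); (t.1.2, t.2); (t.2, t.1.1)].

Definition same_edge E F : bool := (E == F) || (E == (F.2, F.1)).

Definition has_edge t E : bool := has (same_edge E) (edges t).

Definition midpoint E : pt R := ((E.1.1 + E.2.1) / 2, (E.1.2 + E.2.2) / 2).

Definition edge_point E (s : R) : pt R :=
  (E.1.1 + s * (E.2.1 - E.1.1), E.1.2 + s * (E.2.2 - E.1.2)).

Definition seg E : set (pt R) :=
  [set x | exists2 s : R, 0 <= s <= 1 & x = edge_point E s].

Definition edge_length E : R :=
  Num.sqrt ((E.2.1 - E.1.1) ^+ 2 + (E.2.2 - E.1.2) ^+ 2).

Definition tangent E : pt R :=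
  ((E.2.1 - E.1.1) / edge_length E, (E.2.2 - E.1.2) / edge_length E).

Definition normal E : pt R := ((tangent E).2, - (tangent E).1).

Definition edge_integral E (f : pt R -> R) : R :=
  edge_length E * \int[@lebesgue_measure R]_(s in `[0, 1]) f (edge_point E s).

Definition tri_point t (l0 l1 l2 : R) : pt R :=
  (l0 * t.1.1.1 + l1 * t.1.2.1 + l2 * t.2.1,
   l0 * t.1.1.2 + l1 * t.1.2.2 + l2 * t.2.2).

Definition tset t : set (pt R) :=
  [set x | exists l0 l1 l2 : R,
     [/\ 0 <= l0, 0 <= l1, 0 <= l2, l0 + l1 + l2 = 1 & x = tri_point t l0 l1 l2]].

(* The open triangle; all area integrals over T are taken over it. *)
Definition tint t : set (pt R) :=
  [set x | exists l0 l1 l2 : R,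
     [/\ 0 < l0, 0 < l1, 0 < l2, l0 + l1 + l2 = 1 & x = tri_point t l0 l1 l2]].

Definition nondegenerate t : Prop :=
  (t.1.2.1 - t.1.1.1) * (t.2.2 - t.1.1.2)
    - (t.1.2.2 - t.1.1.2) * (t.2.1 - t.1.1.1) != 0.

Definition hT t : R := Num.sqrt (fine (leb2 R (tset t))).

(* For Omega open. *)
Definition bdry Omega : set (pt R) := closure Omega `\` Omega.

Definition polygonal Omega : Prop :=
  exists s : seq (pt R * pt R),
    bdry Omega = [set x | exists2 E, E \in s & seg E x].

(* Near each boundary point, in orthonormal coordinates (s, r) with axes e and
   its rotation by pi/2, Omega is the strict epigraph of a Lipschitz function. *)
Definition lipschitz_boundary Omega : Prop :=
  forall x0 : pt R, bdry Omega x0 ->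
  exists (e : pt R) (gamma : R -> R) (L eps : R),
    [/\ e.1 ^+ 2 + e.2 ^+ 2 = 1, L.-lipschitz gamma, 0 < eps
      & forall s r : R, `|s| < eps -> `|r| < eps ->
          (Omega (x0.1 + s * e.1 - r * e.2, x0.2 + s * e.2 + r * e.1)
             <-> gamma s < r)].

Definition polygonal_lipschitz_domain Omega : Prop :=
  [/\ open Omega, connected Omega, Omega !=set0, bounded_set Omega
    & polygonal Omega] /\ lipschitz_boundary Omega.

End Geometry.

Section Meshes.
Variable R : realType.
Implicit Types (Omega : set (pt R)) (M : {fset tri R}) (t k : tri R).

Definition regular_triangulation Omega M : Prop :=
  [/\ forall t, t \in M -> nondegenerate t,
      closure Omega = [set x | exists2 t, t \in M & tset t x]
    & forall t k, t \in M -> k \in M -> t <> k ->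
        [\/ tset t `&` tset k = set0,
            exists z, [/\ z \in verts t, z \in verts k
                        & tset t `&` tset k = [set z]]
          | exists E, [/\ has_edge t E, has_edge k E
                        & tset t `&` tset k = seg E]]].

(* Newest-vertex bisection of (a, b, c): the midpoint m of the refinement edge
   ab becomes the newest vertex of both children. *)
Definition child1 t : tri R := (t.2, t.1.1, midpoint t.1).
Definition child2 t : tri R := (t.1.2, t.2, midpoint t.1).

(* Intermediate collections may have hanging nodes; conformity is required of
   the final one in [admissible]. *)
Inductive nvb M : {fset tri R} -> Prop :=
| nvb_refl : nvb M M
| nvb_step M' t : nvb M M' -> t \in M' ->
    nvb M ((M' `\ t) `|` [fset child1 t; child2 t])%fset.

(* M' \in T(M) *)
Definition admissible Omega M M' : Prop :=
  nvb M M' /\ regular_triangulation Omega M'.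

(* M \in T(delta), M0 being the initial triangulation *)
Definition fine_triangulation Omega (M0 : {fset tri R}) (delta : R) M : Prop :=
  admissible Omega M0 M /\ forall t, t \in M -> hT t <= delta.

(* The three triangles of the Hsieh-Clough-Tocher split at the centroid. *)
Definition hct_split t : seq (tri R) :=
  let g := tri_point t (3^-1) (3^-1) (3^-1) in
  [:: (t.1.1, t.1.2, g); (t.1.2, t.2, g); (t.2, t.1.1, g)].

End Meshes.

(* Bivariate polynomials: the outer variable is x_1, the inner one x_2. *)
Notation poly2 R := {poly {poly R}}.

(* A piecewise polynomial on a mesh is the family of its polynomials on the
   triangles (set to 0 off the mesh); continuity across edges is not implied. *)
Notation broken R := (tri R -> poly2 R).

Section Broken.
Variable R : realType.
Implicit Types (p q : poly2 R) (v w : broken R) (M : {fset tri R})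
  (t k : tri R) (x : pt R) (E : pt R * pt R).

Definition ev p x : R := p.[x.1, x.2].

Definition total_degree_le (d : nat) p : Prop :=
  forall i j : nat, (d < i + j)%N -> p`_i`_j = 0.

Definition pd (i : 'I_2) p : poly2 R :=
  if i == ord0 then p^`() else map_poly (fun q : {poly R} => q^`()) p.

Definition hess (i j : 'I_2) p : poly2 R := pd i (pd j p).

Definition normal_deriv E p x : R := \sum_(i < 2) ev (pd i p) x * coord i (normal E).

Definition a_pw M v w : R :=
  \sum_(t <- M) \int[leb2 R]_(x in tint t)
    (\sum_(i < 2) \sum_(j < 2) ev (hess i j (v t)) x * ev (hess i j (w t)) x).

Definition norm_pw M v : R := Num.sqrt (a_pw M v v).

(* v as a piecewise polynomial on a refinement of M: each of its triangles k lies
   in exactly one triangle of M, so the sum has one term. *)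
Definition restrict M v : broken R :=
  fun k => \sum_(t <- M | `[< tset k `<=` tset t >]) v t.

(* [D^2_pw v]_E for E an edge of t, with the sign chosen from the side of t.
   The sum has at most one term, the neighbour of t across E, and none if E is
   a boundary edge. *)
Definition hess_jump M v t E (i j : 'I_2) : poly2 R :=
  hess i j (v t) - \sum_(k <- M | (k != t) && has_edge k E) hess i j (v k).

(* || [D^2_pw v]_E tau_E ||^2_{L^2(E)} *)
Definition hess_jump_norm2 M v t E : R :=
  edge_integral E (fun x =>
    \sum_(i < 2) (\sum_(j < 2) ev (hess_jump M v t E i j) x * coord j (tangent E)) ^+ 2).

(* Interior edges are those not contained in the boundary. *)
Definition morley (Omega : set (pt R)) M v : Prop :=
  [/\ (forall t, t \in M -> total_degree_le 2 (v t)) /\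
        (forall t, t \notin M -> v t = 0),
      forall t k z, t \in M -> k \in M -> z \in verts t -> z \in verts k ->
        Omega z -> ev (v t) z = ev (v k) z,
      forall t z, t \in M -> z \in verts t -> bdry Omega z -> ev (v t) z = 0,
      forall t k E, t \in M -> k \in M -> has_edge t E -> has_edge k E ->
        ~ (seg E `<=` bdry Omega) ->
        normal_deriv E (v t) (midpoint E) = normal_deriv E (v k) (midpoint E)
    & forall t E, t \in M -> has_edge t E -> seg E `<=` bdry Omega ->
        normal_deriv E (v t) (midpoint E) = 0].

End Broken.

Section Sobolev.
Variable R : realType.
Implicit Types (Omega : set (pt R)) (f g v : pt R -> R).

Definition partial (i : 'I_2) f : pt R -> R := fun x => 'D_(basis_vec R i) f x.

Definition partials (s : seq 'I_2) f : pt R -> R := foldr partial f s.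

Definition smooth f : Prop :=
  forall s : seq 'I_2, continuous (partials s f) /\
    forall (i : 'I_2) x, derivable (partials s f) x (basis_vec R i).

(* C_c^infty(Omega) *)
Definition test_function Omega f : Prop :=
  smooth f /\ exists K : set (pt R),
    [/\ compact K, K `<=` Omega & forall x, ~ K x -> f x = 0].

Definition cvg_L2 Omega (f : nat -> pt R -> R) g : Prop :=
  measurable_fun Omega g /\
  (fun n => \int[leb2 R]_(x in Omega) ((f n x - g x) ^+ 2)%:E)%E @ \oo --> 0%E.

(* H^2_0(Omega) is the closure of C_c^infty(Omega) in the H^2 norm; G and H are
   the weak gradient and Hessian of v. *)
Definition H20_jet Omega v (G : 'I_2 -> pt R -> R) (H : 'I_2 -> 'I_2 -> pt R -> R)
    : Prop :=
  exists phi : nat -> pt R -> R,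
    [/\ forall n, test_function Omega (phi n),
        cvg_L2 Omega phi v,
        forall i, cvg_L2 Omega (fun n => partial i (phi n)) (G i)
      & forall i j, cvg_L2 Omega (fun n => partial i (partial j (phi n))) (H i j)].

(* H^2_0(Omega) embeds in the continuous functions vanishing on the boundary, and
   point values are taken of its elements: they are represented by their
   continuous representative, extended by 0. *)
Definition in_V Omega v : Prop :=
  [/\ continuous v, forall x, ~ Omega x -> v x = 0
    & exists G H, H20_jet Omega v G H].

Definition hess_norm Omega (H : 'I_2 -> 'I_2 -> pt R -> R) : R :=
  Num.sqrt (\int[leb2 R]_(x in Omega) (\sum_(i < 2) \sum_(j < 2) H i j x ^+ 2)).

Definition in_L2 Omega f : Prop :=
  measurable_fun Omega f /\
  (\int[leb2 R]_(x in Omega) (f x ^+ 2)%:E < +oo)%E.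

Definition poly_on (d : nat) (A : set (pt R)) v : Prop :=
  exists2 p : poly2 R, total_degree_le d p & forall x, A x -> v x = ev p x.

(* C^1 continuity across the inner edges of each split is part of v \in H^2. *)
Definition in_HCT Omega (M : {fset tri R}) v : Prop :=
  in_V Omega v /\
  forall t k, t \in M -> k \in hct_split t -> poly_on 3 (tset k) v.

Definition in_P5V Omega (M : {fset tri R}) v : Prop :=
  in_V Omega v /\ forall t, t \in M -> poly_on 5 (tset t) v.

Definition companion Omega (M : {fset tri R}) (CJ : R)
    (J : broken R -> pt R -> R) : Prop :=
  [/\ forall (c : R) (v w : broken R), morley Omega M v -> morley Omega M w ->
        J (fun t => c%:P *: v t + w t) = (fun x => c * J v x + J w x),
      forall v : broken R, morley Omega M v -> exists w1 w2,
        [/\ in_HCT Omega M w1, in_P5V Omega M w2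
          & J v = (fun x => w1 x + w2 x)],
      forall (v : broken R) (t : tri R) z, morley Omega M v -> t \in M -> z \in verts t ->
        J v z = ev (v t) z
    & forall (v : broken R) G H, morley Omega M v -> H20_jet Omega (J v) G H ->
        hess_norm Omega H <= CJ * norm_pw M v].

End Sobolev.

Section Control.
Variables (R : realType) (Omega : set (pt R)) (Z : {fset pt R}).
Variables (alpha : R) (yd : pt R -> R) (a b : Z -> R).
Implicit Types (M : {fset tri R}) (y p : broken R) (u w : Z -> R) (t : tri R).

Definition Uad u : Prop := forall z : Z, a z <= u z <= b z.

Definition discrete_solution M (J : broken R -> pt R -> R) y p u : Prop :=
  [/\ [/\ morley Omega M y, morley Omega M p & Uad u],
      forall phi, morley Omega M phi ->
        a_pw M y phi = \sum_(z : Z) u z * J phi (val z),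
      forall phi, morley Omega M phi ->
        a_pw M phi p =
        \sum_(t <- M) \int[leb2 R]_(x in tint t)
           ((ev (y t) x - yd x) * ev (phi t) x)
    & forall w, Uad w ->
        0 <= \sum_(z : Z) (J p (val z) + alpha * u z) * (w z - u z)].

(* M' refines M, and (y', p', u') lives on M'. *)
Definition distance M M' (y y' p p' : broken R) (u u' : Z -> R) : R :=
  Num.sqrt (\sum_(z : Z) (u' z - u z) ^+ 2
            + norm_pw M' (fun k => y' k - restrict M y k) ^+ 2
            + norm_pw M' (fun k => p' k - restrict M p k) ^+ 2).

Definition lambda t (z : pt R) : R := if z \in verts t then 0 else 1.

Definition etaS2 u t : R :=
  \sum_(z : Z | `[< tset t (val z) >]) lambda t (val z) * hT t ^+ 2 * `|u z| ^+ 2.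

Definition etaA2 y t : R :=
  hT t ^+ 4 * \int[leb2 R]_(x in tint t) ((ev (y t) x - yd x) ^+ 2).

Definition etaE2 M (v : broken R) t : R :=
  \sum_(E <- edges t) hT t * hess_jump_norm2 M v t E.

Definition eta2 M y p u t : R :=
  etaS2 u t + etaE2 M y t + etaA2 y t + etaE2 M p t.

(* The jumps are those of the full triangulation M, the sum is over S. *)
Definition estimator M y p u (S : {fset tri R}) : R :=
  Num.sqrt (\sum_(t <- S) eta2 M y p u t).

End Control.

(* Main.v *)
Require Import Defs.
From HB Require Import structures.
From mathcomp Require Import all_boot all_order all_algebra finmap.
From mathcomp Require Import all_classical all_reals all_analysis.
From mathcomp Require Import measurable_realfun ring lra.
Set Implicit Arguments.
Unset Strict Implicit.
Unset Printing Implicit Defensive.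
Import Order.TTheory GRing.Theory Num.Theory numFieldNormedType.Exports.
Local Open Scope classical_set_scope.
Local Open Scope ring_scope.

(* Each estimator is a Euclidean norm of local seminorms, so by the triangle
   inequality only the differences on the common triangles have to be bounded.
   Hessians are piecewise constant, and a common triangle has the same edges and
   (up to refinement) the same neighbours in both meshes; hence the jump terms
   follow from shape regularity, which bisection preserves by the parallelogram
   law.

   The volume residual needs a bound of the L^2 norm of yhat - y on the common
   triangles, although yhat - y belongs to neither Morley space. Let I be the
   Morley interpolation onto the coarse mesh, defined by vertex values and mean
   gradients on edges. Then D^2 (I yhat) is the mean of D^2 yhat, so w := I yhat - y
   satisfies |||w||| <= |||yhat - y|||, and w = yhat - y on common triangles. Now w
   is a coarse Morley function: its vertex values are those of J w in H^2_0, hence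
   bounded by |||J w||| <= C_J |||w|||, since a test function f satisfies
   |f| <= \int |d_1 d_2 f|. *)

(** * Quadratic polynomials *)

(** The interpolant is built backwards along the bisection history, undoing one bisection at a time.
    The invariant therefore refers to the fine function alone, through its vertex values and the
    mean of its full gradient over each edge. The full gradient is admissible because its tangential
    part is already fixed by the two end values. When a bisection is undone, the Hessian on the
    parent is the average over two children of equal area, so by convexity the distance to a coarse
    function cannot grow. Vertex values alone do not control a quadratic between the vertices: the
    error of linear interpolation is of order $h_T^2$ times the Hessian, which the energy controls.
    Powers of $h_T$ are bounded by powers of the total area, which bisection preserves. Thus
    $\Lambda_1$ depends only on the area and shape of the initial mesh, the measure of $\Omega$ and
    $C_J$. *)

Lemma ord2 (k : 'I_2) : k = ord0 \/ k = lift ord0 ord0.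
Proof. by case: k => -[|[|//]] hk; [left|right]; exact: val_inj. Qed.

Section Quadratics.
Variable R : realType.
Implicit Types (p q : poly2 R) (x : pt R).

Definition cf p (i j : nat) : R := p`_i`_j.

Lemma cf_add p q i j : cf (p + q) i j = cf p i j + cf q i j.
Proof. by rewrite /cf !coefD. Qed.

Lemma cf_opp p i j : cf (- p) i j = - cf p i j.
Proof. by rewrite /cf !coefN. Qed.

Lemma cf_pd0 p i j : cf (pd ord0 p) i j = cf p i.+1 j *+ i.+1.
Proof. by rewrite /cf /pd eqxx coef_deriv coefMn. Qed.

Lemma cf_pd1 p i j : cf (pd (lift ord0 ord0) p) i j = cf p i j.+1 *+ j.+1.
Proof. by rewrite /cf /pd /= coef_map_id0 ?deriv0// coef_deriv. Qed.

Lemma total_degree_le_sub d p q :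
  total_degree_le d p -> total_degree_le d q -> total_degree_le d (p - q).
Proof.
move=> hp hq i j dij; have := cf_add p (- q) i j; rewrite cf_opp /cf => ->.
by rewrite hp// hq// subr0.
Qed.

Lemma total_degree_le_pd d k p : total_degree_le d p -> total_degree_le d (pd k p).
Proof.
move=> hp i j dij; rewrite -/(cf _ i j).
have [->|->] := ord2 k.
- by rewrite cf_pd0 /cf hp ?mul0rn// ltnW// ltnS.
- by rewrite cf_pd1 /cf hp ?mul0rn// addnS ltnW// ltnS.
Qed.

Lemma ev_quad p x : total_degree_le 2 p ->
  ev p x = cf p 0 0 + cf p 1 0 * x.1 + cf p 0 1 * x.2
    + cf p 2 0 * x.1 ^+ 2 + cf p 1 1 * (x.1 * x.2) + cf p 0 2 * x.2 ^+ 2.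
Proof.
move=> hp.
have s3 : (size p <= 3)%N.
  apply/leq_sizeP => i i3; apply/polyP => j; rewrite coef0; apply: hp.
  by rewrite ltn_addr.
have s3i i : (size (p`_i)%R <= 3)%N.
  by apply/leq_sizeP => j j3; apply: hp; rewrite ltn_addl.
rewrite /ev (horner_coef_wide _ s3) !big_ord_recl big_ord0 /=.
rewrite !hornerD !hornerM !horner_exp !hornerC ?horner0.
rewrite !(horner_coef_wide _ (s3i _)) !big_ord_recl !big_ord0 /= /bump /=.
have -> : (p`_1)%R`_2 = 0 by exact: hp.
have -> : (p`_2)%R`_1 = 0 by exact: hp.
have -> : (p`_2)%R`_2 = 0 by exact: hp.
rewrite /cf /=; ring.
Qed.

(* For total degree at most 2, the partial derivatives of p at x and the entries
   of its constant Hessian. *)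
Definition gr0 p x : R := cf p 1 0 + 2 * cf p 2 0 * x.1 + cf p 1 1 * x.2.
Definition gr1 p x : R := cf p 0 1 + cf p 1 1 * x.1 + 2 * cf p 0 2 * x.2.

Lemma ev_pd0 p x : total_degree_le 2 p -> ev (pd ord0 p) x = gr0 p x.
Proof.
move=> hp; rewrite ev_quad; last exact: total_degree_le_pd.
rewrite !cf_pd0 /gr0.
have -> : cf p 3 0 = 0 by exact: hp.
have -> : cf p 2 1 = 0 by exact: hp.
have -> : cf p 1 2 = 0 by exact: hp.
by rewrite !mul0rn; ring.
Qed.

Lemma ev_pd1 p x : total_degree_le 2 p -> ev (pd (lift ord0 ord0) p) x = gr1 p x.
Proof.
move=> hp; rewrite ev_quad; last exact: total_degree_le_pd.
rewrite !cf_pd1 /gr1.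
have -> : cf p 0 3 = 0 by exact: hp.
have -> : cf p 2 1 = 0 by exact: hp.
have -> : cf p 1 2 = 0 by exact: hp.
by rewrite !mul0rn; ring.
Qed.

(** For total degree at most 2 the constant coefficient is the whole Hessian entry. Read off from
    coefficients, it is additive for all polynomials. *)
Definition hs p (i j : 'I_2) : R := cf (hess i j p) 0 0.

Lemma ev_hess p i j x : total_degree_le 2 p -> ev (hess i j p) x = hs p i j.
Proof.
move=> hp; rewrite /hess /hs ev_quad; last by do 2 apply: total_degree_le_pd.
have h0 a b : (2 < a + b)%N -> cf p a b = 0 by exact: hp.
by have [->|->] := ord2 i; have [->|->] := ord2 j;
  rewrite ?(cf_pd0, cf_pd1) ?(h0 3 0, h0 0 3, h0 2 1, h0 1 2, h0 4 0, h0 0 4,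
    h0 3 1, h0 1 3, h0 2 2)//; ring.
Qed.

Lemma hs_sub p q i j : hs (p - q) i j = hs p i j - hs q i j.
Proof.
by rewrite /hs /hess; have [->|->] := ord2 i; have [->|->] := ord2 j;
  rewrite ?(cf_pd0, cf_pd1, cf_add, cf_opp)//; ring.
Qed.

Lemma hs00 p : hs p ord0 ord0 = 2 * cf p 2 0.
Proof. by rewrite /hs /hess !cf_pd0; ring. Qed.
Lemma hs01 p : hs p ord0 (lift ord0 ord0) = cf p 1 1.
Proof. by rewrite /hs /hess cf_pd0 cf_pd1; ring. Qed.
Lemma hs10 p : hs p (lift ord0 ord0) ord0 = cf p 1 1.
Proof. by rewrite /hs /hess cf_pd1 cf_pd0; ring. Qed.
Lemma hs11 p : hs p (lift ord0 ord0) (lift ord0 ord0) = 2 * cf p 0 2.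
Proof. by rewrite /hs /hess !cf_pd1; ring. Qed.

(* squared Frobenius norm of the Hessian *)
Definition hsq p : R := (2 * cf p 2 0) ^+ 2 + 2 * cf p 1 1 ^+ 2 + (2 * cf p 0 2) ^+ 2.

Lemma hsq_ge0 p : 0 <= hsq p.
Proof. by rewrite /hsq; nra. Qed.

Lemma hsqE p : hsq p = \sum_(i < 2) \sum_(j < 2) hs p i j * hs p i j.
Proof. by rewrite !big_ord_recl !big_ord0 !(hs00, hs01, hs10, hs11) /hsq; ring. Qed.

Definition mkquad (c00 c10 c01 c20 c11 c02 : R) : poly2 R :=
  \poly_(i < 3) \poly_(j < 3)
    (if (i == 0)%N then (if (j == 0)%N then c00 else if (j == 1)%N then c01 else c02)
     else if (i == 1)%N then (if (j == 0)%N then c10 else if (j == 1)%N then c11 else 0)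
     else if (j == 0)%N then c20 else 0).

Lemma mkquad_deg c00 c10 c01 c20 c11 c02 :
  total_degree_le 2 (mkquad c00 c10 c01 c20 c11 c02).
Proof.
move=> i j ij; rewrite coef_poly; case: ltnP => [|_]; last by rewrite coef0.
by case: i ij => [|[|[|//]]] ij _; rewrite coef_poly; case: ltnP => //;
  case: j ij => [|[|[|//]]].
Qed.

Lemma mkquadE c00 c10 c01 c20 c11 c02 (q := mkquad c00 c10 c01 c20 c11 c02) :
  [/\ cf q 0 0 = c00, cf q 1 0 = c10, cf q 0 1 = c01 &
   [/\ cf q 2 0 = c20, cf q 1 1 = c11 & cf q 0 2 = c02]].
Proof. by rewrite /cf /q /mkquad !coef_poly. Qed.

End Quadratics.

(** * Quadratics on a triangle: midpoint gradients and linear interpolation *)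

Section TriangleQuadratics.
Variable R : realType.
Implicit Types (p q : poly2 R) (x A B : pt R) (t : tri R).

Definition det t : R :=
  (t.1.2.1 - t.1.1.1) * (t.2.2 - t.1.1.2) - (t.1.2.2 - t.1.1.2) * (t.2.1 - t.1.1.1).

(** The gradient is affine, so the midpoint rule integrates it exactly along the segment. *)
Lemma midpoint_grad q A B : total_degree_le 2 q ->
  (B.1 - A.1) * gr0 q (midpoint (A, B)) + (B.2 - A.2) * gr1 q (midpoint (A, B))
    = ev q B - ev q A.
Proof. by move=> hq; rewrite !ev_quad// /gr0 /gr1 /midpoint /=; field. Qed.

(** Three gradients and one value are seven data for six coefficients. The one compatibility
    condition is that the tangential increments around the triangle sum to zero. *)
Lemma exists_quad t (ga gb gc : pt R) (v : R) : det t != 0 ->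
  (t.1.2.1 - t.1.1.1) * ga.1 + (t.1.2.2 - t.1.1.2) * ga.2
  + ((t.2.1 - t.1.2.1) * gb.1 + (t.2.2 - t.1.2.2) * gb.2)
  + ((t.1.1.1 - t.2.1) * gc.1 + (t.1.1.2 - t.2.2) * gc.2) = 0 ->
  exists q, [/\ total_degree_le 2 q, ev q t.1.1 = v &
   [/\ gr0 q (midpoint (t.1.1, t.1.2)) = ga.1 /\ gr1 q (midpoint (t.1.1, t.1.2)) = ga.2,
       gr0 q (midpoint (t.1.2, t.2)) = gb.1 /\ gr1 q (midpoint (t.1.2, t.2)) = gb.2
     & gr0 q (midpoint (t.2, t.1.1)) = gc.1 /\ gr1 q (midpoint (t.2, t.1.1)) = gc.2]].
Proof.
case: t => [[[a1 a2] [b1 b2]] [c1 c2]]; case: ga => u1 u2; case: gb => v1 v2.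
case: gc => w1 w2; rewrite /det /= => d0 h.
set d := (X in X != 0) in d0.
pose s1 := 2 * (v1 - u1); pose s2 := 2 * (v2 - u2).
pose r1 := 2 * (w1 - u1); pose r2 := 2 * (w2 - u2).
(* The Hessian is the matrix H with H (c - a) = s and H (c - b) = r. *)
pose e := (c1 - a1) * (c2 - b2) - (c2 - a2) * (c1 - b1).
have eE : e = d by rewrite /e /d; ring.
pose h00 := (s1 * (c2 - b2) - r1 * (c2 - a2)) / d.
pose h01 := (r1 * (c1 - a1) - s1 * (c1 - b1)) / d.
pose h11 := (r2 * (c1 - a1) - s2 * (c1 - b1)) / d.
(* Symmetry of the Hessian: the two expressions for its off-diagonal entry agree exactly because of
   the closing condition [h]. *)
have h01' : h01 = (s2 * (c2 - b2) - r2 * (c2 - a2)) / d.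
  apply/eqP; rewrite /h01 -subr_eq0 -mulrBl mulf_eq0; apply/orP; left; apply/eqP.
  rewrite /r1 /s1 /r2 /s2.
  transitivity (- 2 * ((b1 - a1) * u1 + (b2 - a2) * u2 + ((c1 - b1) * v1 + (c2 - b2) * v2)
    + ((a1 - c1) * w1 + (a2 - c2) * w2))); last by rewrite h mulr0.
  by ring.
have H1 : h00 * (c1 - a1) + h01 * (c2 - a2) = s1.
  by rewrite -[RHS](mulfK d0) /h00 /h01; rewrite -{3}eE /e; field.
have H2 : h00 * (c1 - b1) + h01 * (c2 - b2) = r1.
  by rewrite -[RHS](mulfK d0) /h00 /h01; rewrite -{3}eE /e; field.
have H3 : h01 * (c1 - a1) + h11 * (c2 - a2) = s2.
  by rewrite h01' -[RHS](mulfK d0) /h11; rewrite -{3}eE /e; field.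
have H4 : h01 * (c1 - b1) + h11 * (c2 - b2) = r2.
  by rewrite h01' -[RHS](mulfK d0) /h11; rewrite -{3}eE /e; field.
move: h00 h01 h11 h01' H1 H2 H3 H4 => h00 h01 h11 _ H1 H2 H3 H4.
pose l1 := u1 - h00 * ((a1 + b1) / 2) - h01 * ((a2 + b2) / 2).
pose l2 := u2 - h01 * ((a1 + b1) / 2) - h11 * ((a2 + b2) / 2).
pose l0 := v - (l1 * a1 + l2 * a2 + h00 / 2 * a1 ^+ 2 + h01 * (a1 * a2) + h11 / 2 * a2 ^+ 2).
have := mkquad_deg l0 l1 l2 (h00 / 2) h01 (h11 / 2).
have := mkquadE l0 l1 l2 (h00 / 2) h01 (h11 / 2).
set q := mkquad _ _ _ _ _ _ => -[q1 q2 q3 [q4 q5 q6]] qd.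
exists q; split => //; first by rewrite ev_quad// q1 q2 q3 q4 q5 q6 /l0 /=; ring.
rewrite /gr0 /gr1 q2 q3 q4 q5 q6 /midpoint /=; split; split.
- by rewrite /l1; field.
- by rewrite /l2; field.
- have -> : v1 = u1 + s1 / 2 by rewrite /s1; field.
  by rewrite -H1 /l1; field.
- have -> : v2 = u2 + s2 / 2 by rewrite /s2; field.
  by rewrite -H3 /l2; field.
- have -> : w1 = u1 + r1 / 2 by rewrite /r1; field.
  by rewrite -H2 /l1; field.
- have -> : w2 = u2 + r2 / 2 by rewrite /r2; field.
  by rewrite -H4 /l2; field.
Qed.

Lemma solve2 (u1 u2 w1 w2 x y : R) : u1 * w2 - u2 * w1 != 0 ->
  x * u1 + y * u2 = 0 -> x * w1 + y * w2 = 0 -> x = 0 /\ y = 0.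
Proof.
move=> d0 h1 h2; split; apply: (mulfI d0); rewrite mulr0.
- transitivity (w2 * (x * u1 + y * u2) - u2 * (x * w1 + y * w2)); first by ring.
  by rewrite h1 h2; ring.
- transitivity (u1 * (x * w1 + y * w2) - w1 * (x * u1 + y * u2)); first by ring.
  by rewrite h1 h2; ring.
Qed.

(** Differences of midpoint gradients are the Hessian applied to half an edge vector, and two edge
    vectors are independent. So the Hessians agree, then the gradients, then the values. *)
Lemma quad_unique t q q' : det t != 0 -> total_degree_le 2 q -> total_degree_le 2 q' ->
  ev q t.1.1 = ev q' t.1.1 ->
  (forall E, E \in edges t -> gr0 q (midpoint E) = gr0 q' (midpoint E) /\
     gr1 q (midpoint E) = gr1 q' (midpoint E)) ->
  [/\ (forall x, ev q x = ev q' x), (forall i j, hs q i j = hs q' i j) & hsq (q - q') = 0].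
Proof.
move=> d0 hq hq' ha hE.
have [] := hE (t.1.1, t.1.2); first by rewrite !inE eqxx.
have [] := hE (t.1.2, t.2); first by rewrite !inE eqxx orbT.
have [] := hE (t.2, t.1.1); first by rewrite !inE eqxx !orbT.
move: ha d0 {hE}; case: t => [[[a1 a2] [b1 b2]] [c1 c2]].
rewrite /det /gr0 /gr1 /midpoint /= !ev_quad//=.
set e00 := cf q 0 0; set e10 := cf q 1 0; set e01 := cf q 0 1.
set e20 := cf q 2 0; set e11 := cf q 1 1; set e02 := cf q 0 2.
set f00 := cf q' 0 0; set f10 := cf q' 1 0; set f01 := cf q' 0 1.
set f20 := cf q' 2 0; set f11 := cf q' 1 1; set f02 := cf q' 0 2.
move=> ha d0 h1 h2 h3 h4 h5 h6.
have d0' : (c1 - a1) * (c2 - b2) - (c2 - a2) * (c1 - b1) != 0.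
  by apply: contra_neq d0 => h; rewrite -h; ring.
have [x1 x2] : 2 * (e20 - f20) = 0 /\ e11 - f11 = 0.
  by apply: (solve2 d0'); [move: h3 h5|move: h1 h5]; lra.
have [_ y2] : e11 - f11 = 0 /\ 2 * (e02 - f02) = 0.
  by apply: (solve2 d0'); [move: h4 h6|move: h2 h6]; lra.
have k1 : e20 = f20 by lra.
have k2 : e11 = f11 by lra.
have k3 : e02 = f02 by lra.
have k4 : e10 = f10 by move: h5; rewrite k1 k2; lra.
have k5 : e01 = f01 by move: h6; rewrite k2 k3; lra.
have k6 : e00 = f00 by move: ha; rewrite k1 k2 k3 k4 k5; lra.
split=> [x|i j|].
- rewrite !ev_quad// -/e00 -/e10 -/e01 -/e20 -/e11 -/e02 k1 k2 k3 k4 k5 k6.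
  by [].
- by have [->|->] := ord2 i; have [->|->] := ord2 j;
    rewrite ?(hs00,hs01,hs10,hs11) -?/e20 -?/e11 -?/e02 ?k1 ?k2 ?k3.
- rewrite /hsq !cf_add !cf_opp -/e20 -/e11 -/e02 k1 k2 k3 -/f20 -/f11 -/f02; ring.
Qed.

(* Integrating by parts, |t| D^2 q is the sum over the edges of the outer product of
   the normal and the midpoint gradient; the common edge of the children cancels. *)
Lemma hess_bisect t q q1 q2 (m := midpoint t.1) : det t != 0 ->
  gr0 q (midpoint t.1) = (gr0 q1 (midpoint (t.1.1, m)) + gr0 q2 (midpoint (m, t.1.2))) / 2 ->
  gr1 q (midpoint t.1) = (gr1 q1 (midpoint (t.1.1, m)) + gr1 q2 (midpoint (m, t.1.2))) / 2 ->
  gr0 q (midpoint (t.1.2, t.2)) = gr0 q2 (midpoint (t.1.2, t.2)) ->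
  gr1 q (midpoint (t.1.2, t.2)) = gr1 q2 (midpoint (t.1.2, t.2)) ->
  gr0 q (midpoint (t.2, t.1.1)) = gr0 q1 (midpoint (t.2, t.1.1)) ->
  gr1 q (midpoint (t.2, t.1.1)) = gr1 q1 (midpoint (t.2, t.1.1)) ->
  gr0 q1 (midpoint (m, t.2)) = gr0 q2 (midpoint (m, t.2)) ->
  gr1 q1 (midpoint (m, t.2)) = gr1 q2 (midpoint (m, t.2)) ->
  [/\ cf q 2 0 = (cf q1 2 0 + cf q2 2 0) / 2, cf q 1 1 = (cf q1 1 1 + cf q2 1 1) / 2
    & cf q 0 2 = (cf q1 0 2 + cf q2 0 2) / 2].
Proof.
rewrite {}/m; case: t => [[[a1 a2] [b1 b2]] [c1 c2]].
rewrite /det /gr0 /gr1 /midpoint /=.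
set e10 := cf q 1 0; set e01 := cf q 0 1.
set e20 := cf q 2 0; set e11 := cf q 1 1; set e02 := cf q 0 2.
set f10 := cf q1 1 0; set f01 := cf q1 0 1.
set f20 := cf q1 2 0; set f11 := cf q1 1 1; set f02 := cf q1 0 2.
set g10 := cf q2 1 0; set g01 := cf q2 0 1.
set g20 := cf q2 2 0; set g11 := cf q2 1 1; set g02 := cf q2 0 2.
move=> d0 h1 h2 h3 h4 h5 h6 h7 h8.
have d0' : (c1 - a1) * (c2 - b2) - (c2 - a2) * (c1 - b1) != 0.
  by apply: contra_neq d0 => h; rewrite -h; ring.
have [x1 x2] : 2 * (e20 - (f20 + g20) / 2) = 0 /\ e11 - (f11 + g11) / 2 = 0.
  by apply: (solve2 d0'); [move: h1 h3 h5 h7|move: h1 h3 h5 h7]; lra.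
have [_ y2] : e11 - (f11 + g11) / 2 = 0 /\ 2 * (e02 - (f02 + g02) / 2) = 0.
  by apply: (solve2 d0'); [move: h2 h4 h6 h8|move: h2 h4 h6 h8]; lra.
by split; lra.
Qed.

(** [Q] is the Hessian form on an edge vector, and the last term is the exact error of linear
    interpolation. *)
Lemma quad_interp t q l0 l1 l2 : total_degree_le 2 q -> l0 + l1 + l2 = 1 ->
  let Q (A B : pt R) := 2 * cf q 2 0 * (A.1 - B.1) ^+ 2
     + 2 * cf q 1 1 * ((A.1 - B.1) * (A.2 - B.2)) + 2 * cf q 0 2 * (A.2 - B.2) ^+ 2 in
  ev q (tri_point t l0 l1 l2) = l0 * ev q t.1.1 + l1 * ev q t.1.2 + l2 * ev q t.2
    - (l0 * l1 * Q t.1.1 t.1.2 + l1 * l2 * Q t.1.2 t.2 + l2 * l0 * Q t.2 t.1.1) / 2.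
Proof.
move=> hq hl Q; have -> : l0 = 1 - l1 - l2 by lra.
by rewrite !ev_quad// /Q /tri_point /=; field.
Qed.

End TriangleQuadratics.

(** * Triangles *)

Section Triangles.
Variable R : realType.
Implicit Types (x z A B : pt R) (t k : tri R) (E F : pt R * pt R) (M : {fset tri R}).

Lemma pt_eq x z : x.1 = z.1 -> x.2 = z.2 -> x = z.
Proof. by case: x => ? ?; case: z => ? ? /= -> ->. Qed.

(** Barycentric coordinates by Cramer's rule; as affine functions of the point they also serve for
    openness and measurability. *)
Definition bc1 t x : R :=
  ((x.1 - t.1.1.1) * (t.2.2 - t.1.1.2) - (x.2 - t.1.1.2) * (t.2.1 - t.1.1.1)) / det t.
Definition bc2 t x : R :=
  ((t.1.2.1 - t.1.1.1) * (x.2 - t.1.1.2) - (t.1.2.2 - t.1.1.2) * (x.1 - t.1.1.1)) / det t.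
Definition bc0 t x : R := 1 - bc1 t x - bc2 t x.

Lemma bcK t x : det t != 0 -> tri_point t (bc0 t x) (bc1 t x) (bc2 t x) = x.
Proof.
move=> d0; apply: pt_eq; rewrite /tri_point /bc0 /bc1 /bc2 /=;
  move: (d0); rewrite /det => d0'; field; done.
Qed.

Lemma bc_tri_point t l0 l1 l2 : det t != 0 -> l0 + l1 + l2 = 1 ->
  let x := tri_point t l0 l1 l2 in [/\ bc0 t x = l0, bc1 t x = l1 & bc2 t x = l2].
Proof.
move=> d0 h x; have {h} h : l0 = 1 - l1 - l2 by lra.
have e1 : bc1 t x = l1.
  by rewrite /bc1 /x /tri_point h /=; move: d0; rewrite /det => d0; field.
have e2 : bc2 t x = l2.
  by rewrite /bc2 /x /tri_point h /=; move: d0; rewrite /det => d0; field.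
by rewrite /bc0 e1 e2.
Qed.

Lemma tsetP t x : det t != 0 ->
  tset t x <-> [/\ 0 <= bc0 t x, 0 <= bc1 t x & 0 <= bc2 t x].
Proof.
move=> d0; split.
  by move=> [l0 [l1 [l2 [h0 h1 h2 h ->]]]]; have [-> -> ->] := bc_tri_point d0 h.
move=> [h0 h1 h2]; exists (bc0 t x), (bc1 t x), (bc2 t x); split => //.
  by rewrite /bc0; ring.
by rewrite bcK.
Qed.

Lemma tintP t x : det t != 0 ->
  tint t x <-> [/\ 0 < bc0 t x, 0 < bc1 t x & 0 < bc2 t x].
Proof.
move=> d0; split.
  by move=> [l0 [l1 [l2 [h0 h1 h2 h ->]]]]; have [-> -> ->] := bc_tri_point d0 h.
move=> [h0 h1 h2]; exists (bc0 t x), (bc1 t x), (bc2 t x); split => //.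
  by rewrite /bc0; ring.
by rewrite bcK.
Qed.

Lemma tint_tset t : tint t `<=` tset t.
Proof.
by move=> x [l0 [l1 [l2 [h0 h1 h2 h ->]]]]; exists l0, l1, l2; split=> //; exact: ltW.
Qed.

Lemma tint_nonempty t : tint t !=set0.
Proof.
exists (tri_point t (3^-1) (3^-1) (3^-1)), 3^-1, 3^-1, 3^-1.
by split=> //; rewrite ?invr_gt0 ?ltr0n//; field.
Qed.

Lemma vert_tset t z : z \in verts t -> tset t z.
Proof.
rewrite !inE => /or3P[] /eqP ->; [exists 1, 0, 0|exists 0, 1, 0|exists 0, 0, 1];
  by split=> //; rewrite ?addr0 ?add0r//; apply: pt_eq; rewrite /tri_point /=; ring.
Qed.

Lemma det_child1 t : det (child1 t) = det t / 2.
Proof. by rewrite /det /child1 /midpoint /=; field. Qed.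
Lemma det_child2 t : det (child2 t) = det t / 2.
Proof. by rewrite /det /child2 /midpoint /=; field. Qed.

Lemma child1_point t l0 l1 l2 :
  tri_point (child1 t) l0 l1 l2 = tri_point t (l1 + l2 / 2) (l2 / 2) l0.
Proof. by apply: pt_eq; rewrite /tri_point /child1 /midpoint /=; field. Qed.
Lemma child2_point t l0 l1 l2 :
  tri_point (child2 t) l0 l1 l2 = tri_point t (l2 / 2) (l0 + l2 / 2) l1.
Proof. by apply: pt_eq; rewrite /tri_point /child2 /midpoint /=; field. Qed.

Lemma tset_child1 t : tset (child1 t) `<=` tset t.
Proof.
move=> x [l0 [l1 [l2 [h0 h1 h2 h ->]]]]; rewrite child1_point.
by exists (l1 + l2 / 2), (l2 / 2), l0; split => //; lra.
Qed.
Lemma tset_child2 t : tset (child2 t) `<=` tset t.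
Proof.
move=> x [l0 [l1 [l2 [h0 h1 h2 h ->]]]]; rewrite child2_point.
by exists (l2 / 2), (l0 + l2 / 2), l1; split => //; lra.
Qed.
Lemma tint_child1 t : tint (child1 t) `<=` tint t.
Proof.
move=> x [l0 [l1 [l2 [h0 h1 h2 h ->]]]]; rewrite child1_point.
by exists (l1 + l2 / 2), (l2 / 2), l0; split => //; lra.
Qed.
Lemma tint_child2 t : tint (child2 t) `<=` tint t.
Proof.
move=> x [l0 [l1 [l2 [h0 h1 h2 h ->]]]]; rewrite child2_point.
by exists (l2 / 2), (l0 + l2 / 2), l1; split => //; lra.
Qed.

(** The median to the refinement edge separates the children: [bc0] exceeds [bc1] inside the first
    and is smaller inside the second. *)
Lemma tint_children t : det t != 0 -> tint (child1 t) `&` tint (child2 t) = set0.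
Proof.
move=> d0; apply/seteqP; split => // x [[l0 [l1 [l2 [h0 h1 h2 h ->]]]]].
move=> [k0 [k1 [k2 [g0 g1 g2 g]]]]; rewrite child1_point child2_point => e.
have h' : l1 + l2 / 2 + l2 / 2 + l0 = 1 by lra.
have g' : k2 / 2 + (k0 + k2 / 2) + k1 = 1 by lra.
have [a0 a1 a2] := bc_tri_point d0 h'.
have [b0 b1 b2] := bc_tri_point d0 g'.
by move: a0 a1; rewrite e b0 b1; lra.
Qed.

Lemma has_edgeP t E : reflect (exists2 F, F \in edges t & same_edge E F) (has_edge t E).
Proof. exact: hasP. Qed.

Lemma same_edgeP E F : reflect (E = F \/ E = (F.2, F.1)) (same_edge E F).
Proof. by apply: (iffP orP) => -[/eqP|/eqP] h; [left|right|left|right]; rewrite ?h//; apply/eqP. Qed.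

Lemma same_edgexx E : same_edge E E.
Proof. by apply/same_edgeP; left. Qed.

Lemma same_edgeC E F : same_edge E F = same_edge F E.
Proof.
by apply/same_edgeP/same_edgeP => -[->|->]; [left|right|left|right] => //=;
  rewrite -surjective_pairing.
Qed.

Lemma same_edge_trans E F G : same_edge E F -> same_edge F G -> same_edge E G.
Proof.
move=> /same_edgeP h /same_edgeP g; apply/same_edgeP.
by case: h g => -> [->|->] /=; [left|right|right|left] => //; rewrite -surjective_pairing.
Qed.

Lemma has_edge_same t E F : same_edge E F -> has_edge t E = has_edge t F.
Proof.
move=> h; apply/has_edgeP/has_edgeP => -[G Gt g]; exists G => //.
  by apply: same_edge_trans g; rewrite same_edgeC.
exact: same_edge_trans g.
Qed.

Lemma edge_has_edge t E : E \in edges t -> has_edge t E.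
Proof. by move=> h; apply/has_edgeP; exists E => //; exact: same_edgexx. Qed.

Lemma seg_rev A B : seg (A, B) = seg (B, A).
Proof.
by apply/seteqP; split => _ [s /andP[s0 s1] ->]; exists (1 - s); rewrite ?subr_ge0 ?lerBlDr ?lerDl ?s0 ?s1//;
  apply: pt_eq; rewrite /edge_point /=; ring.
Qed.

Lemma midpoint_rev A B : midpoint (A, B) = midpoint (B, A).
Proof. by rewrite /midpoint /= ![A.1 + _]addrC ![A.2 + _]addrC. Qed.

Lemma midpoint_same E F : same_edge E F -> midpoint E = midpoint F.
Proof. by case: E F => A B [C D] /same_edgeP[->|->]//=; rewrite midpoint_rev. Qed.

Lemma seg_endl E : seg E E.1.
Proof. by exists 0; rewrite ?lexx ?ler01//; apply: pt_eq; rewrite /edge_point /=; ring. Qed.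
Lemma seg_endr E : seg E E.2.
Proof. by exists 1; rewrite ?lexx ?ler01//; apply: pt_eq; rewrite /edge_point /=; ring. Qed.
Lemma seg_mid E : seg E (midpoint E).
Proof.
exists (1 / 2); first by apply/andP; split; lra.
by apply: pt_eq; rewrite /edge_point /midpoint /=; field.
Qed.

Lemma seg_half1 A B : seg (A, midpoint (A, B)) `<=` seg (A, B).
Proof.
move=> _ [s /andP[s0 s1] ->]; exists (s / 2); first by apply/andP; split; lra.
by apply: pt_eq; rewrite /edge_point /midpoint /=; field.
Qed.
Lemma seg_half2 A B : seg (midpoint (A, B), B) `<=` seg (A, B).
Proof. by rewrite seg_rev (seg_rev A) midpoint_rev; exact: seg_half1. Qed.

Lemma det_rot t : det (t.1.2, t.2, t.1.1) = det t.
Proof. by rewrite /det /=; ring. Qed.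
Lemma det_swap t : det (t.1.2, t.1.1, t.2) = - det t.
Proof. by rewrite /det /=; ring. Qed.
Lemma tint_rot t : tint (t.1.2, t.2, t.1.1) = tint t.
Proof.
apply/seteqP; split => x [l0 [l1 [l2 [h0 h1 h2 h ->]]]].
  exists l2, l0, l1; split => //; first by lra.
  by apply: pt_eq; rewrite /tri_point /=; ring.
exists l1, l2, l0; split => //; first by lra.
by apply: pt_eq; rewrite /tri_point /=; ring.
Qed.
Lemma tint_swap t : tint (t.1.2, t.1.1, t.2) = tint t.
Proof.
apply/seteqP; split => x [l0 [l1 [l2 [h0 h1 h2 h ->]]]];
 (exists l1, l0, l2; split => //; first by lra);
 by apply: pt_eq; rewrite /tri_point /=; ring.
Qed.
Lemma tset_rot t : tset (t.1.2, t.2, t.1.1) = tset t.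
Proof.
apply/seteqP; split => x [l0 [l1 [l2 [h0 h1 h2 h ->]]]].
  exists l2, l0, l1; split => //; first by lra.
  by apply: pt_eq; rewrite /tri_point /=; ring.
exists l1, l2, l0; split => //; first by lra.
by apply: pt_eq; rewrite /tri_point /=; ring.
Qed.
Lemma tset_swap t : tset (t.1.2, t.1.1, t.2) = tset t.
Proof.
apply/seteqP; split => x [l0 [l1 [l2 [h0 h1 h2 h ->]]]];
 (exists l1, l0, l2; split => //; first by lra);
 by apply: pt_eq; rewrite /tri_point /=; ring.
Qed.

(* E completed by the opposite vertex c is t up to a permutation of its vertices *)
Lemma has_edge_apex t E : has_edge t E -> exists c,
  [/\ tint (E, c) = tint t, tset (E, c) = tset t, `|det (E, c)| = `|det t|
    & verts t =i verts (E, c)].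
Proof.
have rot F c : [/\ tint (F.2, c, F.1) = tint (F, c), tset (F.2, c, F.1) = tset (F, c),
    `|det (F.2, c, F.1)| = `|det (F, c)| & verts (F.2, c, F.1) =i verts (F, c)].
  split.
  - exact: (tint_rot (F, c)).
  - exact: (tset_rot (F, c)).
  - by rewrite (det_rot (F, c)).
  - by move=> z; rewrite !inE orbC -orbA orbC -!orbA.
have swap F c : [/\ tint (F.2, F.1, c) = tint (F, c), tset (F.2, F.1, c) = tset (F, c),
    `|det (F.2, F.1, c)| = `|det (F, c)| & verts (F.2, F.1, c) =i verts (F, c)].
  split.
  - exact: (tint_swap (F, c)).
  - exact: (tset_swap (F, c)).
  - by rewrite (det_swap (F, c)) normrN.
  - by move=> z; rewrite !inE orbCA.
have H F : F \in edges t -> exists c,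
    [/\ tint (F, c) = tint t, tset (F, c) = tset t, `|det (F, c)| = `|det t|
    & verts t =i verts (F, c)].
  case: t => -[a b] c; rewrite !inE => /or3P[] /eqP ->.
  - by exists c.
  - exists a; have [h1 h2 h3 h4] := rot (a, b) c; rewrite /= in h1 h2 h3 h4.
    by split => //; move=> z; rewrite h4.
  - exists b; have [h1 h2 h3 h4] := rot (c, a) b; rewrite /= in h1 h2 h3 h4.
    by split => // z.
move=> /has_edgeP[F /H [c [h1 h2 h3 h4]] /same_edgeP[->|->]]; first by exists c.
exists c; have [g1 g2 g3 g4] := swap F c; rewrite -h1 -h2 -h3; split => // z.
by rewrite h4 g4.
Qed.

Lemma has_edge_verts t E : has_edge t E -> E.1 \in verts t /\ E.2 \in verts t.
Proof.
by move=> /has_edge_apex[c [_ _ _ h]]; rewrite !h !inE /= !eqxx orbT.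
Qed.

Lemma seg_tset t E : has_edge t E -> seg E `<=` tset t.
Proof.
move=> /has_edge_apex[c [_ <- _ _]] _ [s /andP[s0 s1] ->].
exists (1 - s), s, 0; split; [lra|exact: s0|exact: lexx|lra|].
by apply: pt_eq; rewrite /tri_point /edge_point /=; ring.
Qed.

Lemma seg_not_tint t E x : det t != 0 -> has_edge t E -> seg E x -> ~ tint t x.
Proof.
move=> d0 /has_edge_apex[c [<- _ h _]] [s _ ->].
have {}d0 : det (E, c) != 0 by rewrite -normr_eq0 h normr_eq0.
move/(tintP _ d0) => -[_ _]; rewrite /bc2 /edge_point /=.
by set u := (X in X / _); have -> : u = 0; [rewrite /u; ring|rewrite mul0r ltxx].
Qed.

Lemma vert_has_edge t z : z \in verts t -> exists2 E, has_edge t E & z = E.1.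
Proof.
by rewrite !inE => /or3P[] /eqP ->; [exists (t.1.1, t.1.2)|exists (t.1.2, t.2)|
  exists (t.2, t.1.1)] => //; apply: edge_has_edge; rewrite !inE eqxx ?orbT.
Qed.

Lemma vert_not_tint t z : det t != 0 -> z \in verts t -> ~ tint t z.
Proof.
move=> d0 /vert_has_edge[E tE ->]; apply: seg_not_tint tE _ => //; exact: seg_endl.
Qed.

Lemma vert_on_edge t E z : det t != 0 -> has_edge t E -> z \in verts t -> seg E z ->
  z = E.1 \/ z = E.2.
Proof.
move=> d0 /has_edge_apex[c [_ _ h hv]]; rewrite hv !inE.
have {}d0 : det (E, c) != 0 by rewrite -normr_eq0 h normr_eq0.
case/or3P => /eqP ->; [by left|by right|] => -[s _ /= cE].
case/negP: d0; rewrite /det /= cE /edge_point /=; apply/eqP; ring.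
Qed.

Lemma edge_neq t E : det t != 0 -> has_edge t E -> E.1 <> E.2.
Proof.
move=> d0 /has_edge_apex[c [_ _ h _]] e.
have : det (E, c) != 0 by rewrite -normr_eq0 h normr_eq0.
by rewrite /det /= e; case/negP; apply/eqP; ring.
Qed.

Lemma edge_seg_sub t E F : det t != 0 -> has_edge t E -> has_edge t F ->
  seg E `<=` seg F -> same_edge E F.
Proof.
move=> d0 tE tF sEF; have [v1 v2] := has_edge_verts tE.
have n := edge_neq d0 tE.
have h1 := vert_on_edge d0 tF v1 (sEF _ (seg_endl _)).
have h2 := vert_on_edge d0 tF v2 (sEF _ (seg_endr _)).
apply/same_edgeP; case: E n h1 h2 {tE sEF v1 v2} => A B /= n.
move=> [h1|h1] [h2|h2]; rewrite h1 h2 in n *; rewrite -?surjective_pairing//.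
- by left.
- by right.
Qed.

Lemma seg_collinear t E : tset t `<=` seg E -> det t = 0.
Proof.
move=> h.
have [s _ ea] := h _ (@vert_tset t t.1.1 ltac:(by rewrite !inE eqxx)).
have [s' _ eb] := h _ (@vert_tset t t.1.2 ltac:(by rewrite !inE eqxx orbT)).
have [s'' _ ec] := h _ (@vert_tset t t.2 ltac:(by rewrite !inE eqxx !orbT)).
by rewrite /det ea eb ec /edge_point /=; ring.
Qed.

Lemma set1_degenerate t z : tset t `<=` [set z] -> det t = 0.
Proof.
move=> h.
have /= ea := h _ (@vert_tset t t.1.1 ltac:(by rewrite !inE eqxx)).
have /= eb := h _ (@vert_tset t t.1.2 ltac:(by rewrite !inE eqxx orbT)).
by rewrite /det ea eb; ring.
Qed.

Lemma child_edge t E : has_edge t E ->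
  [\/ same_edge E t.1, has_edge (child1 t) E | has_edge (child2 t) E].
Proof.
case/has_edgeP => F; rewrite !inE => /or3P[] /eqP -> h.
- by apply: Or31; rewrite (surjective_pairing t.1).
- by apply: Or33; apply/has_edgeP; exists (t.1.2, t.2) => //; rewrite !inE eqxx.
- by apply: Or32; apply/has_edgeP; exists (t.2, t.1.1) => //; rewrite !inE eqxx.
Qed.

(** Determinants of equal sign put both apexes on the same side of [E], so points slightly off the
    midpoint of [E] towards that side lie in both triangles. *)
Lemma same_side_overlap E c c' : 0 < det (E, c) * det (E, c') ->
  tint (E, c) `&` tint (E, c') !=set0.
Proof.
move=> dd.
have d0 : det (E, c) != 0 by apply: contraTN dd => /eqP ->; rewrite mul0r ltxx.
have d0' : det (E, c') != 0 by apply: contraTN dd => /eqP ->; rewrite mulr0 ltxx.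
set u := bc0 (E, c') c; set v := bc1 (E, c') c; pose w := bc2 (E, c') c.
have w0 : 0 < w.
  have -> : w = det (E, c) / det (E, c') by [].
  have : 0 < det (E, c) * det (E, c') / det (E, c') ^+ 2.
    by rewrite divr_gt0// exprn_even_gt0//= d0'.
  by rewrite expr2 invfM mulrA mulfK.
(* With this [e] one has $(1-e)/2 = e(1/2+|u|+|v|)$, which keeps the first two coordinates with
   respect to [(E, c')] positive. *)
pose e := (2 + 2 * `|u| + 2 * `|v|)^-1.
have den : 0 < 2 + 2 * `|u| + 2 * `|v| by have := normr_ge0 u; have := normr_ge0 v; lra.
have e0 : 0 < e by rewrite invr_gt0.
have e1 : e * (2 + 2 * `|u| + 2 * `|v|) = 1 by rewrite mulVf// gt_eqF.
have eu := ltac:(exact: (mulr_ge0 (ltW e0) (normr_ge0 u))).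
have ev := ltac:(exact: (mulr_ge0 (ltW e0) (normr_ge0 v))).
have eu' : - (e * `|u|) <= e * u by rewrite -mulrN ler_pM2l// lerNl -normrN ler_norm.
have ev' : - (e * `|v|) <= e * v by rewrite -mulrN ler_pM2l// lerNl -normrN ler_norm.
have {}e1 : 2 * e + 2 * (e * `|u|) + 2 * (e * `|v|) = 1 by rewrite -[RHS]e1; ring.
exists (tri_point (E, c) ((1 - e) / 2) ((1 - e) / 2) e); split.
  by exists ((1 - e) / 2), ((1 - e) / 2), e; split => //; lra.
exists ((1 - e) / 2 + e * u), ((1 - e) / 2 + e * v), (e * w).
split; [lra|lra|exact: mulr_gt0| |].
- have -> : w = 1 - u - v by rewrite /w /u /v /bc0; ring.
  by field.
- have := bcK c d0'; rewrite -/u -/v -/w.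
  by move=> <-; apply: pt_eq; rewrite /tri_point /=; field.
Qed.

End Triangles.

(** * Meshes and newest-vertex bisection *)

Section MeshLemmas.
Variable R : realType.
Implicit Types (Omega : set (pt R)) (x z A B : pt R) (t k : tri R) (E F : pt R * pt R)
  (M T : {fset tri R}).

Section Regular.
Variables (Omega : set (pt R)) (M : {fset tri R}).
Hypothesis reg : regular_triangulation Omega M.

Lemma regular_det t : t \in M -> det t != 0.
Proof. by case: reg => h _ _ /h. Qed.

Lemma regular_disjoint t k : t \in M -> k \in M -> t <> k -> tint t `&` tint k = set0.
Proof.
move=> tM kM tk; have dt := regular_det tM.
have [_ _ /(_ t k tM kM tk) H] := reg.
apply/seteqP; split => // x [xt xk].
have sx : (tset t `&` tset k) x by split; exact: tint_tset.
case: H => [h|[z [zt _ h]]|[E [Et _ h]]]; rewrite h in sx.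
- by [].
- by move: xt; rewrite sx; exact: vert_not_tint.
- exact: seg_not_tint Et sx xt.
Qed.

(** Two distinct triangles meet at most in an edge, which cannot contain a nondegenerate
    triangle. *)
Lemma regular_container_unique t t' k : det k != 0 -> t \in M -> t' \in M ->
  tset k `<=` tset t -> tset k `<=` tset t' -> t = t'.
Proof.
move=> dk tM t'M kt kt'; apply: contrapT => tt'.
have [_ _ /(_ t t' tM t'M tt') H] := reg.
have sk : tset k `<=` tset t `&` tset t' by move=> x xk; split; [exact: kt|exact: kt'].
case: H => [h|[z [_ _ h]]|[E [_ _ h]]]; rewrite h in sk.
- by have [x /tint_tset/sk] := tint_nonempty k.
- by move: dk; rewrite (set1_degenerate sk) eqxx.
- by move: dk; rewrite (seg_collinear sk) eqxx.
Qed.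

(** This is the absence of hanging nodes: the intersection of the two triangles is a common vertex
    or edge, so [z] is a vertex of [k] as well. *)
Lemma regular_vertex_on_edge k k' E z : k \in M -> k' \in M -> has_edge k E ->
  z \in verts k' -> seg E z -> z = E.1 \/ z = E.2.
Proof.
move=> kM k'M kE zk' Ez; have dk := regular_det kM; have dk' := regular_det k'M.
suff zk : z \in verts k by exact: vert_on_edge dk kE zk Ez.
have [<-//|/eqP kk'] := eqVneq k' k.
have [_ _ /(_ k' k k'M kM kk') H] := reg.
have sz : (tset k' `&` tset k) z by split; [exact: vert_tset|exact: (seg_tset kE)].
case: H => [h|[z' [_ z'k h]]|[F [k'F kF h]]]; rewrite h in sz.
- by [].
- by rewrite sz.
- have [v1 v2] := has_edge_verts kF.
  by case: (vert_on_edge dk' k'F zk' sz) => ->.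
Qed.

(** Of three triangles sharing an edge two have apexes on the same side and hence overlap: three
    nonzero determinants cannot have pairwise negative products. *)
Lemma regular_neighbour_unique t k k' E : t \in M -> k \in M -> k' \in M ->
  has_edge t E -> has_edge k E -> has_edge k' E -> k != t -> k' != t -> k = k'.
Proof.
move=> tM kM k'M tE kE k'E /eqP kt /eqP k't; apply: contrapT => kk'.
have apex m : m \in M -> has_edge m E ->
    exists c, tint (E, c) = tint m /\ det (E, c) != 0.
  move=> mM /has_edge_apex[c [h _ hd _]]; exists c; split => //.
  by rewrite -normr_eq0 hd normr_eq0; exact: regular_det.
have no m m' c c' : m \in M -> m' \in M -> m <> m' -> tint (E, c) = tint m ->
    tint (E, c') = tint m' -> det (E, c) * det (E, c') <= 0.
  move=> mM m'M mm' h h'; rewrite leNgt; apply/negP => /same_side_overlap.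
  by rewrite h h' regular_disjoint// => -[].
have [c [hc dc]] := apex _ tM tE.
have [c1 [hc1 dc1]] := apex _ kM kE.
have [c2 [hc2 dc2]] := apex _ k'M k'E.
have n1 := no _ _ _ _ kM tM kt hc1 hc.
have n2 := no _ _ _ _ k'M tM k't hc2 hc.
have n3 := no _ _ _ _ kM k'M kk' hc1 hc2.
move: dc dc1 dc2 n1 n2 n3.
set x := det (E, c); set y := det (E, c1); set w := det (E, c2) => x0 y0 w0 n1 n2 n3.
have n1' : y * x < 0 by rewrite lt_neqAle n1 mulf_neq0.
have n2' : w * x < 0 by rewrite lt_neqAle n2 mulf_neq0.
have n3' : y * w < 0 by rewrite lt_neqAle n3 mulf_neq0.
have : 0 < y * x * (y * w) by rewrite nmulr_rgt0.
have -> : y * x * (y * w) = y ^+ 2 * (w * x) by ring.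
by rewrite pmulr_rgt0 ?exprn_even_gt0//= ltNge (ltW n2').
Qed.

End Regular.

Definition bisect M t : {fset tri R} := ((M `\ t) `|` [fset child1 t; child2 t])%fset.

Lemma in_bisect M t k :
  (k \in bisect M t) = ((k != t) && (k \in M)) || ((k == child1 t) || (k == child2 t)).
Proof. by rewrite !inE. Qed.

(** The part of regularity that survives hanging nodes, and so holds throughout a bisection
    history. *)
Definition separated M : Prop :=
  (forall k, k \in M -> det k != 0) /\
  (forall k k', k \in M -> k' \in M -> k <> k' -> tint k `&` tint k' = set0).

Lemma regular_separated Omega M : regular_triangulation Omega M -> separated M.
Proof.
by move=> reg; split => [k|k k']; [exact: (regular_det reg)|exact: (regular_disjoint reg)].
Qed.

Lemma tint_sub_neq M t k : separated M -> t \in M -> k \in M -> tint k `<=` tint t -> k = t.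
Proof.
move=> [_ dis] tM kM kt; apply: contrapT => nkt.
have [x xk] := tint_nonempty k.
have : (tint k `&` tint t) x by split => //; exact: kt.
by rewrite dis.
Qed.

(** Meshes are finite sets, in which equal elements merge. A child already present would overlap its
    parent, so both children are new and sums over the mesh split. *)
Lemma bisect_children M t : separated M -> t \in M ->
  [/\ child1 t \notin (M `\ t)%fset, child2 t \notin (M `\ t)%fset & child1 t != child2 t].
Proof.
move=> sM tM; have [dM _] := sM.
split; rewrite ?inE; first 1 last.
- apply/negP => /andP[/eqP n cM]; apply: n.
  by apply: tint_sub_neq sM tM cM _; exact: tint_child2.
- apply/eqP => e; have := tint_children (dM _ tM); rewrite e setIid.
  by have [x] := tint_nonempty (child2 t) => /[swap] ->.
- apply/negP => /andP[/eqP n cM]; apply: n.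
  by apply: tint_sub_neq sM tM cM _; exact: tint_child1.
Qed.

Lemma separated_bisect M t : separated M -> t \in M -> separated (bisect M t).
Proof.
move=> sM tM; have [dM iM] := sM; split => [k|].
  rewrite in_bisect => /orP[/andP[_ /dM//]|/orP[]/eqP ->].
    by rewrite det_child1 mulf_neq0 ?dM// invr_eq0 pnatr_eq0.
  by rewrite det_child2 mulf_neq0 ?dM// invr_eq0 pnatr_eq0.
have aux c k : tint c `<=` tint t -> k \in M -> k <> t -> tint c `&` tint k = set0.
  move=> ct kM kt; apply/seteqP; split => // x [/ct xt xk].
  by rewrite -(iM _ _ tM kM (fun e => kt (esym e))).
have n12 := tint_children (dM _ tM).
move=> k k'; rewrite !in_bisect.
move=> /orP[/andP[/eqP kt kM]|/orP[]/eqP ->]; move=> /orP[/andP[/eqP k't k'M]|/orP[]/eqP ->] kk'.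
- exact: iM.
- by rewrite setIC aux//; exact: tint_child1.
- by rewrite setIC aux//; exact: tint_child2.
- by rewrite aux//; exact: tint_child1.
- by [].
- by [].
- by rewrite aux//; exact: tint_child2.
- by rewrite setIC.
- by [].
Qed.

Lemma nvb_separated M M' : nvb M M' -> separated M -> separated M'.
Proof. by move=> h sM; elim: h => // M1 t _ IH tM1; exact: separated_bisect. Qed.

Lemma sum_bisect M t (f : tri R -> R) : separated M -> t \in M ->
  \sum_(k <- bisect M t) f k = \sum_(k <- (M `\ t)%fset) f k + (f (child1 t) + f (child2 t)).
Proof.
move=> sM tM; have [n1 n2 n12] := bisect_children sM tM.
have -> : bisect M t = (child1 t |` (child2 t |` (M `\ t)))%fset.
  by apply/fsetP => k; rewrite in_bisect !inE orbC orbA.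
rewrite big_fsetU1 ?big_fsetU1//=; first by ring.
by rewrite !inE negb_or n12; move: n1; rewrite !inE.
Qed.

Lemma nvb_container M M' k : nvb M M' -> k \in M' -> exists2 t, t \in M & tset k `<=` tset t.
Proof.
move=> h; elim: h k => [|M1 t _ IH tM1] k; first by exists k.
rewrite -/(bisect M1 t) in_bisect => /orP[/andP[_ /IH//]|/orP[]/eqP ->];
  have [s sM ts] := IH _ tM1; exists s => //; apply: subset_trans ts.
  exact: tset_child1.
exact: tset_child2.
Qed.

Lemma verts_child t z : z \in verts t -> z \in verts (child1 t) \/ z \in verts (child2 t).
Proof.
by rewrite !inE => /or3P[] /eqP ->; [left|right|left]; rewrite /= eqxx ?orbT.
Qed.

(** An edge is first divided at its midpoint, and a vertex once created persists in all later
    collections. *)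
Lemma nvb_edge M M' k E : nvb M M' -> k \in M -> has_edge k E ->
  (exists k', [/\ k' \in M', tset k' `<=` tset k & has_edge k' E])
  \/ (exists2 k', k' \in M' & midpoint E \in verts k').
Proof.
move=> h kM kE; elim: h => [|M1 t _ IH tM1]; first by left; exists k; split => //; exact: subset_refl.
case: IH => [[k1 [k1M k1k k1E]]|[k1 k1M mk1]].
  have [e|n] := eqVneq k1 t; last first.
    by left; exists k1; split => //; rewrite -/(bisect M1 t) in_bisect n k1M.
  rewrite e in k1E k1k; case: (child_edge k1E) => [s|s|s].
  - right; exists (child1 t); first by rewrite -/(bisect M1 t) in_bisect eqxx ?orbT.
    by rewrite (midpoint_same s) !inE eqxx !orbT.
  - left; exists (child1 t); split => //; first by rewrite -/(bisect M1 t) in_bisect eqxx ?orbT.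
    by apply: subset_trans k1k; exact: tset_child1.
  - left; exists (child2 t); split => //; first by rewrite -/(bisect M1 t) in_bisect eqxx ?orbT.
    by apply: subset_trans k1k; exact: tset_child2.
right; have [e|n] := eqVneq k1 t; last first.
  by exists k1 => //; rewrite -/(bisect M1 t) in_bisect n k1M.
rewrite e in mk1; case: (verts_child mk1) => zc; [exists (child1 t)|exists (child2 t)] => //;
  by rewrite -/(bisect M1 t) in_bisect eqxx ?orbT.
Qed.

(** The algebraic form makes halving under bisection immediate; [tset_measure] identifies it with
    Lebesgue measure. *)
Definition area t : R := `|det t| / 2.

Lemma area_ge0 t : 0 <= area t.
Proof. by rewrite divr_ge0. Qed.
Lemma area_gt0 t : det t != 0 -> 0 < area t.
Proof. by move=> d; rewrite divr_gt0// normr_gt0. Qed.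

Lemma area_child1 t : area (child1 t) = area t / 2.
Proof. by rewrite /area det_child1 normrM normfV (ger0_norm (ler0n _ 2)) mulrAC. Qed.
Lemma area_child2 t : area (child2 t) = area t / 2.
Proof. by rewrite /area det_child2 normrM normfV (ger0_norm (ler0n _ 2)) mulrAC. Qed.

Lemma nvb_area M M' : nvb M M' -> separated M ->
  \sum_(k <- M') area k = \sum_(k <- M) area k.
Proof.
move=> h sM; elim: h => // M1 t h1 IH tM1; have sM1 := nvb_separated h1 sM.
rewrite -/(bisect M1 t) sum_bisect// area_child1 area_child2 -IH.
by rewrite [RHS](big_fsetD1 t)//=; field.
Qed.

Lemma le_sum_mem (f : tri R -> R) M k : (forall t, 0 <= f t) -> k \in M ->
  f k <= \sum_(t <- M) f t.
Proof. by move=> f0 kM; rewrite (big_fsetD1 k)//= lerDl sumr_ge0. Qed.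

(* [spread t] is |u|^2 + |w|^2 for half the refinement edge u and the median w;
   by the parallelogram law bisection halves it, exactly as it halves the area. *)
Definition spread t : R :=
  ((t.1.2.1 - t.1.1.1) / 2) ^+ 2 + ((t.1.2.2 - t.1.1.2) / 2) ^+ 2
  + (t.2.1 - (midpoint t.1).1) ^+ 2 + (t.2.2 - (midpoint t.1).2) ^+ 2.

Lemma spread_child1 t : spread (child1 t) = spread t / 2.
Proof. by rewrite /spread /child1 /midpoint /=; field. Qed.
Lemma spread_child2 t : spread (child2 t) = spread t / 2.
Proof. by rewrite /spread /child2 /midpoint /=; field. Qed.
Lemma spread_ge0 t : 0 <= spread t.
Proof. by rewrite /spread !addr_ge0// sqr_ge0. Qed.

Definition shape (kappa : R) M : Prop := forall k, k \in M -> spread k <= kappa * area k.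

Lemma nvb_shape kappa M M' : nvb M M' -> shape kappa M -> shape kappa M'.
Proof.
move=> h sM; elim: h => // M1 t h1 IH tM1 k.
rewrite -/(bisect M1 t) in_bisect => /orP[/andP[_ /IH//]|/orP[]/eqP ->].
  by rewrite spread_child1 area_child1 mulrA ler_pM2r ?invr_gt0// IH.
by rewrite spread_child2 area_child2 mulrA ler_pM2r ?invr_gt0// IH.
Qed.

Lemma exists_shape M : (forall k, k \in M -> det k != 0) -> exists2 kappa, 0 < kappa & shape kappa M.
Proof.
move=> dM; have f0 t : 0 <= spread t / area t by rewrite divr_ge0 ?spread_ge0 ?area_ge0.
exists (1 + \sum_(t <- M) (spread t / area t)); first by rewrite ltr_pwDl// sumr_ge0.
move=> k kM; rewrite -ler_pdivrMr ?area_gt0 ?dM//.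
by apply: le_trans (le_sum_mem f0 kM) _; rewrite lerDr.
Qed.

Definition dist2 A B : R := (B.1 - A.1) ^+ 2 + (B.2 - A.2) ^+ 2.

(** The side vectors are $2u$ and $w\pm u$ up to sign, and $|w\pm u|^2\le 2(|u|^2+|w|^2)$. *)
Lemma dist2_verts t A B : A \in verts t -> B \in verts t -> dist2 A B <= 4 * spread t.
Proof.
case: t => [[[a1 a2] [b1 b2]] [c1 c2]]; rewrite /dist2 /spread /midpoint /= !inE.
have e1 : 0 <= (c1 - (a1 + b1) / 2) ^+ 2 by exact: sqr_ge0.
have e2 : 0 <= (c2 - (a2 + b2) / 2) ^+ 2 by exact: sqr_ge0.
have e3 : 0 <= ((b1 - a1) / 2) ^+ 2 by exact: sqr_ge0.
have e4 : 0 <= ((b2 - a2) / 2) ^+ 2 by exact: sqr_ge0.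
have e5 : 0 <= ((b1 - a1) / 2 - (c1 - (a1 + b1) / 2)) ^+ 2 by exact: sqr_ge0.
have e6 : 0 <= ((b1 - a1) / 2 + (c1 - (a1 + b1) / 2)) ^+ 2 by exact: sqr_ge0.
have e7 : 0 <= ((b2 - a2) / 2 - (c2 - (a2 + b2) / 2)) ^+ 2 by exact: sqr_ge0.
have e8 : 0 <= ((b2 - a2) / 2 + (c2 - (a2 + b2) / 2)) ^+ 2 by exact: sqr_ge0.
by move=> /or3P[]/eqP -> /or3P[]/eqP -> /=; nra.
Qed.

Lemma edge_lengthE E : edge_length E ^+ 2 = dist2 E.1 E.2.
Proof. by rewrite sqr_sqrtr// addr_ge0// sqr_ge0. Qed.

Lemma edge_length_ge0 E : 0 <= edge_length E.
Proof. exact: sqrtr_ge0. Qed.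

Lemma edge_length_le kappa M t E : shape kappa M -> t \in M -> has_edge t E ->
  edge_length E ^+ 2 <= 4 * kappa * area t.
Proof.
move=> sh tM tE; have [v1 v2] := has_edge_verts tE.
rewrite edge_lengthE; apply: le_trans (dist2_verts v1 v2) _.
by rewrite -mulrA ler_pM2l// sh.
Qed.

(** No edge is short: by Lagrange's identity $4|t|^2$ is at most the product of two squared side
    lengths, and one of these is at most $4\kappa|t|$. *)
Lemma area_le_edge kappa M t E : shape kappa M -> t \in M -> det t != 0 -> has_edge t E ->
  area t <= kappa * edge_length E ^+ 2.
Proof.
move=> sh tM d0 tE; have a0 := area_gt0 d0.
have [c [_ _ hd hv]] := has_edge_apex tE.
have v1 : E.1 \in verts t by rewrite hv !inE eqxx.
have v2 : c \in verts t by rewrite hv !inE eqxx !orbT.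
have h1 := dist2_verts v1 v2; have h2 := sh _ tM.
rewrite edge_lengthE -(ler_pM2r a0).
have : det (E, c) ^+ 2 <= dist2 E.1 E.2 * dist2 E.1 c.
  rewrite /det /dist2 /=; set p := E.2.1 - _; set q := E.2.2 - _; set r := c.2 - _; set s := c.1 - _.
  have -> : (p ^+ 2 + q ^+ 2) * (s ^+ 2 + r ^+ 2) = (p * r - q * s) ^+ 2 + (p * s + q * r) ^+ 2.
    by ring.
  by rewrite lerDl sqr_ge0.
have -> : det (E, c) ^+ 2 = 4 * (area t * area t).
  by rewrite -[det _ ^+ 2]real_normK ?num_real// hd /area; field.
have d20 : 0 <= dist2 E.1 E.2 by rewrite addr_ge0// sqr_ge0.
by move: d20 h1 h2; set D := dist2 E.1 E.2; set D' := dist2 E.1 c; nra.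
Qed.

End MeshLemmas.

(** * Morley interpolation onto a coarser mesh *)

Section MorleyInterpolation.
Variable R : realType.
Implicit Types (x z A B g : pt R) (t k : tri R) (E F : pt R * pt R) (M T : {fset tri R})
  (p q : poly2 R).

Lemma normal_derivE E p x : total_degree_le 2 p ->
  normal_deriv E p x = gr0 p x * (tangent E).2 - gr1 p x * (tangent E).1.
Proof.
move=> hp; rewrite /normal_deriv !big_ord_recl big_ord0 addr0 ev_pd0// ev_pd1//.
by rewrite /coord /normal /= mulrN.
Qed.

Lemma gr0_sub p q x : gr0 (p - q) x = gr0 p x - gr0 q x.
Proof. by rewrite /gr0 !cf_add !cf_opp; ring. Qed.
Lemma gr1_sub p q x : gr1 (p - q) x = gr1 p x - gr1 q x.
Proof. by rewrite /gr1 !cf_add !cf_opp; ring. Qed.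
Lemma ev_sub p q x : ev (p - q) x = ev p x - ev q x.
Proof. by rewrite /ev !hornerE. Qed.

Lemma normal_tangent_eq0 E (d1 d2 : R) : E.1 <> E.2 ->
  d1 * (tangent E).2 - d2 * (tangent E).1 = 0 ->
  d1 * (E.2.1 - E.1.1) + d2 * (E.2.2 - E.1.2) = 0 -> d1 = 0 /\ d2 = 0.
Proof.
move=> n h1 h2.
have L0 : edge_length E ^+ 2 != 0.
  rewrite edge_lengthE /dist2; apply/eqP => /eqP.
  rewrite paddr_eq0 ?sqr_ge0// !sqrf_eq0 !subr_eq0 => /andP[/eqP a /eqP b].
  by apply: n; apply: pt_eq.
have L0' : edge_length E != 0 by apply: contra_neq L0 => ->; rewrite expr0n.
have {}h1 : d1 * (E.2.2 - E.1.2) + d2 * (- (E.2.1 - E.1.1)) = 0.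
  apply: (mulIf (invr_neq0 L0')); rewrite mul0r -h1 /tangent /=; ring.
apply: (solve2 _ h2 h1); apply: contra_neq L0 => h.
rewrite edge_lengthE /dist2 -[RHS]oppr0 -[in RHS]h; ring.
Qed.

Section FineMesh.
Variables (Omega : set (pt R)) (N : {fset tri R}) (v : broken R).
Hypotheses (reg : regular_triangulation Omega N) (mor : morley Omega N v).

Lemma morley_deg k : k \in N -> total_degree_le 2 (v k).
Proof. by case: mor => -[h _] _ _ _ _; exact: h. Qed.

Lemma vertex_dichotomy k z : k \in N -> z \in verts k -> Omega z \/ bdry Omega z.
Proof.
move=> kN zk; have [oz|oz] := pselect (Omega z); [by left|right; split => //].
by case: reg => _ -> _; exists k => //; exact: vert_tset.
Qed.

(** The value is read from an arbitrary fine triangle at [z]; Morley continuity and the boundary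
    condition make the choice immaterial. The default triangle matters only where [z] is no fine
    vertex. *)
Definition vertex_value z : R :=
  ev (v (xget ((0, 0), (0, 0), (0, 0)) [set k | k \in N /\ z \in verts k])) z.

Lemma vertex_valueE k z : k \in N -> z \in verts k -> vertex_value z = ev (v k) z.
Proof.
move=> kN zk; rewrite /vertex_value; set S := [set k | _].
have [] : S (xget ((0, 0), (0, 0), (0, 0)) S) by apply: xgetPex; exists k.
set k' := xget _ _ => k'N zk'; have [_ h1 h2 _ _] := mor.
have [oz|bz] := vertex_dichotomy kN zk; first exact: h1.
by rewrite !h2.
Qed.

Lemma vertex_value_bdry k z : k \in N -> z \in verts k -> bdry Omega z -> vertex_value z = 0.
Proof. by move=> kN zk bz; rewrite (vertex_valueE kN zk); case: mor => _ _ ->. Qed.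

Lemma tangential_grad k E : k \in N -> has_edge k E ->
  gr0 (v k) (midpoint E) * (E.2.1 - E.1.1) + gr1 (v k) (midpoint E) * (E.2.2 - E.1.2)
  = vertex_value E.2 - vertex_value E.1.
Proof.
move=> kN kE; have [v1 v2] := has_edge_verts kE.
rewrite (vertex_valueE kN v1) (vertex_valueE kN v2) -(midpoint_grad _ _ (morley_deg kN)).
by rewrite -surjective_pairing; ring.
Qed.

Lemma grad_bdry k E : k \in N -> has_edge k E -> seg E `<=` bdry Omega ->
  gr0 (v k) (midpoint E) = 0 /\ gr1 (v k) (midpoint E) = 0.
Proof.
move=> kN kE Eb; have dk := regular_det reg kN; have [v1 v2] := has_edge_verts kE.
apply: (@normal_tangent_eq0 E); first exact: edge_neq dk kE.
- by rewrite -(normal_derivE _ _ (morley_deg kN)); case: mor => _ _ _ _ ->.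
- rewrite tangential_grad// (vertex_value_bdry kN v1) ?(vertex_value_bdry kN v2) ?subr0//.
    by apply: Eb; exact: seg_endr.
  by apply: Eb; exact: seg_endl.
Qed.

(** The normal part agrees by the Morley condition. The tangential part agrees because the midpoint
    rule expresses it by the two end values. *)
Lemma grad_unique k k' E : k \in N -> k' \in N -> has_edge k E -> has_edge k' E ->
  gr0 (v k) (midpoint E) = gr0 (v k') (midpoint E) /\
  gr1 (v k) (midpoint E) = gr1 (v k') (midpoint E).
Proof.
move=> kN k'N kE k'E; have dk := regular_det reg kN.
have [Eb|Eb] := pselect (seg E `<=` bdry Omega).
  by have [-> ->] := grad_bdry kN kE Eb; have [-> ->] := grad_bdry k'N k'E Eb.
have [||h1 h2] := @normal_tangent_eq0 E (gr0 (v k) (midpoint E) - gr0 (v k') (midpoint E))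
  (gr1 (v k) (midpoint E) - gr1 (v k') (midpoint E)) (edge_neq dk kE).
- have [_ _ _ /(_ k k' E kN k'N kE k'E Eb) + _] := mor.
  by rewrite (normal_derivE _ _ (morley_deg kN)) (normal_derivE _ _ (morley_deg k'N)) => h; rewrite !mulrBl; move: h; lra.
- have := tangential_grad kN kE; have := tangential_grad k'N k'E.
  by move=> <- h; rewrite !mulrBl; move: h; lra.
- by split; lra.
Qed.

(* Mean value of the gradient of v over a union of fine edges: the fine edges
   contribute midpoint values, weighted according to repeated bisection. *)
Inductive mean_grad : pt R * pt R -> pt R -> Prop :=
| mean_grad_fine k E : k \in N -> has_edge k E ->
    mean_grad E (gr0 (v k) (midpoint E), gr1 (v k) (midpoint E))
| mean_grad_bisect E g1 g2 : (forall k, k \in N -> ~ has_edge k E) ->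
    mean_grad (E.1, midpoint E) g1 -> mean_grad (midpoint E, E.2) g2 ->
    mean_grad E ((g1.1 + g2.1) / 2, (g1.2 + g2.2) / 2).

(** The negative premise of [mean_grad_bisect] makes the two rules exclusive, and on a fine edge
    both adjacent triangles give the same gradient. *)
Lemma mean_grad_fun E g g' : mean_grad E g -> mean_grad E g' -> g = g'.
Proof.
move=> h; elim: h g' => {E g} [k E kN kE|E g1 g2 nE _ IH1 _ IH2] g' h'.
- case: {g'} _ / h' kE => [k' E' k'N k'E' kE'|E' g1 g2 nE' _ _ kE'].
    by have [-> ->] := grad_unique kN k'N kE' k'E'.
  by case: (nE' _ kN).
- case: {E g'} _ _ / h' nE IH1 IH2 => [k E kN kE nE|E h1 h2 _ H1 H2 _ IH1 IH2].
    by case: (nE _ kN).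
  by rewrite (IH1 _ H1) (IH2 _ H2).
Qed.

Lemma mean_grad_rev E g : mean_grad E g -> mean_grad (E.2, E.1) g.
Proof.
have same F : same_edge (F.2, F.1) F by apply/same_edgeP; right.
elim=> {E g} [k E kN kE|E g1 g2 nE _ IH1 _ IH2].
  rewrite -(midpoint_same (same E)); apply: mean_grad_fine => //.
  by rewrite (has_edge_same _ (same E)).
rewrite [g1.1 + _]addrC [g1.2 + _]addrC; apply: mean_grad_bisect.
- by move=> k kN; rewrite (has_edge_same _ (same E)); exact: nE.
- by rewrite (midpoint_same (same E)).
- by rewrite (midpoint_same (same E)).
Qed.

(** The two halves have equal length, so the averages telescope. *)
Lemma mean_grad_tangential E g : mean_grad E g ->
  g.1 * (E.2.1 - E.1.1) + g.2 * (E.2.2 - E.1.2) = vertex_value E.2 - vertex_value E.1.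
Proof.
elim=> {E g} [k E kN kE|E g1 g2 _ _ h1 _ h2]; first exact: tangential_grad.
move: h1 h2; rewrite /midpoint /=; set a := vertex_value _; lra.
Qed.

Lemma mean_grad_bdry E g : mean_grad E g -> seg E `<=` bdry Omega -> g = (0, 0).
Proof.
elim=> {E g} [k E kN kE|E g1 g2 _ _ h1 _ h2] Eb.
  by have [-> ->] := grad_bdry kN kE Eb.
rewrite h1 ?h2 /= ?addr0 ?mul0r//; apply: subset_trans Eb; case: E {h1 h2} => A B /=.
  exact: seg_half2.
exact: seg_half1.
Qed.

(* q is the Morley interpolation of v on the (possibly nonconforming) mesh M
   between the coarse mesh and N. *)
Definition interpolates M (q : broken R) : Prop := forall k, k \in M ->
  [/\ total_degree_le 2 (q k),
      forall z, z \in verts k -> ev (q k) z = vertex_value z /\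
        exists2 k', k' \in N & z \in verts k'
    & forall E, E \in edges k ->
        mean_grad E (gr0 (q k) (midpoint E), gr1 (q k) (midpoint E))].

Lemma interpolates_self : interpolates N v.
Proof.
move=> k kN; split; first exact: morley_deg.
- by move=> z zk; rewrite (vertex_valueE kN zk); split => //; exists k.
- by move=> E /edge_has_edge kE; exact: mean_grad_fine.
Qed.

Lemma interpolates_edge M (q : broken R) k E : interpolates M q -> k \in M -> has_edge k E ->
  mean_grad E (gr0 (q k) (midpoint E), gr1 (q k) (midpoint E)).
Proof.
move=> iq kM /has_edgeP[F Fk EF]; have [_ _ /(_ F Fk) h] := iq k kM.
rewrite (midpoint_same EF); case/same_edgeP: EF => -> //.
exact: mean_grad_rev.
Qed.

(** The midpoint would be a hanging node on a fine edge. *)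
Lemma bisected_not_fine E : E.1 <> E.2 ->
  (exists2 k', k' \in N & midpoint E \in verts k') -> forall k, k \in N -> ~ has_edge k E.
Proof.
move=> n [k' k'N mk'] k kN kE.
have e (a b : R) : (a + b) / 2 = a \/ (a + b) / 2 = b -> a = b by case; lra.
have := regular_vertex_on_edge reg kN k'N kE mk' (seg_mid E).
by case=> h; apply: n; apply: pt_eq; apply: e; move: h => /(congr1 (fun x => (x.1, x.2))) [h1 h2];
  rewrite /midpoint /= in h1 h2; by [left|right].
Qed.

(** The parent inherits the gradients on its two undivided edges and the average on its refinement
    edge. The closing condition for a quadratic with these data is the telescoping sum of vertex
    values around the triangle. *)
Lemma interpolate_bisect M t (q : broken R) : separated M -> t \in M -> interpolates (bisect M t) q ->
  exists q' : broken R, [/\ interpolates M q', (forall k, k != t -> q' k = q k) &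
    [/\ cf (q' t) 2 0 = (cf (q (child1 t)) 2 0 + cf (q (child2 t)) 2 0) / 2,
        cf (q' t) 1 1 = (cf (q (child1 t)) 1 1 + cf (q (child2 t)) 1 1) / 2
      & cf (q' t) 0 2 = (cf (q (child1 t)) 0 2 + cf (q (child2 t)) 0 2) / 2]].
Proof.
move=> sM tM iq; have dt : det t != 0 by apply sM.
have c1M : child1 t \in bisect M t by rewrite in_bisect eqxx orbT.
have c2M : child2 t \in bisect M t by rewrite in_bisect eqxx !orbT.
have [d1 v1 g1] := iq _ c1M; have [d2 v2 g2] := iq _ c2M.
set m := midpoint t.1.
have tne : t.1.1 <> t.1.2.
  by apply: (@edge_neq _ t (t.1.1, t.1.2)) => //; apply: edge_has_edge; rewrite !inE eqxx.
have Gab : mean_grad t.1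
    ((gr0 (q (child1 t)) (midpoint (t.1.1, m)) + gr0 (q (child2 t)) (midpoint (m, t.1.2))) / 2,
     (gr1 (q (child1 t)) (midpoint (t.1.1, m)) + gr1 (q (child2 t)) (midpoint (m, t.1.2))) / 2).
  have h1 := g1 (t.1.1, m) ltac:(by rewrite !inE eqxx orbT).
  have h2 := g2 (m, t.1.2) ltac:(by rewrite !inE eqxx !orbT).
  apply: (mean_grad_bisect _ h1 h2); apply: bisected_not_fine => //.
  by have [] := v1 m ltac:(by rewrite !inE eqxx !orbT).
have Gbc := g2 (t.1.2, t.2) ltac:(by rewrite !inE eqxx).
have Gca := g1 (t.2, t.1.1) ltac:(by rewrite !inE eqxx).
have Gmc := g1 (m, t.2) ltac:(by rewrite !inE eqxx !orbT).
have Gcm := mean_grad_rev (g2 (t.2, m) ltac:(by rewrite !inE eqxx orbT)).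
rewrite (midpoint_rev t.2) in Gcm.
(* Nothing links the two children's polynomials directly; they agree on the median because its mean
   gradient is determined by [v]. *)
have [Em0 Em1] : gr0 (q (child1 t)) (midpoint (m, t.2)) = gr0 (q (child2 t)) (midpoint (m, t.2)) /\
    gr1 (q (child1 t)) (midpoint (m, t.2)) = gr1 (q (child2 t)) (midpoint (m, t.2)).
  by case: (mean_grad_fun Gmc Gcm).
set ga := (X in mean_grad t.1 X) in Gab.
set gb := (X in mean_grad (t.1.2, t.2) X) in Gbc.
set gc := (X in mean_grad (t.2, t.1.1) X) in Gca.
have Tab := mean_grad_tangential Gab.
have Tbc := mean_grad_tangential Gbc.
have Tca := mean_grad_tangential Gca.
rewrite [(_, _).1]/= [(_, _).2]/= in Tbc Tca.
have [|q0 [dq0 va [[ga0 ga1] [gb0 gb1] [gc0 gc1]]]] :=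
  @exists_quad _ t ga gb gc (vertex_value t.1.1) dt.
  by move: Tab Tbc Tca; lra.
rewrite -surjective_pairing in ga0 ga1.
exists (fun k => if k == t then q0 else q k); split.
- move=> k kM; have [->|kt] := eqVneq k t; last first.
    by apply: iq; rewrite in_bisect kt kM.
  split => //.
  + have fv z : z \in verts t -> exists2 k', k' \in N & z \in verts k'.
      by case/verts_child => [/v1[]|/v2[]].
    move=> z zt; split; last exact: fv.
    move: zt; rewrite !inE => /or3P[]/eqP -> //.
      have := @midpoint_grad _ q0 t.1.1 t.1.2 dq0; rewrite -surjective_pairing ga0 ga1 va.
      by move: Tab; lra.
    have := @midpoint_grad _ q0 t.2 t.1.1 dq0; rewrite gc0 gc1 va.
    by move: Tca; lra.
  + move=> E; rewrite !inE => /or3P[]/eqP ->.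
    * by rewrite -surjective_pairing ga0 ga1 -surjective_pairing.
    * by rewrite gb0 gb1 -surjective_pairing.
    * by rewrite gc0 gc1 -surjective_pairing.
- by move=> k /negPf ->.
- rewrite eqxx; exact: (hess_bisect dt ga0 ga1 gb0 gb1 gc0 gc1 Em0 Em1).
Qed.

End FineMesh.

Lemma restrictE Omega T y t k : regular_triangulation Omega T -> t \in T -> det k != 0 ->
  tset k `<=` tset t -> Defs.restrict T y k = y t.
Proof.
move=> reg tT dk kt; rewrite /Defs.restrict big_mkcond (big_fsetD1 t)//=.
rewrite asboolT// big_seq big1 ?addr0// => s; rewrite !inE => /andP[st sT].
case: asboolP => // ks; case/eqP: st.
exact: (regular_container_unique reg dk sT tT ks kt).
Qed.

(** The squared broken energy norm of [q - r] in algebraic form, usable also on collections with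
    hanging nodes. *)
Definition energy M (q r : broken R) : R := \sum_(k <- M) area k * hsq (q k - r k).

(** Convexity of the squared Frobenius norm; the defect [d] is a quarter of the squared Hessian norm
    of [q1 - q2]. *)
Lemma hsq_average q q1 q2 r : cf q 2 0 = (cf q1 2 0 + cf q2 2 0) / 2 ->
  cf q 1 1 = (cf q1 1 1 + cf q2 1 1) / 2 -> cf q 0 2 = (cf q1 0 2 + cf q2 0 2) / 2 ->
  hsq (q - r) <= (hsq (q1 - r) + hsq (q2 - r)) / 2.
Proof.
move=> h1 h2 h3; rewrite /hsq !cf_add !cf_opp h1 h2 h3 -subr_ge0.
set a1 := cf q1 2 0; set a2 := cf q2 2 0; set b1 := cf q1 1 1; set b2 := cf q2 1 1.
set c1 := cf q1 0 2; set c2 := cf q2 0 2.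
set d := (X in 0 <= X).
have -> : d = (a1 - a2) ^+ 2 + (b1 - b2) ^+ 2 / 2 + (c1 - c2) ^+ 2 by rewrite /d; field.
by rewrite !addr_ge0 ?divr_ge0 ?sqr_ge0.
Qed.

Theorem morley_interpolation Omega T N v y :
  regular_triangulation Omega T -> regular_triangulation Omega N -> nvb T N ->
  morley Omega N v ->
  exists q : broken R, interpolates N v T q /\ energy T q y <= energy N v (Defs.restrict T y).
Proof.
move=> rT rN h mv; pose r := Defs.restrict T y.
have sT := regular_separated rT.
(* Generalised over the current collection [M], so that the induction removes the last bisection
   while [N] and the comparison function [r] stay fixed. *)
have main M : nvb T M -> forall q : broken R, interpolates N v M q ->
    exists q' : broken R, interpolates N v T q' /\ energy T q' r <= energy M q r.
  elim=> [|M1 t h1 IH tM1] q iq; first by exists q.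
  have sM1 := nvb_separated h1 sT.
  have [q' [iq' qq' [e1 e2 e3]]] := interpolate_bisect rN mv sM1 tM1 iq.
  have [q'' [iq'' le]] := IH _ iq'; exists q''; split => //.
  apply: le_trans le _; rewrite -/(bisect M1 t) /energy sum_bisect//.
  rewrite [leLHS](big_fsetD1 t)//= addrC; apply: lerD.
    by rewrite big_seq [leRHS]big_seq ler_sum// => k; rewrite !inE => /andP[kt _]; rewrite qq'.
  (* Parent and children lie in one coarse triangle [t0], so [r] is the same polynomial on all three
     and convexity applies with equal areas. *)
  have [t0 t0T tt0] := nvb_container h1 tM1.
  have dt : det t != 0 by apply sM1.
  have -> : r t = y t0 by exact: (restrictE _ rT).
  have -> : r (child1 t) = y t0.
    apply: (restrictE _ rT) => //; last exact: subset_trans (@tset_child1 _ _) tt0.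
    by rewrite det_child1 mulf_neq0// invr_eq0 pnatr_eq0.
  have -> : r (child2 t) = y t0.
    apply: (restrictE _ rT) => //; last exact: subset_trans (@tset_child2 _ _) tt0.
    by rewrite det_child2 mulf_neq0// invr_eq0 pnatr_eq0.
  rewrite area_child1 area_child2.
  have := hsq_average (y t0) e1 e2 e3; have := area_ge0 t.
  by set a := area t; set b := hsq _; set c := hsq _; set d := hsq _; nra.
have [q [iq le]] := main N h v (interpolates_self rN mv); exists q; split => //.
have -> // : energy T q y = energy T q r.
rewrite /energy big_seq [RHS]big_seq; apply: eq_bigr => k kT.
by rewrite /r (restrictE _ rT kT (regular_det rT kT)).
Qed.

(** Both sides of a coarse edge see the same mean gradient, since it depends on [v] alone; on
    boundary edges it vanishes. *)
Lemma interpolation_morley Omega T N v y (q : broken R) :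
  regular_triangulation Omega T -> regular_triangulation Omega N ->
  morley Omega N v -> morley Omega T y -> interpolates N v T q ->
  morley Omega T (fun t => if t \in T then q t - y t else 0).
Proof.
move=> rT rN mv my iq; have [[y1 y1'] y2 y3 y4 y5] := my.
have dq t : t \in T -> total_degree_le 2 (q t) by move=> /iq[].
have nd E t x : t \in T -> normal_deriv E (q t - y t) x =
    normal_deriv E (q t) x - normal_deriv E (y t) x.
  move=> tT; rewrite !normal_derivE ?gr0_sub ?gr1_sub; first by ring.
  - exact: y1.
  - exact: dq.
  - by apply: total_degree_le_sub; [exact: dq|exact: y1].
split.
- split=> [t tT|t /negPf -> //]; rewrite tT; apply: total_degree_le_sub; first exact: dq.
  exact: y1.
- move=> t k z tT kT zt zk Oz; rewrite tT kT !ev_sub (y2 t k)//.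
  by have [_ /(_ z zt)[-> _] _] := iq t tT; have [_ /(_ z zk)[-> _] _] := iq k kT.
- move=> t z tT zt bz; rewrite tT ev_sub (y3 t)//.
  have [_ /(_ z zt)[-> [k kN zk]] _] := iq t tT.
  by rewrite (vertex_value_bdry rN mv kN zk bz) subr0.
- move=> t k E tT kT tE kE Eb; rewrite tT kT !nd// (y4 t k)//.
  rewrite (normal_derivE _ _ (dq _ tT)) (normal_derivE _ _ (dq _ kT)).
  have := mean_grad_fun rN mv (interpolates_edge iq tT tE) (interpolates_edge iq kT kE).
  by move=> [-> ->].
- move=> t E tT tE Eb; rewrite tT nd// (y5 t)// (normal_derivE _ _ (dq _ tT)).
  have := mean_grad_bdry rN mv (interpolates_edge iq tT tE) Eb.
  by move=> [-> ->]; rewrite !mul0r !subr0.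
Qed.

Lemma interpolates_common Omega T N v (q : broken R) t :
  regular_triangulation Omega N -> morley Omega N v -> interpolates N v T q ->
  t \in T -> t \in N -> (forall x, ev (q t) x = ev (v t) x).
Proof.
move=> rN mv iq tT tN; have [dq vq gq] := iq t tT.
have [dv vv gv] := interpolates_self rN mv tN.
have [] := @quad_unique _ t (q t) (v t) (regular_det rN tN) dq dv.
- by have [-> _] := vq t.1.1 ltac:(by rewrite !inE eqxx);
    have [-> _] := vv t.1.1 ltac:(by rewrite !inE eqxx).
- by move=> E Et; case: (mean_grad_fun rN mv (gq E Et) (gv E Et)).
- by [].
Qed.

End MorleyInterpolation.

(** * Area of a triangle *)

Section PlaneMeasure.
Variable R : realType.
Implicit Types (t : tri R) (x A B : pt R).
Notation mu := (@lebesgue_measure R).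

(** Measurability in the plane refers to the product sigma-algebra, so the open set is exhausted by
    countably many rational boxes. *)
Lemma open_measurable_plane (A : set (pt R)) : open A -> measurable A.
Proof.
move=> oA.
pose box (a b r : rat) : set (pt R) :=
  (ball (ratr a : R) (ratr r)) `*` (ball (ratr b : R) (ratr r)).
have mbox a b r : measurable (box a b r).
  by apply: measurableX; exact: measurable_ball.
rewrite (_ : A = \bigcup_(a : rat) \bigcup_(b : rat) \bigcup_(r : rat)
    (if `[< box a b r `<=` A >] then box a b r else set0)).
  do 3 apply: bigcupT_measurable_rat => ?.
  by case: ifP.
apply/seteqP; split => [[x1 x2] Ax|x [a _ [b _ [r _]]]]; last first.
  by case: ifP => // /asboolP h /h.
have /nbhs_ballP[e /= e0 he] := oA _ Ax.
have e40 : 0 < e / 4 by rewrite divr_gt0.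
have [r /andP[r0 re]] := rat_in_itvoo e40.
have r0' : (0 : R) < ratr r by [].
have [a /andP[a1 a2]] : exists q : rat, x1 - ratr r < ratr q < x1 + ratr r.
  by have [q] := @rat_in_itvoo _ (x1 - ratr r) (x1 + ratr r) ltac:(lra); rewrite in_itv /=; exists q.
have [b /andP[b1 b2]] : exists q : rat, x2 - ratr r < ratr q < x2 + ratr r.
  by have [q] := @rat_in_itvoo _ (x2 - ratr r) (x2 + ratr r) ltac:(lra); rewrite in_itv /=; exists q.
exists a => //; exists b => //; exists r => //.
have -> : `[< box a b r `<=` A >].
  apply/asboolP => -[y1 y2] [/= h1 h2]; apply: he; split => /=;
    rewrite /ball /= ltr_norml; move: h1 h2; rewrite /ball /= !ltr_norml => /andP[? ?] /andP[? ?];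
    apply/andP; move: re; rewrite bnd_simp => re; split; lra.
by split; rewrite /= /ball /= ltr_norml; apply/andP; split; lra.
Qed.

Lemma continuous_measurable_plane (f : pt R -> R) : continuous f -> measurable_fun setT f.
Proof.
move=> cf; apply: (measurability _ (RGenOpens.measurableE R)) => //.
move=> _ [_ [U [oU ->]] <-]; rewrite setTI; apply: open_measurable_plane.
exact: open_comp.
Qed.

Lemma measurable_affine (al be ga : R) :
  measurable_fun setT (fun x : pt R => al * x.1 + be * x.2 + ga).
Proof.
apply: measurable_funD => //; apply: measurable_funD.
  by apply: measurable_funM => //; exact: measurable_fst.
by apply: measurable_funM => //; exact: measurable_snd.
Qed.

Lemma measurable_ge0 (f : pt R -> R) : measurable_fun setT f -> measurable [set x | 0 <= f x].
Proof.
move=> mf; rewrite (_ : [set x | _] = f @^-1` `[0, +oo[%classic).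
  by rewrite -[X in measurable X]setTI; exact: mf.
by apply/seteqP; split => x /=; rewrite in_itv/= andbT.
Qed.

Lemma measurable_gt0 (f : pt R -> R) : measurable_fun setT f -> measurable [set x | 0 < f x].
Proof.
move=> mf; rewrite (_ : [set x | _] = f @^-1` `]0, +oo[%classic).
  by rewrite -[X in measurable X]setTI; exact: mf.
by apply/seteqP; split => x /=; rewrite in_itv/= andbT.
Qed.

Lemma measurable_eq0 (f : pt R -> R) : measurable_fun setT f -> measurable [set x | f x = 0].
Proof.
move=> mf; rewrite (_ : [set x | _] = f @^-1` [set 0]).
  by rewrite -[X in measurable X]setTI; exact: mf.
by apply/seteqP; split => x.
Qed.

Lemma bc1_affine t : exists al be ga, (forall x, bc1 t x = al * x.1 + be * x.2 + ga).
Proof.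
exists ((t.2.2 - t.1.1.2) / det t), (- (t.2.1 - t.1.1.1) / det t),
 ((- t.1.1.1 * (t.2.2 - t.1.1.2) + t.1.1.2 * (t.2.1 - t.1.1.1)) / det t) => x.
by rewrite /bc1; ring.
Qed.
Lemma bc2_affine t : exists al be ga, (forall x, bc2 t x = al * x.1 + be * x.2 + ga).
Proof.
exists (- (t.1.2.2 - t.1.1.2) / det t), ((t.1.2.1 - t.1.1.1) / det t),
 ((t.1.1.1 * (t.1.2.2 - t.1.1.2) - t.1.1.2 * (t.1.2.1 - t.1.1.1)) / det t) => x.
by rewrite /bc2; ring.
Qed.
Lemma bc0_affine t : exists al be ga, (forall x, bc0 t x = al * x.1 + be * x.2 + ga).
Proof.
have [a1 [b1 [c1 h1]]] := bc1_affine t; have [a2 [b2 [c2 h2]]] := bc2_affine t.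
by exists (- a1 - a2), (- b1 - b2), (1 - c1 - c2) => x; rewrite /bc0 h1 h2; ring.
Qed.

Lemma measurable_bc t : [/\ measurable_fun setT (bc0 t), measurable_fun setT (bc1 t)
  & measurable_fun setT (bc2 t)].
Proof.
split; [have [al [be [ga h]]] := bc0_affine t|have [al [be [ga h]]] := bc1_affine t|
  have [al [be [ga h]]] := bc2_affine t]; rewrite (funext h); exact: measurable_affine.
Qed.

Lemma measurable_tset t : det t != 0 -> measurable (tset t).
Proof.
move=> d0; have [m0 m1 m2] := measurable_bc t.
rewrite (_ : tset t = [set x | 0 <= bc0 t x] `&` [set x | 0 <= bc1 t x] `&` [set x | 0 <= bc2 t x]).
  by apply: measurableI; [apply: measurableI|]; exact: measurable_ge0.
apply/seteqP; split => x.
  by case/(tsetP x d0) => h0 h1 h2; split.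
by case=> -[h0 h1] h2; apply/(tsetP x d0).
Qed.

Lemma measurable_tint t : det t != 0 -> measurable (tint t).
Proof.
move=> d0; have [m0 m1 m2] := measurable_bc t.
rewrite (_ : tint t = [set x | 0 < bc0 t x] `&` [set x | 0 < bc1 t x] `&` [set x | 0 < bc2 t x]).
  by apply: measurableI; [apply: measurableI|]; exact: measurable_gt0.
apply/seteqP; split => x.
  by case/(tintP x d0) => h0 h1 h2; split.
by case=> -[h0 h1] h2; apply/(tintP x d0).
Qed.

Lemma line_measure0 (al be ga : R) : (al != 0) || (be != 0) ->
  leb2 R [set x | al * x.1 + be * x.2 + ga = 0] = 0%E.
Proof.
have [->|b0 _] := eqVneq be 0.
  rewrite orbF => a0; rewrite (_ : [set x | _] = [set - (ga / al)] `*` setT).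
    rewrite product_measure1E//.
    by rewrite [X in (X * _)%E]lebesgue_measure_set1 mul0e.
  apply/seteqP; split => -[x y] /=.
    by rewrite mul0r addr0 => h; split => //; apply: (mulfI a0); rewrite mulrN mulrCA divff// mulr1; lra.
  by move=> [-> _]; field.
rewrite /product_measure1 integral0_eq// => x _ /=.
rewrite (_ : xsection _ x = [set - ((al * x + ga) / be)]); first exact: lebesgue_measure_set1.
apply/seteqP; split => y; rewrite /xsection /= inE /=.
  by move=> h; apply: (mulfI b0); rewrite mulrN mulrCA divff// mulr1; lra.
by move=> ->; field.
Qed.

Lemma integral_affine (u v al be : R) : u < v ->
  (\int[mu]_(x in `[u, v]) (al * x + be)%:E =
   (al * (v ^+ 2 - u ^+ 2) / 2 + be * (v - u))%:E)%E.
Proof.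
move=> uv; pose F (x : R^o) : R^o := al / 2 * x ^+ 2 + be * x.
have dF (x : R) : is_derive (x : R^o) 1 F (al * x + be).
  by rewrite /F; apply: is_derive_eq; rewrite /GRing.scale /=; field.
have cF : continuous F by move=> x; apply: differentiable_continuous; apply/derivable1_diffP; case: (dF x).
rewrite (@continuous_FTC2 _ _ F)//.
- by rewrite /F -EFinB; congr EFin; field.
- apply: continuous_subspaceT => x; apply: cvgD; last exact: cvg_cst.
  by apply: cvgM; [exact: cvg_cst|exact: cvg_id].
- split => [x _||]; first by case: (dF x).
    by apply: cvg_at_right_filter; exact: cF.
  by apply: cvg_at_left_filter; exact: cF.
- by move=> x _; rewrite derive1E; apply: derive_val.
Qed.

(** Cavalieri: the vertical sections are intervals whose length grows affinely from 0 at the apex to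
    [y2 - y1] on the vertical side. *)
Lemma vertical_triangle_measure (p q y0 y1 y2 : R) : p != q -> y1 < y2 ->
  leb2 R (tset ((p, y0), (q, y1), (q, y2))) = (`|q - p| * (y2 - y1) / 2)%:E.
Proof.
move=> pq y12; have qp0 : q - p != 0 by rewrite subr_eq0 eq_sym.
set t := ((p, y0), (q, y1), (q, y2)).
pose s (x : R) := (x - p) / (q - p).
have sec (x : R) : xsection (tset t) x = if (0 <= s x <= 1) then
   `[y0 * (1 - s x) + s x * y1, y0 * (1 - s x) + s x * y2]%classic else set0.
  apply/seteqP; split => y.
    rewrite /xsection /= inE => -[l0 [l1 [l2 [h0 h1 h2 h]]]].
    rewrite /tri_point /= => -[ex ey].
    have sE : s x = l1 + l2.
      by rewrite /s ex; have -> : l0 = 1 - l1 - l2 by [lra]; field.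
    have -> : 0 <= s x <= 1 by rewrite sE; apply/andP; split; lra.
    rewrite /= in_itv /= sE ey.
    have -> : l0 = 1 - l1 - l2 by lra.
    have h3 := mulr_ge0 h2 (ltW (etrans (subr_gt0 _ _) y12)).
    have h4 := mulr_ge0 h1 (ltW (etrans (subr_gt0 _ _) y12)).
    by apply/andP; split; nra.
  case: ifP => // /andP[s0 s1]; rewrite /= in_itv /= => /andP[h1 h2].
  rewrite /xsection /= inE.
  pose w := (y - (y0 * (1 - s x) + s x * y1)) / (y2 - y1).
  have d0 : 0 < y2 - y1 by rewrite subr_gt0.
  have w0 : 0 <= w by apply: divr_ge0; [rewrite subr_ge0|exact: ltW].
  have ws : w <= s x by rewrite ler_pdivrMr//; lra.
  exists (1 - s x), (s x - w), w; split; [lra|lra|lra|lra|].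
  apply: pt_eq; rewrite /tri_point /=; first by rewrite /s; field.
  by rewrite /w; field; rewrite gt_eqF.
rewrite /product_measure1.
pose u := Num.min p q; pose v := Num.max p q.
have uv : u < v by rewrite /u /v; case: (ltgtP p q) pq.
have sI (x : R) : (0 <= s x <= 1) = (x \in `[u, v]).
  rewrite in_itv /= /u /v /s; case: (ltgtP p q) pq => // pq _.
    by rewrite ler_pdivlMr ?subr_gt0// ler_pdivrMr ?subr_gt0// mul0r mul1r subr_ge0 lerBlDr subrK.
  rewrite ler_ndivlMr ?subr_lt0// ler_ndivrMr ?subr_lt0// mul0r mul1r subr_le0 lerBrDr subrK.
  by rewrite andbC.
transitivity (\int[mu]_x (((fun x : R => ((y2 - y1) / (q - p) * x + (- p * (y2 - y1) / (q - p)))%:E) \_ `[u, v]) x))%E.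
  apply: eq_integral => x _ /=; rewrite sec sI patchE.
  rewrite mem_setE.
  case: ifP => xuv; last by rewrite measure0.
  rewrite lebesgue_measure_itv /= lte_fin.
  have s0 : 0 <= s x by move: xuv; rewrite -sI => /andP[].
  have -> : (y2 - y1) / (q - p) * x + - p * (y2 - y1) / (q - p) = s x * (y2 - y1).
    by rewrite /s; ring.
  case: ltP => h.
    by rewrite -EFinB; congr EFin; ring.
  (* At the apex the section is a single point, where the affine length must vanish. *)
  congr EFin; apply/eqP; rewrite eq_le; apply/andP; split.
    by rewrite mulr_ge0// subr_ge0 ltW.
  by move: h; lra.
rewrite -integral_mkcond integral_affine//; congr EFin.
rewrite /u /v; case: (ltgtP p q) pq => // pq _.
  by rewrite gtr0_norm ?subr_gt0//; field.
by rewrite ltr0_norm ?subr_lt0//; field.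
Qed.

End PlaneMeasure.

Section TriangleMeasure.
Variable R : realType.
Implicit Types (t : tri R) (x A B : pt R).

Let P t := leb2 R (tset t) = (area t)%:E.

Let P_rot t : P (t.1.2, t.2, t.1.1) -> P t.
Proof. by rewrite /P /area tset_rot det_rot. Qed.

Let P_swap t : P (t.1.2, t.1.1, t.2) -> P t.
Proof. by rewrite /P /area tset_swap det_swap normrN. Qed.

Let P_vertical t : det t != 0 -> t.1.2.1 = t.2.1 -> P t.
Proof.
have lt (p q y0 y1 y2 : R) : p != q -> y1 < y2 -> P ((p, y0), (q, y1), (q, y2)).
  move=> pq y12; rewrite /P vertical_triangle_measure//; congr EFin.
  rewrite /area /det /=; have -> : (q - p) * (y2 - y0) - (y1 - y0) * (q - p) = (q - p) * (y2 - y1).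
    by ring.
  by rewrite normrM (@gtr0_norm _ (y2 - y1))// subr_gt0.
case: t => [[[p y0] [q y1]] [q' y2]]; rewrite /det /= => d0 qq'; subst q'.
have pq : p != q by apply: contra_neq d0 => ->; ring.
have y12 : y1 != y2 by apply: contra_neq d0 => ->; ring.
have [y|y|e] := ltgtP y1 y2; [exact: lt| |by rewrite e eqxx in y12].
by apply: P_rot; apply: P_swap; apply: P_rot; apply: P_rot; exact: lt.
Qed.

(* cut along the vertical line through the middle vertex *)
Let P_sorted t : det t != 0 -> t.1.1.1 < t.1.2.1 < t.2.1 -> P t.
Proof.
case: t => [[[a1 a2] [b1 b2]] [c1 c2]] d0 /= /andP[ab bc].
set t := (_, _, _) in d0 *.
pose th := (b1 - a1) / (c1 - a1).
have ca : 0 < c1 - a1 by rewrite subr_gt0 (lt_trans ab).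
have th0 : 0 < th by rewrite divr_gt0// subr_gt0.
have th1 : 0 < 1 - th by rewrite subr_gt0 ltr_pdivrMr// mul1r ltrD2r.
pose d := (b1, a2 + th * (c2 - a2)) : pt R.
have b1E : b1 = a1 + th * (c1 - a1) by rewrite /th divfK ?gt_eqF//; ring.
pose t1 := ((a1, a2), (b1, b2), d) : tri R.
pose t2 := (d, (b1, b2), (c1, c2)) : tri R.
have e1 : det t1 = th * det t by rewrite /t1 /t /d /det /= b1E; ring.
have e2 : det t2 = (1 - th) * det t by rewrite /t2 /t /d /det /= b1E; ring.
have d1 : det t1 != 0 by rewrite e1 mulf_neq0// gt_eqF.
have d2 : det t2 != 0 by rewrite e2 mulf_neq0// gt_eqF.
have P1 : P t1 by exact: P_vertical.
have P2 : P t2.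
  by do 2 apply: P_rot; apply: P_vertical => //; rewrite (det_rot (t2.1.2, t2.2, t2.1.1)) det_rot.
rewrite /P; have -> : tset t = tset t1 `|` tset t2.
  apply/seteqP; split => x.
    move=> [l0 [l1 [l2 [h0 h1 h2 h ->]]]].
    (* As $d=(1-\theta)a+\theta c$, the sign of $(1-\theta)l_2-\theta l_0$ tells on which side of
       the cutting line the point lies. *)
    have [c|c] := leP ((1 - th) * l2) (th * l0).
    - left; exists (l0 - (1 - th) * l2 / th), l1, (l2 / th); split => //.
      + by rewrite subr_ge0 ler_pdivrMr// [_ * th]mulrC.
      + by rewrite divr_ge0// ltW.
      + by rewrite -[RHS]h; field; rewrite gt_eqF.
      + by apply: pt_eq; rewrite /tri_point /t1 /d /= ?b1E; field; rewrite gt_eqF.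
    - right; exists (l0 / (1 - th)), l1, (l2 - th * l0 / (1 - th)); split => //.
      + by rewrite divr_ge0// ltW.
      + by rewrite subr_ge0 ler_pdivrMr// [l2 * _]mulrC ltW.
      + by rewrite -[RHS]h; field; rewrite gt_eqF.
      + by apply: pt_eq; rewrite /tri_point /t2 /d /= ?b1E; field; rewrite gt_eqF.
  move=> [|] [l0 [l1 [l2 [h0 h1 h2 h ->]]]].
    exists (l0 + (1 - th) * l2), l1, (th * l2); split => //.
    - by rewrite addr_ge0// mulr_ge0// ltW.
    - by rewrite mulr_ge0// ltW.
    - by rewrite -[RHS]h; ring.
    - by apply: pt_eq; rewrite /tri_point /t1 /d /= ?b1E; ring.
  exists ((1 - th) * l0), l1, (l2 + th * l0); split => //.
  - by rewrite mulr_ge0// ltW.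
  - by rewrite addr_ge0// mulr_ge0// ltW.
  - by rewrite -[RHS]h; ring.
  - by apply: pt_eq; rewrite /tri_point /t2 /d /= ?b1E; ring.
have m1 := measurable_tset d1; have m2 := measurable_tset d2.
have f2 : (leb2 R (tset t2) < +oo)%E by rewrite P2 ltry.
have U : leb2 R (tset t1 `|` tset t2) =
    (leb2 R (tset t1) + leb2 R (tset t2) - leb2 R (tset t1 `&` tset t2))%E.
  exact: measureUfinr.
rewrite U.
have -> : leb2 R (tset t1 `&` tset t2) = 0%E.
  apply: (@subset_measure0 _ _ _ (leb2 R) _ [set x | 1 * x.1 + 0 * x.2 + - b1 = 0]).
  - exact: measurableI.
  - by apply: measurable_eq0; exact: measurable_affine.
  - move=> x [[l0 [l1 [l2 [h0 h1 h2 h ex]]]] [k0 [k1 [k2 [g0 g1 g2 g ex']]]]] /=.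
    have := congr1 fst ex; have := congr1 fst ex'; rewrite /= => -> ->.
    have e3 := congr1 fst ex; have e4 := congr1 fst ex'; rewrite /= in e3 e4.
    have := mulr_ge0 h0 (ltW (etrans (subr_gt0 _ _) ab)).
    have := mulr_ge0 g2 (ltW (etrans (subr_gt0 _ _) bc)).
    have l1E : l1 = 1 - l0 - l2 by lra.
    have k1E : k1 = 1 - k0 - k2 by lra.
    by move: e3 e4; rewrite l1E k1E; nra.
  - by apply: line_measure0; rewrite oner_eq0.
rewrite P1 P2 sube0 -EFinD; congr EFin; rewrite /area e1 e2 (normrM th) (normrM (1 - th)).
by rewrite (gtr0_norm th0) (gtr0_norm th1); field.
Qed.

Lemma tset_measure t : det t != 0 -> leb2 R (tset t) = (area t)%:E.
Proof.
have dr (k : tri R) : det k != 0 -> det (k.1.2, k.2, k.1.1) != 0 by rewrite det_rot.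
have ds (k : tri R) : det k != 0 -> det (k.1.2, k.1.1, k.2) != 0 by rewrite det_swap oppr_eq0.
move=> d0; rewrite -/(P t).
have [e|n1] := eqVneq t.1.2.1 t.2.1; first exact: P_vertical.
have [e|n2] := eqVneq t.2.1 t.1.1.1.
  by apply: P_rot; apply: P_vertical => //; exact: dr.
have [e|n3] := eqVneq t.1.1.1 t.1.2.1.
  by do 2 apply: P_rot; apply: P_vertical => //; do 2 apply: (dr _).
have up (k : tri R) : det k != 0 -> k.1.1.1 < k.1.2.1 -> k.1.2.1 != k.2.1 -> k.2.1 != k.1.1.1 -> P k.
  move=> dk ab bc ca.
  have [h|h|h] := ltgtP k.1.2.1 k.2.1; last by rewrite h eqxx in bc.
    by apply: P_sorted; rewrite // ab h.
  have [g|g|g] := ltgtP k.2.1 k.1.1.1; last by rewrite g eqxx in ca.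
    do 2 apply: P_rot; apply: P_sorted; last by rewrite /= g ab.
    by apply: (dr (k.1.2, k.2, k.1.1)); exact: dr.
  apply: P_swap; apply: P_rot; apply: P_sorted; last by rewrite /= g h.
  by apply: (dr (k.1.2, k.1.1, k.2)); exact: ds.
have [h|h|h] := ltgtP t.1.1.1 t.1.2.1; last by rewrite h eqxx in n3.
  exact: up.
by apply: P_swap; apply: up => //=; [exact: ds|rewrite eq_sym|rewrite eq_sym].
Qed.

(** The closed triangle exceeds the open one only by points on three lines, each of measure zero. *)
Lemma tint_measure t : det t != 0 -> leb2 R (tint t) = (area t)%:E.
Proof.
move=> d0; rewrite -tset_measure//.
have mt := measurable_tset d0; have mi := measurable_tint d0.
have null f : (exists al be ga, forall x, f x = al * x.1 + be * x.2 + ga) ->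
    (exists x y, f x != f y) -> measurable [set x | f x = 0] /\ leb2 R [set x | f x = 0] = 0%E.
  move=> [al [be [ga h]]] [x [y fxy]]; rewrite (funext h); split.
    by apply: measurable_eq0; exact: measurable_affine.
  apply: line_measure0; apply: contraR fxy; rewrite negb_or !negbK => /andP[/eqP a0 /eqP b0].
  by rewrite !h a0 b0 !mul0r.
have bcv l0 l1 l2 := @bc_tri_point R t l0 l1 l2 d0.
have [m0 n0] : measurable [set x | bc0 t x = 0] /\ leb2 R [set x | bc0 t x = 0] = 0%E.
  apply: null; first exact: bc0_affine.
  exists (tri_point t 1 0 0), (tri_point t 0 1 0).
  have [-> _ _] := bcv 1 0 0 ltac:(lra); have [-> _ _] := bcv 0 1 0 ltac:(lra).
  by rewrite oner_eq0.
have [m1 n1] : measurable [set x | bc1 t x = 0] /\ leb2 R [set x | bc1 t x = 0] = 0%E.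
  apply: null; first exact: bc1_affine.
  exists (tri_point t 0 1 0), (tri_point t 1 0 0).
  have [_ -> _] := bcv 1 0 0 ltac:(lra); have [_ -> _] := bcv 0 1 0 ltac:(lra).
  by rewrite oner_eq0.
have [m2 n2] : measurable [set x | bc2 t x = 0] /\ leb2 R [set x | bc2 t x = 0] = 0%E.
  apply: null; first exact: bc2_affine.
  exists (tri_point t 0 0 1), (tri_point t 1 0 0).
  have [_ _ ->] := bcv 1 0 0 ltac:(lra); have [_ _ ->] := bcv 0 0 1 ltac:(lra).
  by rewrite oner_eq0.
set L0 := [set x | bc0 t x = 0] in m0 n0; set L1 := [set x | bc1 t x = 0] in m1 n1.
set L2 := [set x | bc2 t x = 0] in m2 n2.
have U : leb2 R (tint t `|` L0 `|` L1 `|` L2) = leb2 R (tint t).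
  have h1 : leb2 R (tint t `|` L0) = leb2 R (tint t) by exact: measureU0.
  have h2 : leb2 R (tint t `|` L0 `|` L1) = leb2 R (tint t `|` L0).
    by apply: measureU0 => //; exact: measurableU.
  rewrite -h1 -h2; apply: measureU0 => //; apply: measurableU => //; exact: measurableU.
apply/eqP; rewrite eq_le; apply/andP; split.
  by apply: le_measure; rewrite ?inE//; exact: tint_tset.
rewrite -U; apply: le_measure; rewrite ?inE//; first by do ?apply: measurableU.
move=> x /(tsetP x d0)[]; rewrite !le_eqVlt => /orP[/eqP|] h0; first by left; left; right.
move=> /orP[/eqP|] h1; first by left; right.
move=> /orP[/eqP|] h2; first by right.
by left; left; left; apply/(tintP x d0).
Qed.

Lemma hT_sqr t : det t != 0 -> hT t ^+ 2 = area t.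
Proof. by move=> d0; rewrite /hT tset_measure//= sqr_sqrtr// area_ge0. Qed.

Lemma Rintegral_tint_cst t (r : R) : det t != 0 -> \int[leb2 R]_(x in tint t) r = area t * r.
Proof.
move=> d0; transitivity (r * fine (leb2 R (tint t))).
  by apply: Rintegral_cst; exact: measurable_tint.
by rewrite tint_measure//= mulrC.
Qed.

End TriangleMeasure.

(** * Pointwise bounds in H^2_0 *)

Section SquareIntegrals.
Context d (T : measurableType d) (R : realType) (mu : {measure set T -> \bar R}).
Variables (D : set T) (mD : measurable D).
Implicit Types f g : T -> R.
Local Open Scope ereal_scope.

Lemma measurable_sqr f : measurable_fun D f -> measurable_fun D (fun x => (f x ^+ 2)%:E).
Proof. by move=> mf; apply/measurable_EFinP; exact: measurable_funX. Qed.

Lemma integral_sqrD_le f g : measurable_fun D f -> measurable_fun D g ->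
  \int[mu]_(x in D) ((f x + g x) ^+ 2)%:E <=
  2%:E * \int[mu]_(x in D) (f x ^+ 2)%:E + 2%:E * \int[mu]_(x in D) (g x ^+ 2)%:E.
Proof.
move=> mf mg; have m2 (h : T -> R) : measurable_fun D h -> measurable_fun D (fun x => 2%:E * (h x ^+ 2)%:E).
  move=> mh; under eq_fun do rewrite -EFinM; apply/measurable_EFinP.
  by apply: measurable_funM => //; exact: measurable_funX.
have s0 (h : T -> R) x : 0 <= (h x ^+ 2)%:E :> \bar R by rewrite lee_fin sqr_ge0.
rewrite -!ge0_integralZl//; try exact: measurable_sqr.
rewrite -ge0_integralD//; try exact: m2; try by move=> x _; rewrite mule_ge0// s0.
apply: ge0_le_integral => //.
- by move=> x _; rewrite lee_fin sqr_ge0.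
- by apply: measurable_sqr; exact: measurable_funD.
- by apply: emeasurable_funD; exact: m2.
- move=> x _; rewrite -!EFinM -EFinD lee_fin -subr_ge0.
  have -> : (2 * f x ^+ 2 + 2 * g x ^+ 2 - (f x + g x) ^+ 2 = (f x - g x) ^+ 2)%R by ring.
  exact: sqr_ge0.
Qed.

Lemma cvg0_small (a : nat -> \bar R) (e : R) : a @ \oo --> 0 -> (0 < e)%R ->
  \forall n \near \oo, a n < e%:E.
Proof.
move=> ha e0; apply: (ha [set y | y < e%:E]); apply: open_nbhs_nbhs.
by split; [exact: open_ereal_lt_ereal|rewrite /= lte_fin].
Qed.

End SquareIntegrals.

(** * Derivatives and integrals along coordinate lines *)

Section RealFTC.
Variable R : realType.
Notation mu := (@lebesgue_measure R).

Lemma integral_derive (F f : R -> R) a b : a < b ->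
  (forall x : R, is_derive (x : R^o) 1 (F : R^o -> R^o) (f x)) -> continuous f ->
  (\int[mu]_(x in `[a, b]) (f x)%:E = (F b - F a)%:E)%E.
Proof.
move=> ab dF cf.
have cF : continuous (F : R^o -> R^o).
  by move=> x; apply: differentiable_continuous; apply/derivable1_diffP; case: (dF x).
rewrite (@continuous_FTC2 _ _ (F : R -> R^o))//.
- exact: continuous_subspaceT.
- split => [x _||]; first by case: (dF x).
    by apply: cvg_at_right_filter; exact: cF.
  by apply: cvg_at_left_filter; exact: cF.
- by move=> x _; rewrite derive1E; apply: derive_val.
Qed.

Lemma is_derive_fst (f : pt R -> R) (s y : R) : derivable f (s, y) (basis_vec R ord0) ->
  is_derive (s : R^o) 1 (fun r : R^o => f (r, y) : R^o) (partial ord0 f (s, y)).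
Proof.
move=> df.
have E : (fun h : R => h^-1 *: ((f \o shift (s, y)) (h *: basis_vec R ord0) - f (s, y)))
  = (fun h : R => h^-1 *: (((fun r : R^o => f (r, y) : R^o) \o shift (s : R^o)) (h *: (1 : R^o)) - f (s, y))).
  apply/funext => h /=; congr (_ *: (f _ - _)); apply: pt_eq => /=.
    by rewrite /basis_vec /=.
  by rewrite /basis_vec /= scaler0 add0r.
by split; [move: df; rewrite /derivable E|rewrite /partial /derive E].
Qed.

Lemma is_derive_snd (f : pt R -> R) (x s : R) : derivable f (x, s) (basis_vec R (lift ord0 ord0)) ->
  is_derive (s : R^o) 1 (fun r : R^o => f (x, r) : R^o) (partial (lift ord0 ord0) f (x, s)).
Proof.
move=> df.
have E : (fun h : R => h^-1 *: ((f \o shift (x, s)) (h *: basis_vec R (lift ord0 ord0)) - f (x, s)))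
  = (fun h : R => h^-1 *: (((fun r : R^o => f (x, r) : R^o) \o shift (s : R^o)) (h *: (1 : R^o)) - f (x, s))).
  apply/funext => h /=; congr (_ *: (f _ - _)); apply: pt_eq => /=.
    by rewrite /basis_vec /= scaler0 add0r.
  by rewrite /basis_vec /=.
by split; [move: df; rewrite /derivable E|rewrite /partial /derive E].
Qed.

Lemma continuous_pairl (f : pt R -> R) (y : R) : continuous f -> continuous (fun r => f (r, y)).
Proof.
move=> cf x; have h1 : r @[r --> x] --> x by exact: cvg_id.
have h2 : (fun _ : R => y) @ x --> y by exact: cvg_cst.
exact: (cvg_comp _ f (cvg_pair h1 h2) (cf (x, y))).
Qed.

Lemma continuous_pairr (f : pt R -> R) (x : R) : continuous f -> continuous (fun r => f (x, r)).
Proof.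
move=> cf y; have h1 : r @[r --> y] --> y by exact: cvg_id.
have h2 : (fun _ : R => x) @ y --> x by exact: cvg_cst.
exact: (cvg_comp _ f (cvg_pair h2 h1) (cf (x, y))).
Qed.

End RealFTC.

(** * Pointwise bound for test functions *)

Section TestFunctions.
Variables (R : realType) (Omega : set (pt R)).
Hypothesis oOmega : open Omega.
Implicit Types (f g phi : pt R -> R) (x : pt R).
Notation mu := (@lebesgue_measure R).
Notation i0 := (@ord0 1).
Notation i1 := (lift ord0 (@ord0 0)).

Lemma partial_eq0 (K : set (pt R)) f i x : closed K -> (forall y, ~ K y -> f y = 0) -> ~ K x ->
  partial i f x = 0.
Proof.
move=> cK f0 nKx; rewrite /partial (@near_eq_derive _ _ _ f (cst 0)) ?derive_cst//.
have : nbhs x (~` K) by apply: open_nbhs_nbhs; split => //; exact: closed_openC.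
by apply: filterS => y /f0.
Qed.

Lemma measurable_norm_continuous (f : R -> R) : continuous f -> measurable_fun setT (fun r => `|f r|%:E).
Proof.
move=> cf; apply/measurable_EFinP; apply: measurableT_comp => //.
exact: continuous_measurable_fun.
Qed.

Lemma abs_le_integral_derive (F f : R -> R) a b : a < b -> F a = 0 ->
  (forall x : R, is_derive (x : R^o) 1 (F : R^o -> R^o) (f x)) -> continuous f ->
  (`|F b|%:E <= \int[mu]_r `|f r|%:E)%E.
Proof.
move=> ab Fa dF cf; have := integral_derive ab dF cf; rewrite Fa subr0 => e.
have mf := measurable_norm_continuous cf.
have -> : (`|F b|%:E = `|(F b)%:E|)%E by [].
rewrite -e; apply: (@le_trans _ _ (\int[mu]_(x in `[a, b]) `|(f x)%:E|)%E).
  apply: le_abse_integral => //; apply/measurable_EFinP; apply: measurable_funTS.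
  exact: continuous_measurable_fun.
by apply: ge0_subset_integral => //=; exact: subsetT.
Qed.

Variable B : R.
Hypothesis Omega_box : forall x, Omega x -> [/\ - B < x.1, x.1 < B, - B < x.2 & x.2 < B].

(** The two one-dimensional integrations start on $x_1=-B$ and $x_2=-B$, outside the domain, where
    [phi] and its first derivative vanish. Tonelli joins them into an area integral. *)
Lemma test_function_le_integral phi x : test_function Omega phi -> Omega x ->
  (`|phi x|%:E <= \int[leb2 R]_(z in Omega) `|partial i1 (partial i0 phi) z|%:E)%E.
Proof.
move=> [sm [K [cK KO K0]]] Ox; have [x1 _ x2 _] := Omega_box Ox.
have clK : closed K by apply: compact_closed => //; exact: norm_hausdorff.
have [_ d0] := sm [::]; have [c1 d1] := sm [:: i0]; have [c2 _] := sm [:: i1; i0].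
rewrite /partials /= in d0 c1 d1 c2.
set p := partial i0 phi in c1 d1 c2 *; set g := partial i1 p in c2 *.
have p0 y : ~ K y -> p y = 0 by move=> ?; exact: (partial_eq0 i0 clK K0).
have g0 y : ~ K y -> g y = 0 by move=> ?; exact: (partial_eq0 i1 clK p0).
have nK1 y : ~ K (- B, y) by move=> /KO /Omega_box[] /=; rewrite ltxx.
have nK2 s : ~ K (s, - B) by move=> /KO /Omega_box[] _ _ /=; rewrite ltxx.
have h1 : (`|phi x|%:E <= \int[mu]_s `|p (s, x.2)|%:E)%E.
  rewrite {1}(surjective_pairing x).
  apply: (@abs_le_integral_derive (fun r => phi (r, x.2)) (fun r => p (r, x.2)) _ _ x1).
  - by rewrite K0.
  - by move=> s; apply: is_derive_fst; exact: d0.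
  - exact: continuous_pairl.
have h2 s : (`|p (s, x.2)|%:E <= \int[mu]_r `|g (s, r)|%:E)%E.
  apply: (@abs_le_integral_derive (fun r => p (s, r)) (fun r => g (s, r)) _ _ x2).
  - by rewrite p0.
  - by move=> r; apply: is_derive_snd; exact: d1.
  - exact: continuous_pairr.
have mg : measurable_fun setT (fun z => `|g z|%:E).
  by apply/measurable_EFinP; apply: measurableT_comp => //; exact: continuous_measurable_plane.
have ag0 z : (0 <= `|g z|%:E)%E by rewrite lee_fin.
have h3 : (\int[mu]_s `|p (s, x.2)|%:E <= \int[mu]_s \int[mu]_r `|g (s, r)|%:E)%E.
  apply: ge0_le_integral.
  - exact: measurableT.
  - by move=> s _; rewrite lee_fin.
  - by apply: measurable_norm_continuous; exact: continuous_pairl.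
  - exact: (@measurable_fun_fubini_tonelli_F _ _ (measurableTypeR R) (measurableTypeR R) R mu (fun z => `|g z|%:E) mg ag0).
  - by move=> s _; exact: h2.
apply: (le_trans h1); apply: (le_trans h3).
have := @fubini_tonelli1 _ _ _ _ _ mu mu (fun z => `|g z|%:E)%E mg ag0.
rewrite /fubini_F => <-.
rewrite [leRHS]integral_mkcond; apply: ge0_le_integral.
- exact: measurableT.
- by move=> z _; exact: ag0.
- exact: mg.
- apply/(measurable_restrictT _ _).1 => //; first exact: open_measurable_plane.
  exact: measurable_funTS.
- move=> z _; rewrite patchE; case: ifPn => //; rewrite notin_setE => nz.
  by rewrite g0 ?normr0// => /KO.
Qed.

End TestFunctions.

(** * Passage to $L^2$ limits on a bounded domain *)

Section SobolevEmbedding.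
Variables (R : realType) (Omega : set (pt R)).
Hypothesis oOmega : open Omega.
Implicit Types (f g phi v : pt R -> R) (x : pt R).
Notation mu := (@lebesgue_measure R).
Notation i0 := (@ord0 1).
Notation i1 := (lift ord0 (@ord0 0)).

Let mOmega : measurable Omega := open_measurable_plane oOmega.

Variable B : R.
Hypothesis Omega_box : forall x, Omega x -> [/\ - B < x.1, x.1 < B, - B < x.2 & x.2 < B].

Lemma Omega_finite : (leb2 R Omega < +oo)%E.
Proof.
apply: (@le_lt_trans _ _ (leb2 R (`]- B, B[%classic `*` `]- B, B[%classic))).
  apply: le_measure; rewrite ?inE//; first exact: measurableX.
  by move=> x /Omega_box[h1 h2 h3 h4]; split; rewrite /= in_itv /= ?h1 ?h2 ?h3 ?h4.
rewrite product_measure1E//= !lebesgue_measure_itv /=.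
by case: ifP => _; rewrite ?mul0e ?ltry// -EFinB -EFinM ltry.
Qed.

Definition vol : R := fine (leb2 R Omega).

Lemma volE : leb2 R Omega = vol%:E.
Proof. by rewrite /vol fineK// ge0_fin_numE ?Omega_finite// measure_ge0. Qed.

Lemma vol_ge0 : 0 <= vol.
Proof. by rewrite /vol fine_ge0// measure_ge0. Qed.

(** Cauchy-Schwarz in Young form: the free parameter [th] avoids square roots of extended real
    integrals. *)
Lemma integral_le_sqr g (th : R) : measurable_fun Omega g -> 0 < th ->
  (\int[leb2 R]_(z in Omega) `|g z|%:E <=
   (th / 2)%:E * \int[leb2 R]_(z in Omega) (g z ^+ 2)%:E + (vol / (2 * th))%:E)%E.
Proof.
move=> mg th0.
have t2 : 0 <= th / 2 by rewrite divr_ge0// ltW.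
have t3 : 0 <= (2 * th)^-1 by rewrite invr_ge0 mulr_ge0// ltW.
have -> : ((vol / (2 * th))%:E = \int[leb2 R]_(z in Omega) ((2 * th)^-1)%:E)%E.
  by rewrite integral_cst//= [X in (_ * X)%E]volE -EFinM mulrC.
have s0 z : (0 <= (g z ^+ 2)%:E)%E by rewrite lee_fin sqr_ge0.
have ms := measurable_sqr mg.
rewrite -ge0_integralZl// -ge0_integralD//.
- apply: ge0_le_integral => //.
  + by apply/measurable_EFinP; exact: measurableT_comp.
  + apply: emeasurable_funD => //; under eq_fun do rewrite -EFinM.
    by apply/measurable_EFinP; apply: measurable_funM => //; exact: measurable_funX.
  + move=> z _; rewrite -EFinM -EFinD lee_fin -subr_ge0.
    have -> : th / 2 * g z ^+ 2 + (2 * th)^-1 - `|g z| = (th * `|g z| - 1) ^+ 2 / (2 * th).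
      by rewrite -(real_normK (num_real (g z))); field; rewrite gt_eqF.
    by rewrite divr_ge0 ?sqr_ge0// mulr_ge0// ltW.
- by move=> z _; rewrite mule_ge0.
- under eq_fun do rewrite -EFinM.
  by apply/measurable_EFinP; apply: measurable_funM => //; exact: measurable_funX.
Qed.

Lemma compact_support_bounded f (K : set (pt R)) : continuous f -> compact K ->
  (forall x, ~ K x -> f x = 0) -> exists C, forall x, `|f x| <= C.
Proof.
move=> cf cK f0.
have : compact (f @` K) by apply: continuous_compact => //; exact: continuous_subspaceT.
move=> /compact_bounded[M [_ hM]]; exists (`|M| + 1) => x.
have M1 : M < `|M| + 1 by rewrite (le_lt_trans (ler_norm M))// ltrDl.
have [Kx|nKx] := pselect (K x); last by rewrite f0// normr0 addr_ge0.
by apply: (hM _ M1); exists x.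
Qed.

Lemma compact_support_L2 f (K : set (pt R)) : continuous f -> compact K ->
  (forall x, ~ K x -> f x = 0) -> (\int[leb2 R]_(x in Omega) (f x ^+ 2)%:E < +oo)%E.
Proof.
move=> cf cK f0; have [C hC] := compact_support_bounded cf cK f0.
have mf : measurable_fun Omega f by apply: measurable_funTS; exact: continuous_measurable_plane.
apply: (@le_lt_trans _ _ (\int[leb2 R]_(x in Omega) (C ^+ 2)%:E)%E).
  apply: ge0_le_integral => //.
  - by move=> x _; rewrite lee_fin sqr_ge0.
  - exact: measurable_sqr.
  - move=> x _; rewrite lee_fin -(real_normK (num_real (f x))).
    by rewrite lerXn2r// nnegrE// (le_trans _ (hC x)).
by rewrite integral_cst//= [X in (_ * X)%E]volE -EFinM ltry.
Qed.

(** If $|v(x)|>K$, continuity leaves a gap of at least [d] between [v] and all late [phi n] on a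
    whole square around [x]. This bounds the squared $L^2$ distance from below and contradicts
    convergence. *)
Lemma L2_limit_bounded (phi : nat -> pt R -> R) v (K : R) : continuous v ->
  (forall n, measurable_fun Omega (phi n)) -> cvg_L2 Omega phi v ->
  (\forall n \near \oo, forall x, Omega x -> `|phi n x| <= K) ->
  forall x, Omega x -> `|v x| <= K.
Proof.
move=> cv mphi [mv hcv] hK x Ox; rewrite leNgt; apply/negP => Kv.
pose d : R := (`|v x| - K) / 2; have d0 : 0 < d by rewrite divr_gt0// subr_gt0.
have : nbhs x (Omega `&` [set y | `|v x - v y| < d]).
  apply: filterI; first exact: open_nbhs_nbhs.
  by have /cvgrPdist_lt /(_ d d0) := cv x.
move=> /nbhs_ballP[e /= e0 he].
pose U : set (pt R) := ball x.1 e `*` ball x.2 e.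
have mU : measurable U by apply: measurableX; exact: measurable_ball.
have hU y : U y -> Omega y /\ `|v x - v y| < d by move=> [? ?]; apply: he.
have UO : U `<=` Omega by move=> y /hU[].
have muU : leb2 R U = ((e *+ 2) * (e *+ 2))%:E.
  have mb z : mu (ball z e) = (e *+ 2)%:E by rewrite lebesgue_measure_ball// ltW.
  transitivity (mu (ball x.1 e) * mu (ball x.2 e))%E; last by rewrite !mb.
  by apply: product_measure1E; exact: measurable_ball.
have E0 : 0 < d ^+ 2 * (e *+ 2 * (e *+ 2)) by rewrite mulr_gt0 ?exprn_gt0// mulr_gt0// pmulrn_lgt0.
have hs := cvg0_small hcv E0.
have [n [hn Kn]] : exists n, (\int[leb2 R]_(x in Omega) ((phi n x - v x) ^+ 2)%:E <
    (d ^+ 2 * (e *+ 2 * (e *+ 2)))%:E)%E /\ forall x, Omega x -> `|phi n x| <= K.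
  have [n hn] := filter_ex (filterI hs hK); exists n; exact: hn.
move: hn; rewrite ltNge => /negP; apply.
have mpv : measurable_fun Omega (fun x => ((phi n x - v x) ^+ 2)%:E).
  by apply: measurable_sqr; exact: measurable_funB.
have s0 z : (0 <= ((phi n z - v z) ^+ 2)%:E)%E by rewrite lee_fin sqr_ge0.
apply: (@le_trans _ _ (\int[leb2 R]_(x in U) ((phi n x - v x) ^+ 2)%:E)%E); last first.
  by apply: ge0_subset_integral.
apply: (@le_trans _ _ (\int[leb2 R]_(x in U) (d ^+ 2)%:E)%E).
  by rewrite integral_cst// [X in (_ * X)%E]muU -EFinM.
apply: ge0_le_integral => //.
- by move=> z _; rewrite lee_fin sqr_ge0.
- exact: measurable_funS mpv.
- move=> y Uy; have [Oy vy] := hU y Uy; have Ky := Kn y Oy.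
  have hd : d <= `|phi n y - v y|.
    have h1 := ler_normD (v y) (v x - v y); have h2 := ler_normB (phi n y) (phi n y - v y).
    have dE : d + d = `|v x| - K by rewrite /d; field.
    rewrite subKr in h2; rewrite [v y + _]addrC subrK in h1.
    by move: h1 h2 dE vy Ky; set a := `|v x|; set b := `|v y|; set c := `|phi n y|; lra.
  rewrite lee_fin -[leRHS]real_normK ?num_real//.
  by rewrite lerXn2r// nnegrE// ltW.
Qed.

End SobolevEmbedding.

Section SquareIntegrable.
Context d (T : measurableType d) (R : realType) (mu : {measure set T -> \bar R}).
Variables (D : set T) (mD : measurable D).
Implicit Types f g : T -> R.

Lemma sqr_integrable f : measurable_fun D f -> (\int[mu]_(x in D) (f x ^+ 2)%:E < +oo)%E ->
  mu.-integrable D (EFin \o (fun x => f x ^+ 2)).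
Proof.
move=> mf fin; apply/integrableP; split; first exact: measurable_sqr.
apply: le_lt_trans fin; rewrite le_eqVlt; apply/orP; left; apply/eqP.
by apply: eq_integral => x _ /=; rewrite ger0_norm ?sqr_ge0.
Qed.

End SquareIntegrable.

Section SobolevPoint.
Variables (R : realType) (Omega : set (pt R)).
Hypothesis oOmega : open Omega.
Implicit Types (f g phi v w : pt R -> R) (x : pt R).
Notation i0 := (@ord0 1).
Notation i1 := (lift ord0 (@ord0 0)).

Let mOmega : measurable Omega := open_measurable_plane oOmega.

Lemma test_function_partials phi (s : seq 'I_2) : test_function Omega phi ->
  measurable_fun Omega (partials s phi).
Proof.
move=> [sm _]; apply: measurable_funTS; apply: continuous_measurable_plane.
by case: (sm s).
Qed.

Lemma partials_eq0 phi (K : set (pt R)) (s : seq 'I_2) : closed K ->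
  (forall y, ~ K y -> phi y = 0) -> forall y, ~ K y -> partials s phi y = 0.
Proof.
by move=> cK f0; elim: s => // i s IH y; exact: partial_eq0.
Qed.

Variable B : R.
Hypothesis Omega_box : forall x, Omega x -> [/\ - B < x.1, x.1 < B, - B < x.2 & x.2 < B].

Lemma test_function_L2 phi (s : seq 'I_2) : test_function Omega phi ->
  (\int[leb2 R]_(x in Omega) (partials s phi x ^+ 2)%:E < +oo)%E.
Proof.
move=> [sm [K [cK KO f0]]]; have clK : closed K by apply: compact_closed => //; exact: norm_hausdorff.
apply: (compact_support_L2 oOmega Omega_box _ cK); first by case: (sm s).
exact: partials_eq0.
Qed.

Lemma cvg_L2_le (psi : nat -> pt R -> R) h (e : R) : (forall n, measurable_fun Omega (psi n)) ->
  cvg_L2 Omega psi h -> 0 < e -> \forall n \near \oo,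
  (\int[leb2 R]_(x in Omega) (psi n x ^+ 2)%:E <=
    2%:E * e%:E + 2%:E * \int[leb2 R]_(x in Omega) (h x ^+ 2)%:E)%E /\
  (\int[leb2 R]_(x in Omega) (h x ^+ 2)%:E <=
    2%:E * e%:E + 2%:E * \int[leb2 R]_(x in Omega) (psi n x ^+ 2)%:E)%E.
Proof.
move=> mpsi [mh hcv] e0; have := cvg0_small hcv e0.
apply: filterS => n /ltW hn.
have mph : measurable_fun Omega (fun x => psi n x - h x) by exact: measurable_funB.
have mhp : measurable_fun Omega (fun x => h x - psi n x) by exact: measurable_funB.
have hn' : (\int[leb2 R]_(x in Omega) ((h x - psi n x) ^+ 2)%:E <= e%:E)%E.
  by under eq_integral do rewrite -sqrrN opprB.
have two (a b c : \bar R) : (a <= b -> 2%:E * a + c <= 2%:E * b + c)%E.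
  by move=> ab; apply: leeD2r; apply: lee_wpmul2l; rewrite ?lee_fin.
split.
- have := integral_sqrD_le (leb2 R) mOmega mph mh.
  under eq_integral do rewrite subrK.
  by move=> h1; apply: (le_trans h1); exact: two.
- have := integral_sqrD_le (leb2 R) mOmega mhp (mpsi n).
  under eq_integral do rewrite subrK.
  by move=> h1; apply: (le_trans h1); exact: two.
Qed.

Lemma L2_limit_finite (psi : nat -> pt R -> R) h : (forall n, measurable_fun Omega (psi n)) ->
  (forall n, \int[leb2 R]_(x in Omega) (psi n x ^+ 2)%:E < +oo)%E ->
  cvg_L2 Omega psi h -> (\int[leb2 R]_(x in Omega) (h x ^+ 2)%:E < +oo)%E.
Proof.
move=> mpsi fpsi hcv.
have [n [_ hn]] := filter_ex (cvg_L2_le mpsi hcv ltr01).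
apply: (le_lt_trans hn); rewrite -EFinM.
have s0 : (0 <= \int[leb2 R]_(x in Omega) (psi n x ^+ 2)%:E)%E.
  by apply: integral_ge0 => x _; rewrite lee_fin sqr_ge0.
have /fineK <- : (\int[leb2 R]_(x in Omega) (psi n x ^+ 2)%:E \is a fin_num)%E.
  by rewrite ge0_fin_numE.
by rewrite -EFinM -EFinD ltry.
Qed.

Lemma hess_norm_ge0 H : 0 <= hess_norm Omega H.
Proof. exact: sqrtr_ge0. Qed.

(** [hess_norm] uses a real-valued integral, informative only for an integrable integrand.
    Finiteness is inherited from the test functions before one entry is compared with the full
    sum. *)
Lemma jet_hess_le v G H : H20_jet Omega v G H ->
  (\int[leb2 R]_(x in Omega) (H i1 i0 x ^+ 2)%:E <= (hess_norm Omega H ^+ 2)%:E)%E.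
Proof.
move=> [phi [tphi _ _ hH]].
have iH i j : (leb2 R).-integrable Omega (EFin \o (fun x => H i j x ^+ 2)).
  apply: (@sqr_integrable _ _ _ (leb2 R)) => //; first by case: (hH i j).
  apply: (L2_limit_finite _ _ (hH i j)) => n.
    exact: (test_function_partials [:: i; j]).
  exact: (test_function_L2 [:: i; j]).
have E x : \sum_(i < 2) \sum_(j < 2) H i j x ^+ 2 =
    H i0 i0 x ^+ 2 + H i0 i1 x ^+ 2 + (H i1 i0 x ^+ 2 + H i1 i1 x ^+ 2).
  by rewrite !big_ord_recl !big_ord0 !addr0.
have iS : (leb2 R).-integrable Omega
    (EFin \o (fun x => H i0 i0 x ^+ 2 + H i0 i1 x ^+ 2 + (H i1 i0 x ^+ 2 + H i1 i1 x ^+ 2))).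
  have D f g : (leb2 R).-integrable Omega (EFin \o f) -> (leb2 R).-integrable Omega (EFin \o g) ->
      (leb2 R).-integrable Omega (EFin \o (fun x => f x + g x)).
    move=> hf hg; have := @integrableD _ _ _ (leb2 R) Omega mOmega _ _ hf hg.
    by rewrite /comp /=; under eq_fun do rewrite -EFinD.
  exact: D (D _ _ (iH i0 i0) (iH i0 i1)) (D _ _ (iH i1 i0) (iH i1 i1)).
have I0 : 0 <= \int[leb2 R]_(x in Omega) (\sum_(i < 2) \sum_(j < 2) H i j x ^+ 2).
  by apply: (@Rintegral_ge0 _ _ _ (leb2 R)) => x _; rewrite E !addr_ge0 ?sqr_ge0.
rewrite /hess_norm sqr_sqrtr//.
have /fineK <- : (\int[leb2 R]_(x in Omega) (H i1 i0 x ^+ 2)%:E \is a fin_num)%E.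
  exact: (@integrable_fin_num _ _ _ (leb2 R) Omega mOmega _ (iH i1 i0)).
rewrite lee_fin; under eq_Rintegral do rewrite E.
apply: (@le_Rintegral _ _ _ (leb2 R)) => // x _.
have h := sqr_ge0 (H _ _ x); have h1 := h i0 i0; have h2 := h i0 i1; have h3 := h i1 i1.
by move: h1 h2 h3; lra.
Qed.

Lemma sobolev_point v G H x : continuous v -> H20_jet Omega v G H -> Omega x ->
  `|v x| <= (1 + vol Omega / 2) * hess_norm Omega H.
Proof.
move=> cv jet Ox; have hle := jet_hess_le jet; have [phi [tphi cphi _ hH]] := jet.
set N := hess_norm Omega H in hle *; have N0 : 0 <= N by exact: hess_norm_ge0.
have c0 : 0 < 1 + vol Omega / 2 by rewrite ltr_wpDr// divr_ge0// vol_ge0.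
(* [N] may be zero, so the bound is shown for every [s] above it. The choices $e=s^2-N^2$ and
   $\theta=1/s$ turn the Young bound into exactly $(1+\mathrm{vol}/2)s$. *)
have main s : N < s -> `|v x| <= (1 + vol Omega / 2) * s.
  move=> Ns; have s0 : 0 < s by exact: le_lt_trans Ns.
  have e0 : 0 < s ^+ 2 - N ^+ 2 by rewrite subr_gt0 ltrXn2r.
  apply: (L2_limit_bounded oOmega cv _ cphi) => //.
    by move=> n; exact: (test_function_partials [::] (tphi n)).
  have mg n : measurable_fun Omega (partial i1 (partial i0 (phi n))).
    exact: (test_function_partials [:: i1; i0] (tphi n)).
  have := cvg_L2_le mg (hH i1 i0) e0; apply: filterS => n [hn _] y Oy.
  rewrite -lee_fin; apply: (le_trans (test_function_le_integral oOmega Omega_box (tphi n) Oy)).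
  have si0 : 0 < s^-1 by rewrite invr_gt0.
  apply: (le_trans (integral_le_sqr oOmega Omega_box (mg n) si0)).
  have hn' : (\int[leb2 R]_(x in Omega) (partial i1 (partial i0 (phi n)) x ^+ 2)%:E <=
      (2 * s ^+ 2)%:E)%E.
    apply: (le_trans hn).
    have -> : ((2 * s ^+ 2)%:E = 2%:E * (s ^+ 2 - N ^+ 2)%:E + 2%:E * (N ^+ 2)%:E)%E.
      by rewrite -!EFinM -EFinD; congr EFin; ring.
    by apply: leeD2l; apply: lee_wpmul2l; rewrite ?lee_fin.
  have -> : ((1 + vol Omega / 2) * s)%:E =
      ((s^-1 / 2)%:E * (2 * s ^+ 2)%:E + (vol Omega / (2 * s^-1))%:E)%E.
    by rewrite -EFinM -EFinD; congr EFin; field; rewrite gt_eqF.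
  by apply: leeD2r; apply: lee_wpmul2l => //; rewrite lee_fin ltW// divr_gt0.
rewrite leNgt; apply/negP => h.
(* The midpoint between [N] and the supposed larger quotient is a value of [s] that contradicts
   [main]. *)
pose s := (N + `|v x| / (1 + vol Omega / 2)) / 2.
have h' : N < `|v x| / (1 + vol Omega / 2) by rewrite ltr_pdivlMr// mulrC.
have /main : N < s by rewrite /s; move: h'; set a := _ / _; lra.
rewrite mulrC -ler_pdivrMr// /s; move: h'; set a := _ / _; lra.
Qed.

Lemma partial_add f g i x : derivable f x (basis_vec R i) -> derivable g x (basis_vec R i) ->
  partial i (f \+ g) x = partial i f x + partial i g x.
Proof. by move=> df dg; rewrite /partial -deriveD. Qed.

Lemma partials_add f g s : smooth f -> smooth g ->
  partials s (f \+ g) = partials s f \+ partials s g.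
Proof.
move=> sf sg; elim: s => // i s IH; rewrite /= IH; apply/funext => x.
have [_ df] := sf s; have [_ dg] := sg s.
by rewrite partial_add.
Qed.

Lemma test_function_add f g : test_function Omega f -> test_function Omega g ->
  test_function Omega (f \+ g).
Proof.
move=> [sf [K [cK KO f0]]] [sg [L [cL LO g0]]]; split.
  move=> s; rewrite partials_add//; have [cf df] := sf s; have [cg dg] := sg s; split.
    by move=> x; apply: cvgD; [exact: cf|exact: cg].
  by move=> i x; exact: (derivableD (df i x) (dg i x)).
exists (K `|` L); split; first exact: compactU.
  by rewrite subUset.
by move=> x /not_orP[nK nL] /=; rewrite f0// g0// addr0.
Qed.

Lemma cvg_L2_add (f g : nat -> pt R -> R) f' g' : (forall n, measurable_fun Omega (f n)) ->
  (forall n, measurable_fun Omega (g n)) -> cvg_L2 Omega f f' -> cvg_L2 Omega g g' ->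
  cvg_L2 Omega (fun n => f n \+ g n) (f' \+ g').
Proof.
move=> mf mg [mf' cf] [mg' cg]; split; first exact: measurable_funD.
have z : (0 = 2%:E * 0 + 2%:E * 0 :> \bar R)%E by rewrite mule0 adde0.
have H : ((fun n => 2%:E * \int[leb2 R]_(x in Omega) ((f n x - f' x) ^+ 2)%:E
   + 2%:E * \int[leb2 R]_(x in Omega) ((g n x - g' x) ^+ 2)%:E)%E @ \oo --> 0%E).
  rewrite [X in _ --> X]z; apply: cvgeD; rewrite ?mule0//.
    by rewrite -[X in _ --> X](mule0 2%:E); apply: cvgeZl.
  by rewrite -[X in _ --> X](mule0 2%:E); apply: cvgeZl.
apply: (squeeze_cvge _ (cvg_cst 0%E) H); near=> n; apply/andP; split.
  by apply: integral_ge0 => x _; rewrite lee_fin sqr_ge0.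
have h1 := @integral_sqrD_le _ _ _ (leb2 R) _ mOmega (fun x => f n x - f' x)
  (fun x => g n x - g' x) (measurable_funB (mf n) mf') (measurable_funB (mg n) mg').
apply: le_trans h1; rewrite le_eqVlt; apply/orP; left; apply/eqP.
by apply: eq_integral => x _ /=; congr (EFin (_ ^+ 2)); ring.
Unshelve. all: by end_near. Qed.

(** The companion is given as a sum of two elements of $V$, while its energy bound speaks about a
    jet of the sum. *)
Lemma jet_add v w Gv Gw Hv Hw : H20_jet Omega v Gv Hv -> H20_jet Omega w Gw Hw ->
  H20_jet Omega (v \+ w) (fun i => Gv i \+ Gw i) (fun i j => Hv i j \+ Hw i j).
Proof.
move=> [f [tf cf gf hf]] [g [tg cg gg hg]]; exists (fun n => f n \+ g n).
have pa s n : partials s (f n \+ g n) = partials s (f n) \+ partials s (g n).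
  by apply: partials_add; [case: (tf n)|case: (tg n)].
have mf s n : measurable_fun Omega (partials s (f n)) by exact: test_function_partials.
have mg s n : measurable_fun Omega (partials s (g n)) by exact: test_function_partials.
split.
- by move=> n; exact: test_function_add.
- by apply: cvg_L2_add => // n; [exact: (mf [::])|exact: (mg [::])].
- move=> i; have -> : (fun n => partial i (f n \+ g n)) = (fun n => partial i (f n) \+ partial i (g n)).
    by apply/funext => n; exact: (pa [:: i]).
  by apply: cvg_L2_add => // n; [exact: (mf [:: i])|exact: (mg [:: i])].
- move=> i j; have -> : (fun n => partial i (partial j (f n \+ g n))) =
      (fun n => partial i (partial j (f n)) \+ partial i (partial j (g n))).
    by apply/funext => n; exact: (pa [:: i; j]).
  by apply: cvg_L2_add => // n; [exact: (mf [:: i; j])|exact: (mg [:: i; j])].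
Qed.

End SobolevPoint.

(** * The triangulated domain and the bound of vertex values *)

Section Domain.
Variables (R : realType) (Omega : set (pt R)).
Implicit Types (x z : pt R) (t : tri R) (M : {fset tri R}).

Lemma bounded_box : bounded_set Omega ->
  exists B, forall x, Omega x -> [/\ - B < x.1, x.1 < B, - B < x.2 & x.2 < B].
Proof.
move=> [M [_ hM]]; exists (`|M| + 2) => x Ox.
have M1 : M < `|M| + 1 by rewrite (le_lt_trans (ler_norm M))// ltrDl.
have := hM _ M1 _ Ox; rewrite /= prod_normE ge_max => /andP[].
rewrite !ler_norml => /andP[? ?] /andP[? ?].
by have := normr_ge0 M; split; lra.
Qed.

Lemma open_tint t : det t != 0 -> open (tint t).
Proof.
have gt0 (f : pt R -> R) : (exists al be ga, forall x, f x = al * x.1 + be * x.2 + ga) ->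
    open [set x | 0 < f x].
  move=> [al [be [ga h]]]; apply: (@open_comp _ _ f [set y | 0 < y]); last exact: open_gt.
  move=> x _; rewrite (funext h); apply: cvgD; last exact: cvg_cst.
  by apply: cvgD; (apply: cvgM; first exact: cvg_cst); [exact: cvg_fst|exact: cvg_snd].
move=> d0; rewrite (_ : tint t = [set x | 0 < bc0 t x] `&` [set x | 0 < bc1 t x] `&` [set x | 0 < bc2 t x]).
  apply: openI; first apply: openI.
  - exact: gt0 (bc0_affine t).
  - exact: gt0 (bc1_affine t).
  - exact: gt0 (bc2_affine t).
apply/seteqP; split => x.
  by case/(tintP x d0) => h0 h1 h2; split.
by case=> -[h0 h1] h2; apply/(tintP x d0).
Qed.

(* Near a boundary point the domain lies strictly above a Lipschitz graph, so a
   neighbourhood of that point cannot be covered by the closure. *)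
Lemma interior_closure_lipschitz (U : set (pt R)) : lipschitz_boundary Omega -> open U ->
  U `<=` closure Omega -> U `<=` Omega.
Proof.
move=> lip oU Ucl x Ux; apply: contrapT => nOx.
have [e [gam [L [eps [e1 lipg eps0 hg]]]]] := lip x (conj (Ucl _ Ux) nOx).
have g0 : 0 <= gam 0.
  rewrite leNgt; apply/negP => g0; apply: nOx.
  have n0 : `|0 : R| < eps by rewrite normr0.
  have := (hg 0 0 n0 n0).2 g0.
  by rewrite !mul0r !subr0 !addr0 -surjective_pairing.
have lipg' s : `|gam s - gam 0| <= L * `|s|.
  by have := lipg (s, 0) (conj I I); rewrite /self_sub /= subr0.
have /nbhs_ballP[k /= k0 hk] := oU _ Ux.
have ee1 : `|e.1| <= 1 by rewrite -(@ler_pXn2r _ 2)// ?nnegrE// expr1n real_normK ?num_real// -e1 lerDl sqr_ge0.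
have ee2 : `|e.2| <= 1 by rewrite -(@ler_pXn2r _ 2)// ?nnegrE// expr1n real_normK ?num_real// -e1 lerDr sqr_ge0.
pose rho := Num.min (k / 2) (eps / 4).
have rho0 : 0 < rho by rewrite lt_min !divr_gt0.
have rk : rho <= k / 2 by rewrite ge_min lexx.
have re : rho <= eps / 4 by rewrite ge_min lexx orbT.
(* The tolerance gives $2\kappa'(1+|L|)=\rho/2$ for $\kappa'$ = [kap]: within it the graph stays
   above height $-|L|\,2\kappa'$, and the perturbed point stays below $-\rho+2\kappa'$. *)
pose kap : R := rho / (4 * (1 + `|L|)).
have L1 : 0 < 1 + `|L| by rewrite ltr_pwDl.
have kap0 : 0 < kap by rewrite divr_gt0// mulr_gt0.
have kapE : kap * (4 * (1 + `|L|)) = rho by rewrite divfK// gt_eqF// mulr_gt0.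
(* The point at depth [rho] below [x], with local coordinates $(s,r)=(0,-\rho)$; [q'] will be a
   point of the domain close to it. *)
pose q : pt R := (x.1 + rho * e.2, x.2 - rho * e.1).
have bound (a b : R) : `|b| <= 1 -> `|a * b| <= `|a|.
  by move=> b1; rewrite normrM ler_piMr.
have Uq : U q.
  apply: hk; split; rewrite /ball /q /=.
    rewrite opprD addrA subrr sub0r normrN; apply: le_lt_trans (bound _ _ ee2) _.
    by rewrite gtr0_norm//; lra.
  rewrite opprB addrCA subrr addr0; apply: le_lt_trans (bound _ _ ee1) _.
  by rewrite gtr0_norm//; lra.
have [|q' [Oq' [/= b1 b2]]] := Ucl _ Uq (ball q kap); first exact: nbhsx_ballx.
rewrite /ball /= in b1 b2.
pose d1 := q'.1 - q.1; pose d2 := q'.2 - q.2.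
have nd1 : `|d1| < kap by rewrite /d1 distrC.
have nd2 : `|d2| < kap by rewrite /d2 distrC.
pose s := d1 * e.1 + d2 * e.2; pose r := - rho - d1 * e.2 + d2 * e.1.
have q'E : q' = (x.1 + s * e.1 - r * e.2, x.2 + s * e.2 + r * e.1).
  have E (a : R) : a = a * (e.1 ^+ 2 + e.2 ^+ 2) by rewrite e1 mulr1.
  apply: pt_eq; rewrite /= /s /r.
    transitivity (x.1 + rho * e.2 + d1 * (e.1 ^+ 2 + e.2 ^+ 2)); last by ring.
    by rewrite -E /d1 /q /=; ring.
  transitivity (x.2 - rho * e.1 + d2 * (e.1 ^+ 2 + e.2 ^+ 2)); last by ring.
  by rewrite -E /d2 /q /=; ring.
have t1 := le_lt_trans (bound d1 _ ee1) nd1; have t2 := le_lt_trans (bound d2 _ ee2) nd2.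
have t3 := le_lt_trans (bound d1 _ ee2) nd1; have t4 := le_lt_trans (bound d2 _ ee1) nd2.
rewrite !ltr_norml in t1 t2 t3 t4.
move: t1 t2 t3 t4 => /andP[t1 t1'] /andP[t2 t2'] /andP[t3 t3'] /andP[t4 t4'].
have kaple : 4 * kap <= rho.
  by rewrite -kapE; have := normr_ge0 L; nra.
have ns : `|s| < 2 * kap by rewrite ltr_norml /s; apply/andP; split; lra.
have ns' : `|s| < eps by lra.
have nr : `|r| < eps by rewrite ltr_norml /r; apply/andP; split; lra.
move: Oq'; rewrite q'E => /(hg s r ns' nr).1 gr.
have rle : r < - rho + 2 * kap by rewrite /r; lra.
have := lipg' s; rewrite ler_norml => /andP[l1 _].
have : L * `|s| <= `|L| * (2 * kap).
  apply: (@le_trans _ _ (`|L| * `|s|)); first by rewrite ler_wpM2r// ler_norm.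
  by rewrite ler_wpM2l// ltW.
by have := normr_ge0 L; nra.
Qed.

Lemma tint_Omega M t : polygonal_lipschitz_domain Omega -> regular_triangulation Omega M ->
  t \in M -> tint t `<=` Omega.
Proof.
move=> [_ lip] reg tM; have d0 := regular_det reg tM.
apply: interior_closure_lipschitz => //; first exact: open_tint.
move=> x xt; case: reg => _ -> _; exists t => //; exact: tint_tset.
Qed.

Lemma companion_vertex_bound (M : {fset tri R}) CJ J w t z :
  polygonal_lipschitz_domain Omega -> companion Omega M CJ J ->
  morley Omega M w -> t \in M -> z \in verts t ->
  `|ev (w t) z| <= (1 + vol Omega / 2) * `|CJ| * norm_pw M w.
Proof.
move=> [[oO _ _ bO _] _] [_ dec vert bnd] mw tM zt.
have [B hB] := bounded_box bO.
have [w1 [w2 [[V1 _] [V2 _] Jw]]] := dec w mw.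
have v0 : 0 <= 1 + vol Omega / 2 by rewrite addr_ge0// divr_ge0// vol_ge0.
have n0 : 0 <= norm_pw M w by exact: sqrtr_ge0.
have [c1 z1 [G1 [H1 j1]]] := V1; have [c2 z2 [G2 [H2 j2]]] := V2.
rewrite -(vert w t z mw tM zt).
(* A vertex outside the open domain is a zero of both summands of the companion. *)
have [Oz|nOz] := pselect (Omega z); last first.
  by rewrite Jw z1// z2// addr0 normr0 !mulr_ge0.
have jj := jet_add oO j1 j2.
have JE : J w = w1 \+ w2 by rewrite Jw.
rewrite -JE in jj.
have cJ : continuous (J w) by rewrite JE => x; apply: cvgD; [exact: c1|exact: c2].
apply: (le_trans (sobolev_point oO hB cJ jj Oz)).
rewrite -mulrA ler_wpM2l//; apply: (le_trans (bnd w _ _ mw jj)).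
by rewrite ler_wpM2r// ler_norm.
Qed.

End Domain.

(** * Perturbation of square roots of sums of squares *)

Section SqrtClose.
Variable R : realType.
Implicit Types A B C : R.

(* C bounds the squared distance of two vectors with squared norms A and B *)
Definition sqrt_close A B C : Prop :=
  [/\ 0 <= A, 0 <= B & (Num.sqrt A - Num.sqrt B) ^+ 2 <= C].

Lemma sqrt_close_le A B C C' : C <= C' -> sqrt_close A B C -> sqrt_close A B C'.
Proof. by move=> CC' [A0 B0 h]; split => //; exact: le_trans CC'. Qed.

(** The plane triangle inequality for $(\sqrt A,\sqrt{A'})$ and $(\sqrt B,\sqrt{B'})$; [cs] is
    Cauchy-Schwarz, with a perfect square as its defect. *)
Lemma sqrt_closeD A B C A' B' C' : sqrt_close A B C -> sqrt_close A' B' C' ->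
  sqrt_close (A + A') (B + B') (C + C').
Proof.
move=> [A0 B0 h] [A0' B0' h']; split; [exact: addr_ge0|exact: addr_ge0|].
apply: le_trans (lerD h h'); rewrite !sqrrB !sqr_sqrtr ?addr_ge0//.
have cs : Num.sqrt A * Num.sqrt B + Num.sqrt A' * Num.sqrt B' <=
    Num.sqrt (A + A') * Num.sqrt (B + B').
  rewrite -[leRHS]sqrtrM ?addr_ge0//; apply: (le_trans (ler_norm _)); rewrite -sqrtr_sqr.
  apply: ler_wsqrtr.
  have [a2 b2] := (sqr_sqrtr A0, sqr_sqrtr B0); have [a2' b2'] := (sqr_sqrtr A0', sqr_sqrtr B0').
  rewrite -[in leRHS]a2 -[in leRHS]b2 -[in leRHS]a2' -[in leRHS]b2'.
  set a := Num.sqrt A; set b := Num.sqrt B; set a' := Num.sqrt A'; set b' := Num.sqrt B'.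
  rewrite -subr_ge0.
  have -> : (a ^+ 2 + a' ^+ 2) * (b ^+ 2 + b' ^+ 2) - (a * b + a' * b') ^+ 2 = (a * b' - a' * b) ^+ 2.
    by ring.
  exact: sqr_ge0.
by rewrite !mulr2n; lra.
Qed.

Lemma sqrt_close0 : sqrt_close 0 0 0.
Proof. by split => //; rewrite subrr expr0n. Qed.

Lemma sqrt_close_sum (I : eqType) (s : seq I) (P : pred I) (A B C : I -> R) :
  (forall i, i \in s -> P i -> sqrt_close (A i) (B i) (C i)) ->
  sqrt_close (\sum_(i <- s | P i) A i) (\sum_(i <- s | P i) B i) (\sum_(i <- s | P i) C i).
Proof.
elim: s => [|i s IH] h; first by rewrite !big_nil; exact: sqrt_close0.
have hs : sqrt_close (\sum_(i <- s | P i) A i) (\sum_(i <- s | P i) B i) (\sum_(i <- s | P i) C i).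
  by apply: IH => j js; apply: h; rewrite inE js orbT.
rewrite !big_cons; case: ifP => // Pi; apply: sqrt_closeD => //.
by apply: h => //; rewrite inE eqxx.
Qed.

Lemma sqrt_close_scale k A B C : 0 <= k -> sqrt_close A B C ->
  sqrt_close (k * A) (k * B) (k * C).
Proof.
move=> k0 [A0 B0 h]; split; [exact: mulr_ge0|exact: mulr_ge0|].
by rewrite !sqrtrM// -mulrBr exprMn sqr_sqrtr// ler_wpM2l.
Qed.

Lemma sqrt_close_sqr x y : sqrt_close (x ^+ 2) (y ^+ 2) ((x - y) ^+ 2).
Proof.
split; rewrite ?sqr_ge0// !sqrtr_sqr -[leRHS]real_normK ?num_real//.
by rewrite -[leLHS]real_normK ?num_real// lerXn2r ?nnegrE// ler_dist_dist.
Qed.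

Lemma sqrt_close_dist A B C (L D : R) : 0 <= L -> 0 <= D -> C <= L ^+ 2 * D ->
  sqrt_close A B C -> `|Num.sqrt A - Num.sqrt B| <= L * Num.sqrt D.
Proof.
move=> L0 D0 CLD [_ _ h]; rewrite -(@ler_pXn2r _ 2)// ?nnegrE ?mulr_ge0 ?sqrtr_ge0//.
by rewrite real_normK ?num_real// exprMn sqr_sqrtr// (le_trans h).
Qed.

End SqrtClose.

(** * Reverse triangle inequality in $L^2$ *)

Section L2Close.
Context d (T : measurableType d) (R : realType) (mu : {measure set T -> \bar R}).
Variables (D : set T) (mD : measurable D).
Implicit Types F G : T -> R.

(** [key] integrates the pointwise inequality $(1-\theta)F^2+(1-\theta^{-1})G^2\le(F-G)^2$. With
    norms $a$ and $b$ the optimal $\theta=b/a$ makes its left side $(a-b)^2$. *)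
Lemma sqrt_close_Rintegral F G (S m : R) : mu D = m%:E ->
  measurable_fun D F -> measurable_fun D G ->
  (\int[mu]_(x in D) (F x ^+ 2)%:E < +oo)%E -> (\int[mu]_(x in D) (G x ^+ 2)%:E < +oo)%E ->
  0 <= S -> (forall x, D x -> `|F x - G x| <= S) ->
  sqrt_close (\int[mu]_(x in D) (F x ^+ 2)) (\int[mu]_(x in D) (G x ^+ 2)) (m * S ^+ 2).
Proof.
move=> muD mF mG fF fG S0 hS.
have iF := sqr_integrable mF fF; have iG := sqr_integrable mG fG.
have A0 : 0 <= \int[mu]_(x in D) (F x ^+ 2) by apply: Rintegral_ge0 => x _; exact: sqr_ge0.
have B0 : 0 <= \int[mu]_(x in D) (G x ^+ 2) by apply: Rintegral_ge0 => x _; exact: sqr_ge0.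
split => //.
have C_E : \int[mu]_(x in D) (S ^+ 2) = m * S ^+ 2.
  by rewrite Rintegral_cst// muD mulrC.
have iC : mu.-integrable D (EFin \o (fun=> S ^+ 2)).
  apply/integrableP; split; first exact/measurable_EFinP.
  by rewrite /= integral_cst// muD -EFinM ltry.
have key th : 0 < th -> (1 - th) * \int[mu]_(x in D) (F x ^+ 2) +
    (1 - th^-1) * \int[mu]_(x in D) (G x ^+ 2) <= m * S ^+ 2.
  move=> th0.
  have iZ k (f : T -> R) : mu.-integrable D (EFin \o f) -> mu.-integrable D (EFin \o (fun x => k * f x)).
    by move=> hf; have := integrableZl mD k hf; under eq_fun do rewrite -EFinM.
  rewrite -C_E -!RintegralZl// -RintegralD//; [|exact: iZ|exact: iZ].
  apply: le_Rintegral => //.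
    have := integrableD mD (iZ (1 - th) _ iF) (iZ (1 - th^-1) _ iG).
    by rewrite /comp /=; under eq_fun do rewrite -EFinD.
  move=> x Dx; apply: (@le_trans _ _ ((F x - G x) ^+ 2)).
    rewrite -subr_ge0.
    have -> : (F x - G x) ^+ 2 - ((1 - th) * F x ^+ 2 + (1 - th^-1) * G x ^+ 2) =
       (th * F x - G x) ^+ 2 / th by field; rewrite gt_eqF.
    by rewrite divr_ge0 ?sqr_ge0// ltW.
  by rewrite -[leLHS]real_normK ?num_real// lerXn2r ?nnegrE// hS.
move: key A0 B0; set A := \int[mu]_(x in D) (F x ^+ 2); set B := \int[mu]_(x in D) (G x ^+ 2).
move=> key A0 B0; set a := Num.sqrt A; set b := Num.sqrt B.
have a0 : 0 <= a by exact: sqrtr_ge0.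
have b0 : 0 <= b by exact: sqrtr_ge0.
have aA : A = a ^+ 2 by rewrite sqr_sqrtr.
have bB : B = b ^+ 2 by rewrite sqr_sqrtr.
apply/ler_addgt0Pr => e e0.
pose ep := e / (a + b + 1).
have ab0 : 0 < a + b + 1 by rewrite ltr_wpDl// addr_ge0.
have ep0 : 0 < ep by rewrite divr_gt0.
have aep : 0 < a + ep by rewrite ltr_wpDl.
have bep : 0 < b + ep by rewrite ltr_wpDl.
(* The shift by [ep] keeps the ratio defined and positive when a norm vanishes, at a cost of at most
   [e]. *)
have := key ((b + ep) / (a + ep)) (divr_gt0 bep aep); rewrite aA bB => k1.
apply: (@le_trans _ _ (m * S ^+ 2 + ep * (a + b))); last first.
  by rewrite lerD2l /ep mulrAC ler_pdivrMr// ler_pM2l// lerDl.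
have h1 : a ^+ 2 * ((b + ep) / (a + ep)) <= a * (b + ep).
  rewrite mulrA ler_pdivrMr//; have := mulr_ge0 (mulr_ge0 a0 (ltW bep)) (ltW ep0); lra.
have h2 : b ^+ 2 * ((b + ep) / (a + ep))^-1 <= b * (a + ep).
  rewrite invf_div mulrA ler_pdivrMr//; have := mulr_ge0 (mulr_ge0 b0 (ltW aep)) (ltW ep0); lra.
by move: k1 h1 h2; set th := _ / _; lra.
Qed.

End L2Close.

(** * Edge terms *)

Section EdgeJumps.
Variable R : realType.
Implicit Types (x z A B : pt R) (t k : tri R) (E F : pt R * pt R) (M T N : {fset tri R})
  (p q : poly2 R) (v : broken R).

Lemma ev_sum (I : Type) (s : seq I) (P : pred I) (f : I -> poly2 R) x :
  ev (\sum_(i <- s | P i) f i) x = \sum_(i <- s | P i) ev (f i) x.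
Proof.
by apply: (big_morph (fun p => ev p x)); [move=> p q; rewrite /ev !hornerE|rewrite /ev !hornerE].
Qed.

Definition jump M v t E (i j : 'I_2) : R :=
  hs (v t) i j - \sum_(k <- M | (k != t) && has_edge k E) hs (v k) i j.

Lemma ev_hess_jump M v t E i j x : (forall k, k \in M -> total_degree_le 2 (v k)) -> t \in M ->
  ev (hess_jump M v t E i j) x = jump M v t E i j.
Proof.
move=> dv tM; rewrite /hess_jump ev_sub ev_sum (ev_hess _ _ _ (dv _ tM)); congr (_ - _).
rewrite big_seq_cond [RHS]big_seq_cond; apply: eq_bigr => k /andP[kM _].
by rewrite (ev_hess _ _ _ (dv _ kM)).
Qed.

Lemma edge_length_neq0 E : E.1 <> E.2 -> edge_length E != 0.
Proof.
move=> n; have : edge_length E ^+ 2 != 0.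
  rewrite edge_lengthE /dist2; apply/eqP => /eqP.
  rewrite paddr_eq0 ?sqr_ge0// !sqrf_eq0 !subr_eq0 => /andP[/eqP a /eqP b].
  by apply: n; apply: pt_eq.
by rewrite sqrf_eq0.
Qed.

Lemma tangent_unit E : E.1 <> E.2 -> (tangent E).1 ^+ 2 + (tangent E).2 ^+ 2 = 1.
Proof.
move=> n; have L0 := edge_length_neq0 n.
rewrite /tangent /= !exprMn -mulrDl.
have -> : (E.2.1 - E.1.1) ^+ 2 + (E.2.2 - E.1.2) ^+ 2 = edge_length E ^+ 2.
  by rewrite edge_lengthE.
by rewrite -exprMn divff// expr1n.
Qed.

Lemma hess_jump_norm2E M v t E : (forall k, k \in M -> total_degree_le 2 (v k)) -> t \in M ->
  hess_jump_norm2 M v t E = edge_length E *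
    \sum_(i < 2) (\sum_(j < 2) jump M v t E i j * Defs.coord j (tangent E)) ^+ 2.
Proof.
move=> dv tM; rewrite /hess_jump_norm2 /edge_integral; congr (_ * _).
set c := (RHS).
transitivity (\int[@lebesgue_measure R]_(s in `[0, 1]) c).
  apply: eq_Rintegral => s _; apply: eq_bigr => i _; congr (_ ^+ 2); apply: eq_bigr => j _.
  by rewrite ev_hess_jump.
rewrite Rintegral_cst//=.
have -> : lebesgue_measure (`[0, 1]%classic : set R) = 1%E.
  by rewrite lebesgue_measure_itv /= lte_fin ltr01 -EFinB subr0.
by rewrite mulr1.
Qed.

Lemma neighbour_sum Omega M t k E (f : tri R -> R) : regular_triangulation Omega M ->
  t \in M -> k \in M -> has_edge t E -> has_edge k E -> k != t ->
  \sum_(k' <- M | (k' != t) && has_edge k' E) f k' = f k.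
Proof.
move=> reg tM kM tE kE kt; rewrite big_mkcond (big_fsetD1 k)//= kt kE /= big_seq big1 ?addr0// => k'.
rewrite !inE => /andP[k'k k'M]; case: ifP => // /andP[k't k'E].
by rewrite (regular_neighbour_unique reg tM k'M kM tE k'E kE k't kt) eqxx in k'k.
Qed.

Lemma no_neighbour_sum M t E (f : tri R -> R) : (forall k, k \in M -> k != t -> ~ has_edge k E) ->
  \sum_(k' <- M | (k' != t) && has_edge k' E) f k' = 0.
Proof.
move=> h; rewrite big_seq_cond big1// => k /andP[kM /andP[kt kE]].
by case: (h k kM kt).
Qed.

(** * Neighbours of common triangles in a mesh and its refinement *)

Section Refinement.
Variables (Omega : set (pt R)) (T N : {fset tri R}).
Hypotheses (rT : regular_triangulation Omega T) (rN : regular_triangulation Omega N)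
  (hTN : nvb T N).

(** The edge cannot have been bisected on the side of [k], since its midpoint would be a hanging
    node on the surviving triangle [t]. *)
Lemma neighbour_refines t k E : t \in T -> t \in N -> has_edge t E -> k \in T -> k != t ->
  has_edge k E -> exists k', [/\ k' \in N, k' != t, has_edge k' E & tset k' `<=` tset k].
Proof.
move=> tT tN tE kT kt kE.
have [[k' [k'N k'k k'E]]|mN] := nvb_edge hTN kT kE.
  exists k'; split => //; apply/eqP => e; rewrite e in k'k.
  move/eqP: kt; apply; apply: (regular_container_unique rT (regular_det rT tT) kT tT k'k).
  exact: subset_refl.
by case: (bisected_not_fine rN (edge_neq (regular_det rN tN) tE) mN tN tE).
Qed.

(** The coarse triangle containing [k'] meets [t] at least in all of [E]; by regularity they share
    an edge, and this must be [E]. *)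
Lemma neighbour_coarse t k' E : t \in T -> t \in N -> has_edge t E -> k' \in N -> k' != t ->
  has_edge k' E -> exists k, [/\ k \in T, k != t, has_edge k E & tset k' `<=` tset k].
Proof.
move=> tT tN tE k'N k't k'E; have [k kT k'k] := nvb_container hTN k'N.
have dk' := regular_det rN k'N; have n := edge_neq dk' k'E.
have kt : k != t.
  apply/eqP => e; rewrite e in k'k; move/eqP: k't; apply.
  by apply: (regular_container_unique rN dk' k'N tN _ k'k); exact: subset_refl.
exists k; split => //.
have sE : seg E `<=` tset k `&` tset t.
  by move=> x Ex; split; [apply: k'k; exact: (seg_tset k'E)|exact: (seg_tset tE)].
have [_ _ /(_ k t kT tT (elimN eqP kt)) H] := rT.
case: H => [h|[z [_ _ h]]|[F [kF tF h]]]; rewrite h in sE.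
- by case: (sE _ (seg_endl E)).
- by case: n; rewrite (sE _ (seg_endl E)) (sE _ (seg_endr E)).
- by rewrite (has_edge_same _ (edge_seg_sub (regular_det rT tT) tE tF sE)).
Qed.

Lemma neighbour_sum_restrict t E v i j : t \in T -> t \in N -> has_edge t E ->
  \sum_(k <- T | (k != t) && has_edge k E) hs (v k) i j =
  \sum_(k <- N | (k != t) && has_edge k E) hs (Defs.restrict T v k) i j.
Proof.
move=> tT tN tE.
have [[k [kT kt kE]]|none] := pselect (exists k, [/\ k \in T, k != t & has_edge k E]).
  have [k' [k'N k't k'E k'k]] := neighbour_refines tT tN tE kT kt kE.
  rewrite (neighbour_sum _ rT tT kT tE kE kt) (neighbour_sum _ rN tN k'N tE k'E k't).
  by rewrite (restrictE _ rT kT (regular_det rN k'N) k'k).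
rewrite !no_neighbour_sum// => k' k'N k't.
  move=> k'E; have [k [kT kt kE _]] := neighbour_coarse tT tN tE k'N k't k'E.
  by apply: none; exists k.
by move=> k'E; apply: none; exists k'.
Qed.

Variable kappa : R.
Hypotheses (kappa0 : 0 < kappa) (shN : shape kappa N).

Let c := 4 * kappa * (kappa + 1).

(** The sizes of neighbours are compared through their common edge: $h_T|E|\le(h_T^2+|E|^2)/2$, with
    $h_T^2\le\kappa|E|^2$ and $|E|^2\le4\kappa|k|$. *)
Lemma hT_edge_le t k E : t \in N -> has_edge t E -> k \in N -> has_edge k E ->
  hT t * edge_length E <= c / 2 * area k.
Proof.
move=> tN tE kN kE; have dt := regular_det rN tN.
have h1 := area_le_edge shN tN dt tE; have h2 := edge_length_le shN kN kE.
have h3 := hT_sqr dt; rewrite -h3 in h1.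
apply: (@le_trans _ _ ((kappa + 1) / 2 * edge_length E ^+ 2)).
  by have := sqr_ge0 (hT t - edge_length E); move: h1; set a := hT t; set b := edge_length E; lra.
have k1 : 0 <= (kappa + 1) / 2 by rewrite divr_ge0// addr_ge0// ltW.
by have := ler_wpM2l k1 h2; rewrite /c; lra.
Qed.

Variables v v' : broken R.
Hypotheses (dv : forall k, k \in T -> total_degree_le 2 (v k))
  (dv' : forall k, k \in N -> total_degree_le 2 (v' k)).

Let D k := hsq (v' k - Defs.restrict T v k).

(** The sum has at most one term, so squaring produces no cross terms. *)
Lemma sqr_sum_neighbour t E (f : tri R -> R) : t \in N -> has_edge t E ->
  (\sum_(k <- N | (k != t) && has_edge k E) f k) ^+ 2 =
  \sum_(k <- N | (k != t) && has_edge k E) f k ^+ 2.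
Proof.
move=> tN tE.
have [[k [kN kt kE]]|none] := pselect (exists k, [/\ k \in N, k != t & has_edge k E]).
  by rewrite !(neighbour_sum _ rN tN kN tE kE kt).
rewrite !no_neighbour_sum ?expr0n// => k kN kt kE; apply: none; exists k; split => //.
Qed.

Lemma jump_close t E : t \in T -> t \in N -> has_edge t E ->
  sqrt_close (hT t * hess_jump_norm2 N v' t E) (hT t * hess_jump_norm2 T v t E)
    (c * (area t * D t + \sum_(k <- N | (k != t) && has_edge k E) area k * D k)).
Proof.
move=> tT tN tE; have dt := regular_det rN tN; have n := edge_neq dt tE.
rewrite !hess_jump_norm2E//.
pose dl i j := jump N v' t E i j - jump T v t E i j.
have h0 : 0 <= hT t by exact: sqrtr_ge0.
have l0 := edge_length_ge0 E.
have := @sqrt_close_sum R _ (index_enum 'I_2) xpredT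
  (fun i => (\sum_(j < 2) jump N v' t E i j * Defs.coord j (tangent E)) ^+ 2)
  (fun i => (\sum_(j < 2) jump T v t E i j * Defs.coord j (tangent E)) ^+ 2)
  (fun i => (\sum_(j < 2) jump N v' t E i j * Defs.coord j (tangent E) -
     \sum_(j < 2) jump T v t E i j * Defs.coord j (tangent E)) ^+ 2) (fun i _ _ => sqrt_close_sqr _ _).
move=> /(sqrt_close_scale l0) /(sqrt_close_scale h0); apply: sqrt_close_le.
have dlE i j : dl i j = hs (v' t - Defs.restrict T v t) i j -
    \sum_(k <- N | (k != t) && has_edge k E) hs (v' k - Defs.restrict T v k) i j.
  rewrite /dl /jump (neighbour_sum_restrict _ _ _ tT tN tE).
  under [in RHS]eq_bigr do rewrite hs_sub.
  rewrite sumrB hs_sub (restrictE v rT tT dt (@subset_refl _ _)).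
  by ring.
set X := (X in _ * (_ * X) <= _).
(* Applying a matrix to the unit tangent does not increase its Frobenius norm. *)
have XE : X <= \sum_(i < 2) \sum_(j < 2) dl i j ^+ 2.
  rewrite /X; apply: ler_sum => i _; rewrite -sumrB.
  under eq_bigr do rewrite -mulrBl -/(dl _ _).
  rewrite !big_ord_recl !big_ord0 !addr0 /Defs.coord /=.
  have := tangent_unit n; set t1 := (tangent E).1; set t2 := (tangent E).2 => tu.
  set d1 := dl i _; set d2 := dl i _; rewrite -subr_ge0.
  have -> : d1 ^+ 2 + d2 ^+ 2 - (d1 * t1 + d2 * t2) ^+ 2 =
    (d1 * t2 - d2 * t1) ^+ 2 + (d1 ^+ 2 + d2 ^+ 2) * (1 - (t1 ^+ 2 + t2 ^+ 2)) by ring.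
  by rewrite tu subrr mulr0 addr0 sqr_ge0.
have S_E : \sum_(i < 2) \sum_(j < 2) dl i j ^+ 2 <=
    2 * D t + 2 * \sum_(k <- N | (k != t) && has_edge k E) D k.
  have -> : \sum_(k <- N | (k != t) && has_edge k E) D k = \sum_(i < 2) \sum_(j < 2)
      (\sum_(k <- N | (k != t) && has_edge k E) hs (v' k - Defs.restrict T v k) i j) ^+ 2.
    under eq_bigr do rewrite /D hsqE.
    rewrite exchange_big /=; apply: eq_bigr => i _.
    rewrite exchange_big /=; apply: eq_bigr => j _.
    by rewrite sqr_sum_neighbour.
  rewrite /D hsqE !mulr_sumr -big_split /=; apply: ler_sum => i _.
  rewrite !mulr_sumr -big_split /=; apply: ler_sum => j _.
  rewrite dlE; set a := hs _ _ _; set b := \sum_(k <- _ | _) _.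
  by have := sqr_ge0 (a + b); rewrite -subr_ge0 => h; nra.
have hl0 : 0 <= hT t * edge_length E by exact: mulr_ge0.
rewrite mulrA; apply: (le_trans (ler_wpM2l hl0 (le_trans XE S_E))).
have D0 k : 0 <= D k by exact: hsq_ge0.
have term k : k \in N -> has_edge k E -> hT t * edge_length E * (2 * D k) <= c * (area k * D k).
  move=> kN kE; have := ler_wpM2r (D0 k) (hT_edge_le tN tE kN kE); lra.
rewrite (mulrDr (hT t * edge_length E)) (mulrDr c); apply: lerD; first exact: term.
rewrite !mulr_sumr big_seq_cond [leRHS]big_seq_cond; apply: ler_sum => k /andP[kN /andP[_ kE]].
exact: term.
Qed.

Lemma le_sum_subset (S M : {fset tri R}) (f : tri R -> R) : (forall t, 0 <= f t) ->
  {subset S <= M} -> \sum_(t <- S) f t <= \sum_(t <- M) f t.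
Proof.
move=> f0 SM; pose g t := if t \in S then f t else 0.
have -> : \sum_(t <- S) f t = \sum_(t <- S) g t.
  by rewrite big_seq [RHS]big_seq; apply: eq_bigr => t tS; rewrite /g tS.
have -> : \sum_(t <- S) g t = \sum_(t <- M) g t.
  by apply: big_fset_incl; [apply/fsubsetP => t; exact: SM|move=> t _ /negPf; rewrite /g => ->].
by apply: ler_sum => t _; rewrite /g; case: ifP.
Qed.

(** A crude count: three edges of [k], at most one neighbour across each, and three edges for every
    such neighbour. *)
Lemma neighbour_count k : k \in N ->
  \sum_(t <- N) \sum_(E <- edges t) (if (k != t) && has_edge k E then 1 else 0 : R) <= 9.
Proof.
move=> kN.
have h1 t E : t \in N -> E \in edges t -> (if (k != t) && has_edge k E then 1 else 0 : R) <=
    \sum_(F <- edges k) (if (t != k) && has_edge t F then 1 else 0).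
  move=> tN Et; have g0 F : (0 : R) <= (if (t != k) && has_edge t F then 1 else 0) by case: ifP.
  case: ifP => [/andP[kt /has_edgeP[F Fk EF]]|_]; last exact: sumr_ge0.
  have tF : has_edge t F by rewrite -(has_edge_same _ EF) edge_has_edge.
  rewrite (big_rem F)//= eq_sym kt tF /= lerDl; apply: sumr_ge0 => y _; by case: ifP.
apply: (@le_trans _ _ (\sum_(t <- N) 3 * \sum_(F <- edges k) (if (t != k) && has_edge t F then 1 else 0))).
  rewrite big_seq [leRHS]big_seq; apply: ler_sum => t tN.
  set X := \sum_(F <- edges k) _.
  apply: (@le_trans _ _ (\sum_(E <- edges t) X)).
    by rewrite big_seq [leRHS]big_seq; apply: ler_sum => E Et; exact: h1.
  by rewrite /edges !big_cons big_nil; lra.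
rewrite -mulr_sumr exchange_big /=.
have h2 F : F \in edges k -> \sum_(t <- N) (if (t != k) && has_edge t F then 1 else 0) <= 1 :> R.
  move=> Fk; rewrite -big_mkcond /=.
  have [[t [tN tk tF]]|none] := pselect (exists t, [/\ t \in N, t != k & has_edge t F]).
    by rewrite (neighbour_sum (fun=> 1) rN kN tN (edge_has_edge Fk) tF tk).
  by rewrite no_neighbour_sum ?ler01// => t tN tk tF; apply: none; exists t.
apply: (@le_trans _ _ (3 * \sum_(F <- edges k) 1)).
  rewrite ler_wpM2l// big_seq [leRHS]big_seq; apply: ler_sum => F Fk; exact: h2.
by rewrite /edges !big_cons big_nil; lra.
Qed.

(** The factor is $12=3+9$: each triangle is charged once for each of its own three edges, and at
    most nine times as a neighbour. *)
Lemma edge_estimator_close (S := (T `&` N)%fset) :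
  sqrt_close (\sum_(t <- S) etaE2 N v' t) (\sum_(t <- S) etaE2 T v t)
    (12 * c * energy N v' (Defs.restrict T v)).
Proof.
have c0 : 0 <= c by rewrite /c !mulr_ge0// ?addr_ge0// ltW.
have aD0 k : 0 <= area k * D k by rewrite mulr_ge0 ?area_ge0 ?hsq_ge0.
pose C t E := c * (area t * D t + \sum_(k <- N | (k != t) && has_edge k E) area k * D k).
have C0 t E : 0 <= C t E by rewrite mulr_ge0// addr_ge0// sumr_ge0.
have h : sqrt_close (\sum_(t <- S) etaE2 N v' t) (\sum_(t <- S) etaE2 T v t)
    (\sum_(t <- S) \sum_(E <- edges t) C t E).
  apply: sqrt_close_sum => t; rewrite inE => /andP[tT tN] _.
  apply: sqrt_close_sum => E Et _; apply: jump_close => //; exact: edge_has_edge.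
apply: sqrt_close_le h.
apply: (@le_trans _ _ (\sum_(t <- N) \sum_(E <- edges t) C t E)).
  apply: (@le_sum_subset S N (fun t => \sum_(E <- edges t) C t E)) => t; first exact: sumr_ge0.
  by rewrite inE => /andP[].
have -> : \sum_(t <- N) \sum_(E <- edges t) C t E = c * (3 * energy N v' (Defs.restrict T v) +
   \sum_(t <- N) \sum_(E <- edges t) \sum_(k <- N | (k != t) && has_edge k E) area k * D k).
  under eq_bigr do (rewrite -mulr_sumr big_split /=).
  rewrite -mulr_sumr big_split /=; congr (_ * (_ + _)).
  rewrite /energy mulr_sumr; apply: eq_bigr => t _.
  by rewrite /edges !big_cons big_nil -/(D t); ring.
rewrite (mulrC 12) -(mulrA c); apply: ler_wpM2l => //.
have -> : \sum_(t <- N) \sum_(E <- edges t) \sum_(k <- N | (k != t) && has_edge k E) area k * D k =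
   \sum_(k <- N) (area k * D k *
     \sum_(t <- N) \sum_(E <- edges t) (if (k != t) && has_edge k E then 1 else 0)).
  under [RHS]eq_bigr do rewrite mulr_sumr.
  rewrite [RHS]exchange_big /=; apply: eq_bigr => t _.
  under [RHS]eq_bigr do rewrite mulr_sumr.
  rewrite [RHS]exchange_big /=; apply: eq_bigr => E _.
  rewrite big_mkcond /=; apply: eq_bigr => k _.
  by case: ifP => _; rewrite ?mulr1 ?mulr0.
have h9 : \sum_(k <- N) (area k * D k *
     \sum_(t <- N) \sum_(E <- edges t) (if (k != t) && has_edge k E then 1 else 0)) <=
   9 * energy N v' (Defs.restrict T v).
  rewrite /energy mulr_sumr big_seq [leRHS]big_seq; apply: ler_sum => k kN.
  by rewrite -/(D k) [leRHS]mulrC ler_wpM2l// neighbour_count.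
by move: h9; lra.
Qed.

End Refinement.

End EdgeJumps.

(** * Volume terms and conclusion *)

Section VolumeTerms.
Variable R : realType.
Implicit Types (Omega : set (pt R)) (x z A B : pt R) (t k : tri R) (M T N : {fset tri R})
  (p q : poly2 R) (v : broken R).

Lemma energy_ge0 M v (r : broken R) : 0 <= energy M v r.
Proof. by apply: sumr_ge0 => k _; rewrite mulr_ge0 ?area_ge0 ?hsq_ge0. Qed.

Lemma norm_pw_sqr M v : (forall k, k \in M -> total_degree_le 2 (v k)) ->
  (forall k, k \in M -> det k != 0) -> norm_pw M v ^+ 2 = \sum_(k <- M) area k * hsq (v k).
Proof.
move=> dv dM; have E : a_pw M v v = \sum_(k <- M) area k * hsq (v k).
  rewrite /a_pw big_seq [RHS]big_seq; apply: eq_bigr => k kM.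
  rewrite -(Rintegral_tint_cst _ (dM k kM)) hsqE.
  apply: eq_Rintegral => x _; apply: eq_bigr => i _; apply: eq_bigr => j _.
  by rewrite (ev_hess _ _ _ (dv k kM)).
rewrite /norm_pw E sqr_sqrtr//; apply: sumr_ge0 => k _.
by rewrite mulr_ge0 ?area_ge0 ?hsq_ge0.
Qed.

Lemma quad_abs_le kappa M t q (K : R) x : shape kappa M -> t \in M -> det t != 0 ->
  total_degree_le 2 q -> (forall z, z \in verts t -> `|ev q z| <= K) -> tset t x ->
  `|ev q x| <= K + 2 * kappa * area t * Num.sqrt (hsq q).
Proof.
move=> sh tM d0 dq hK [l0 [l1 [l2 [h0 h1 h2 h ->]]]]; rewrite (quad_interp _ dq h).
pose Q (A B : pt R) := 2 * cf q 2 0 * (A.1 - B.1) ^+ 2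
  + 2 * cf q 1 1 * ((A.1 - B.1) * (A.2 - B.2)) + 2 * cf q 0 2 * (A.2 - B.2) ^+ 2.
rewrite -!/(Q _ _).
(* Frobenius norm of the Hessian times the bound $4\kappa|t|$ of squared edge lengths, hence a bound
   of the Hessian form on every edge. *)
pose m : R := Num.sqrt (hsq q) * (4 * (kappa * area t)).
have Qm A B : A \in verts t -> B \in verts t -> `|Q A B| <= m.
  move=> At Bt; have d4 : dist2 A B <= 4 * (kappa * area t).
    by apply: le_trans (dist2_verts At Bt) _; rewrite ler_pM2l// sh.
  have d20 : 0 <= dist2 A B by rewrite addr_ge0// sqr_ge0.
  apply: (@le_trans _ _ (Num.sqrt (hsq q) * dist2 A B)); last by rewrite ler_wpM2l ?sqrtr_ge0.
  rewrite -(@ler_pXn2r _ 2)// ?nnegrE ?mulr_ge0 ?sqrtr_ge0//.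
  rewrite real_normK ?num_real// exprMn sqr_sqrtr ?hsq_ge0// /Q /hsq /dist2.
  set a := 2 * cf q 2 0; set b := cf q 1 1; set c := 2 * cf q 0 2.
  set dx := A.1 - B.1; set dy := A.2 - B.2.
  have -> : B.1 - A.1 = - dx by rewrite opprB.
  have -> : B.2 - A.2 = - dy by rewrite opprB.
  rewrite !sqrrN -subr_ge0.
  (* Cauchy-Schwarz for the Hessian against the outer square of the edge vector, with the defect
     written as a sum of squares. *)
  have -> : (a ^+ 2 + 2 * b ^+ 2 + c ^+ 2) * (dx ^+ 2 + dy ^+ 2) ^+ 2 -
      (a * dx ^+ 2 + 2 * b * (dx * dy) + c * dy ^+ 2) ^+ 2 =
      (a * dy ^+ 2 - c * dx ^+ 2) ^+ 2 + 2 * (a * (dx * dy) - b * dx ^+ 2) ^+ 2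
      + 2 * (c * (dx * dy) - b * dy ^+ 2) ^+ 2 by ring.
  have s2 (r : R) : 0 <= 2 * r ^+ 2 by rewrite mulr_ge0 ?sqr_ge0.
  by apply: addr_ge0; [apply: addr_ge0; [exact: sqr_ge0|exact: s2]|exact: s2].
have va : t.1.1 \in verts t by rewrite !inE eqxx.
have vb : t.1.2 \in verts t by rewrite !inE eqxx orbT.
have vc : t.2 \in verts t by rewrite !inE eqxx !orbT.
have m0 : 0 <= m by exact: le_trans (Qm _ _ va vb).
have sc (l a b : R) : 0 <= l -> `|a| <= b -> - (l * b) <= l * a <= l * b.
  move=> l0' ab; rewrite -ler_norml normrM ger0_norm// ler_wpM2l//.
have /andP[a1 a2] := sc _ _ _ h0 (hK _ va).
have /andP[b1 b2] := sc _ _ _ h1 (hK _ vb).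
have /andP[c1 c2] := sc _ _ _ h2 (hK _ vc).
have /andP[d1 d2] := sc _ _ _ (mulr_ge0 h0 h1) (Qm _ _ va vb).
have /andP[e1 e2] := sc _ _ _ (mulr_ge0 h1 h2) (Qm _ _ vb vc).
have /andP[f1 f2] := sc _ _ _ (mulr_ge0 h2 h0) (Qm _ _ vc va).
have sumK : l0 * K + l1 * K + l2 * K = K by rewrite -!mulrDl h mul1r.
have summ : l0 * l1 * m + l1 * l2 * m + l2 * l0 * m <= m.
  rewrite -!mulrDl ler_piMl//.
  have -> : 1 = (l0 + l1 + l2) ^+ 2 by rewrite h expr1n.
  have := mulr_ge0 h0 h1; have := mulr_ge0 h1 h2; have := mulr_ge0 h2 h0.
  by have := sqr_ge0 l0; have := sqr_ge0 l1; have := sqr_ge0 l2; nra.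
have -> : 2 * kappa * area t * Num.sqrt (hsq q) = m / 2 by rewrite /m; field.
by rewrite ler_norml; apply/andP; split; lra.
Qed.

Lemma measurable_ev p : total_degree_le 2 p -> measurable_fun setT (ev p).
Proof.
move=> dp; have -> : ev p = (fun x : pt R => cf p 0 0 + cf p 1 0 * x.1 + cf p 0 1 * x.2
    + cf p 2 0 * x.1 ^+ 2 + cf p 1 1 * (x.1 * x.2) + cf p 0 2 * x.2 ^+ 2).
  by apply/funext => x; rewrite ev_quad.
have m1 : measurable_fun setT (fun x : pt R => x.1) by exact: measurable_fst.
have m2 : measurable_fun setT (fun x : pt R => x.2) by exact: measurable_snd.
have mc (c : R) (f : pt R -> R) : measurable_fun setT f -> measurable_fun setT (fun x => c * f x).
  by move=> mf; apply: measurable_funM.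
do 5 (apply: measurable_funD; last (apply: mc;
  first [exact: m1|exact: m2|exact: measurable_funX|exact: measurable_funM])).
exact: measurable_cst.
Qed.

Lemma residual_L2 Omega yd t p : open Omega -> in_L2 Omega yd -> tint t `<=` Omega ->
  det t != 0 -> total_degree_le 2 p ->
  measurable_fun (tint t) (fun x => ev p x - yd x) /\
  (\int[leb2 R]_(x in tint t) ((ev p x - yd x) ^+ 2)%:E < +oo)%E.
Proof.
move=> oO [my fy] tO d0 dp; have mt := measurable_tint d0.
have mO := open_measurable_plane oO.
have me : measurable_fun (tint t) (ev p) by apply: measurable_funTS; exact: measurable_ev.
have my' : measurable_fun (tint t) yd by exact: measurable_funS my.
have mN : measurable_fun (tint t) (fun x => - yd x) by exact: measurable_funN.
split; first exact: measurable_funB.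
(* A single triangle is its own mesh with some shape constant; only finiteness matters here. *)
have [kappa kappa0 sh] := @exists_shape R [fset t]%fset (fun k => ltac:(by rewrite inE => /eqP ->)).
have tt : t \in [fset t]%fset by rewrite inE.
pose K := `|ev p t.1.1| + `|ev p t.1.2| + `|ev p t.2|.
have hK z : z \in verts t -> `|ev p z| <= K.
  by rewrite !inE => /or3P[]/eqP ->; rewrite /K;
    have := normr_ge0 (ev p t.1.1); have := normr_ge0 (ev p t.1.2); have := normr_ge0 (ev p t.2); lra.
set S := K + 2 * kappa * area t * Num.sqrt (hsq p).
have hS x : tint t x -> `|ev p x| <= S.
  by move=> /tint_tset xt; exact: quad_abs_le sh tt d0 dp hK xt.
apply: (le_lt_trans (@integral_sqrD_le _ _ _ (leb2 R) _ mt (ev p) (fun x => - yd x) me mN)).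
have i1 : (\int[leb2 R]_(x in tint t) (ev p x ^+ 2)%:E <= (S ^+ 2 * area t)%:E)%E.
  apply: (@le_trans _ _ (\int[leb2 R]_(x in tint t) (S ^+ 2)%:E)%E); last first.
    by rewrite integral_cst// [X in (_ * X)%E](tint_measure d0) -EFinM.
  apply: ge0_le_integral => //.
  - by move=> x _; rewrite lee_fin sqr_ge0.
  - exact: measurable_sqr.
  - move=> x xt; rewrite lee_fin -[leLHS]real_normK ?num_real// lerXn2r ?nnegrE ?hS//.
    by rewrite (le_trans _ (hS _ xt)).
have i2 : (\int[leb2 R]_(x in tint t) ((- yd x) ^+ 2)%:E <= \int[leb2 R]_(x in Omega) (yd x ^+ 2)%:E)%E.
  under eq_integral do rewrite sqrrN.
  apply: ge0_subset_integral => //; first exact: measurable_sqr.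
  by move=> x _; rewrite lee_fin sqr_ge0.
apply: lte_add_pinfty; apply: lte_mul_pinfty => //.
- exact: le_lt_trans i1 (ltry _).
- exact: le_lt_trans i2 fy.
Qed.

Lemma area_sum_le M (S : {fset tri R}) (f : tri R -> R) : {subset S <= M} -> (forall t, 0 <= f t) ->
  \sum_(t <- S) area t * f t <= \sum_(t <- M) area t * f t.
Proof.
move=> SM f0; apply: (@le_sum_subset R S M (fun t => area t * f t)) => // t.
by rewrite mulr_ge0 ?area_ge0.
Qed.

(** A point may lie in several closed triangles, but each triangle contributes at most its area
    times the full squared control difference. *)
Lemma source_estimator_close (Z : {fset pt R}) (M S : {fset tri R}) (u u' : Z -> R) :
  {subset S <= M} -> (forall t, t \in M -> det t != 0) ->
  sqrt_close (\sum_(t <- S) etaS2 u' t) (\sum_(t <- S) etaS2 u t)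
    (\sum_(t <- M) area t * \sum_(z : Z) (u' z - u z) ^+ 2).
Proof.
move=> SM dM.
set du := \sum_(z : Z) (u' z - u z) ^+ 2.
have du0 : 0 <= du by apply: sumr_ge0 => z _; exact: sqr_ge0.
have h : sqrt_close (\sum_(t <- S) etaS2 u' t) (\sum_(t <- S) etaS2 u t)
    (\sum_(t <- S) \sum_(z : Z | `[< tset t (val z) >]) Defs.lambda t (val z) * hT t ^+ 2 * (u' z - u z) ^+ 2).
  apply: sqrt_close_sum => t tS _; apply: sqrt_close_sum => z _ _.
  apply: sqrt_close_scale; last by rewrite !real_normK ?num_real//; exact: sqrt_close_sqr.
  by rewrite mulr_ge0 ?sqr_ge0// /Defs.lambda; case: ifP.
apply: sqrt_close_le h; apply: le_trans (area_sum_le SM (fun=> du0)).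
rewrite big_seq [leRHS]big_seq; apply: ler_sum => t tS.
rewrite -(hT_sqr (dM _ (SM _ tS))) /du mulr_sumr big_mkcond /=; apply: ler_sum => z _.
have u0 := sqr_ge0 (u' z - u z); have t0 := sqr_ge0 (hT t).
case: ifP => _; last by rewrite mulr_ge0.
by rewrite ler_wpM2r// /Defs.lambda; case: ifP => _; rewrite ?mul0r ?mul1r.
Qed.

(** Each term is $h_T^4|T|s_T^2=|T|^3s_T^2$ with $s_T^2\le2K^2+8\kappa^2|T|^2|D^2w|^2$. One factor
    $|T|$ is kept for the sum and the other powers of area are bounded by those of [A0]. *)
Lemma residual_estimator_close Omega yd kappa (T S : {fset tri R}) (y y' w : broken R) (K : R) :
  open Omega -> in_L2 Omega yd -> shape kappa T -> 0 <= kappa -> 0 <= K ->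
  {subset S <= T} -> (forall t, t \in T -> det t != 0) -> (forall t, t \in T -> tint t `<=` Omega) ->
  (forall t, t \in S -> total_degree_le 2 (y t)) -> (forall t, t \in S -> total_degree_le 2 (y' t)) ->
  (forall t, t \in T -> total_degree_le 2 (w t)) ->
  (forall t x, t \in S -> ev (y' t) x - ev (y t) x = ev (w t) x) ->
  (forall t z, t \in T -> z \in verts t -> `|ev (w t) z| <= K) ->
  let A0 := \sum_(t <- T) area t in
  sqrt_close (\sum_(t <- S) etaA2 yd y' t) (\sum_(t <- S) etaA2 yd y t)
    (2 * A0 ^+ 3 * K ^+ 2 + 8 * kappa ^+ 2 * A0 ^+ 4 * \sum_(t <- T) area t * hsq (w t)).
Proof.
move=> oO hyd sh k0 K0 ST dT tO dy dy' dw yw hK A0.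
pose s t := K + 2 * kappa * area t * Num.sqrt (hsq (w t)).
have s0 t : 0 <= s t by rewrite addr_ge0// !mulr_ge0// ?area_ge0 ?sqrtr_ge0.
have h : sqrt_close (\sum_(t <- S) etaA2 yd y' t) (\sum_(t <- S) etaA2 yd y t)
    (\sum_(t <- S) hT t ^+ 4 * (area t * s t ^+ 2)).
  apply: sqrt_close_sum => t tS _; have tT := ST _ tS; have d0 := dT _ tT.
  apply: sqrt_close_scale; first by rewrite exprn_even_ge0.
  have [m1 f1] := residual_L2 oO hyd (tO _ tT) d0 (dy _ tS).
  have [m2 f2] := residual_L2 oO hyd (tO _ tT) d0 (dy' _ tS).
  apply: (@sqrt_close_Rintegral _ _ _ (leb2 R)) => //.
  - exact: measurable_tint.
  - exact: tint_measure.
  - move=> x /tint_tset xt; have -> : ev (y' t) x - yd x - (ev (y t) x - yd x) = ev (w t) x.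
      by rewrite -yw//; ring.
    by apply: (quad_abs_le sh tT d0 (dw _ tT) _ xt) => z; exact: hK.
apply: sqrt_close_le h.
have aA t : t \in T -> area t <= A0 by exact: (le_sum_mem (@area_ge0 R)).
have A00 : 0 <= A0 by apply: sumr_ge0 => t _; exact: area_ge0.
pose f t := 2 * A0 ^+ 2 * K ^+ 2 + 8 * kappa ^+ 2 * A0 ^+ 4 * hsq (w t).
have f0 t : 0 <= f t.
  by rewrite addr_ge0// !mulr_ge0 ?exprn_ge0 ?hsq_ge0.
apply: (@le_trans _ _ (\sum_(t <- S) area t * f t)).
  rewrite big_seq [leRHS]big_seq; apply: ler_sum => t tS; have tT := ST _ tS.
  have -> : hT t ^+ 4 = area t ^+ 2 by rewrite -(hT_sqr (dT _ tT)) -exprM.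
  rewrite mulrCA ler_wpM2l ?area_ge0//.
  have a0 := area_ge0 t; have aA0 := aA _ tT.
  apply: (@le_trans _ _ (area t ^+ 2 * (2 * K ^+ 2 + 8 * kappa ^+ 2 * area t ^+ 2 * hsq (w t)))).
    rewrite ler_wpM2l ?sqr_ge0// -[in leRHS](sqr_sqrtr (hsq_ge0 (w t))) /s.
    set r := Num.sqrt _; rewrite -subr_ge0.
    have -> : 2 * K ^+ 2 + 8 * kappa ^+ 2 * area t ^+ 2 * r ^+ 2 - (K + 2 * kappa * area t * r) ^+ 2
      = (K - 2 * kappa * area t * r) ^+ 2 by ring.
    exact: sqr_ge0.
  have e2 : area t ^+ 2 <= A0 ^+ 2 by rewrite lerXn2r ?nnegrE.
  have e4 : area t ^+ 4 <= A0 ^+ 4 by rewrite lerXn2r ?nnegrE.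
  have q0 : 0 <= 8 * kappa ^+ 2 * hsq (w t) by rewrite !mulr_ge0 ?exprn_ge0 ?hsq_ge0.
  have q1 : 0 <= 2 * K ^+ 2 by rewrite mulr_ge0 ?sqr_ge0.
  have -> : area t ^+ 2 * (2 * K ^+ 2 + 8 * kappa ^+ 2 * area t ^+ 2 * hsq (w t)) =
    2 * K ^+ 2 * area t ^+ 2 + 8 * kappa ^+ 2 * hsq (w t) * area t ^+ 4 by ring.
  have -> : f t = 2 * K ^+ 2 * A0 ^+ 2 + 8 * kappa ^+ 2 * hsq (w t) * A0 ^+ 4 by rewrite /f; ring.
  by apply: lerD; apply: ler_wpM2l.
apply: (le_trans (area_sum_le ST f0)); rewrite /f.
under eq_bigr do rewrite mulrDr.
rewrite big_split /= -mulr_suml -/A0 mulr_sumr.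
have -> : A0 * (2 * A0 ^+ 2 * K ^+ 2) = 2 * A0 ^+ 3 * K ^+ 2 by ring.
rewrite lerD2l; apply: ler_sum => t _; rewrite le_eqVlt; apply/orP; left; apply/eqP; ring.
Qed.

Lemma estimatorE (Z : {fset pt R}) (yd : pt R -> R) M (S : {fset tri R}) (y p : broken R) (u : Z -> R) :
  estimator yd M y p u S = Num.sqrt (\sum_(t <- S) etaS2 u t + \sum_(t <- S) etaE2 M y t +
    \sum_(t <- S) etaA2 yd y t + \sum_(t <- S) etaE2 M p t).
Proof. by rewrite -!big_split. Qed.

End VolumeTerms.

Theorem mainTheorem6 (R : realType) (Omega : set (pt R)) (Z : {fset pt R})
    (alpha : R) (yd : pt R -> R) (a b : Z -> R) (T0 : {fset tri R})
    (CJ : R) (J : {fset tri R} -> broken R -> pt R -> R)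
    (hOmega : polygonal_lipschitz_domain Omega)
    (hZ : forall z, z \in Z -> Omega z)
    (halpha : 0 < alpha)
    (hyd : in_L2 Omega yd)
    (hab : forall z : Z, a z <= b z)
    (hT0 : regular_triangulation Omega T0)
    (hJ : forall T, admissible Omega T0 T -> companion Omega T CJ (J T)) :
  exists2 Lambda1 : R, 0 < Lambda1 &
  exists2 delta0 : R, 0 < delta0 &
  forall T That : {fset tri R},
    fine_triangulation Omega T0 delta0 T -> admissible Omega T That ->
  forall (y p y' p' : broken R) (u u' : Z -> R),
    discrete_solution Omega alpha yd a b T (J T) y p u ->
    discrete_solution Omega alpha yd a b That (J That) y' p' u' ->
    `| estimator yd That y' p' u' (T `&` That)%fset - estimator yd T y p u (T `&` That)%fset |
      <= Lambda1 * distance T That y y' p p' u u'.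
Proof.
have [kappa kappa0 sh0] := exists_shape (fun t => @regular_det R Omega T0 hT0 t).
pose A0 := \sum_(t <- T0) area t.
pose C0 := (1 + vol Omega / 2) * `|CJ|.
pose c : R := 4 * kappa * (kappa + 1).
(* The three summands bound the squared perturbations of the source terms, of either family of jump
   terms, and of the volume residual. *)
pose X := A0 + 12 * c + (2 * A0 ^+ 3 * C0 ^+ 2 + 8 * kappa ^+ 2 * A0 ^+ 4).
have A00 : 0 <= A0 by apply: sumr_ge0 => t _; exact: area_ge0.
have c0 : 0 <= c by rewrite /c !mulr_ge0// ?addr_ge0// ltW.
have C00 : 0 <= C0 by rewrite /C0 mulr_ge0// addr_ge0// divr_ge0// vol_ge0.
have r0 : 0 <= 2 * A0 ^+ 3 * C0 ^+ 2 + 8 * kappa ^+ 2 * A0 ^+ 4.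
  have e3 := exprn_ge0 3 A00; have e4 := exprn_ge0 4 A00.
  have t2 := mulr_ge0 (ler0n R 2) e3; have t8 := mulr_ge0 (ler0n R 8) (sqr_ge0 kappa).
  exact: addr_ge0 (mulr_ge0 t2 (sqr_ge0 C0)) (mulr_ge0 t8 e4).
have X0 : 0 <= X by exact: addr_ge0 (addr_ge0 A00 (mulr_ge0 (ler0n R 12) c0)) r0.
(* [1 + X] is positive even for [X = 0], and its square dominates [X]. *)
exists (1 + X); first by rewrite ltr_pwDl.
exists 1 => // T N [aT _] [nTN rN] y p y' p' u u' [[my mp _] _ _ _] [[my' mp' _] _ _ _].
have [nT rT] := aT.
have shT := nvb_shape nT sh0; have shN := nvb_shape nTN shT.
have dT t : t \in T -> det t != 0 by move=> h; exact: (regular_det rT h).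
have dN t : t \in N -> det t != 0 by move=> h; exact: (regular_det rN h).
have areaT : \sum_(t <- T) area t = A0 by exact: nvb_area nT (regular_separated hT0).
have oO : open Omega by case: hOmega => -[].
have ST : {subset (T `&` N)%fset <= T} by move=> t; rewrite inE => /andP[].
have SN t : t \in (T `&` N)%fset -> t \in N by rewrite inE => /andP[].
have degy := @morley_deg _ _ _ _ my; have degy' := @morley_deg _ _ _ _ my'.
have degp := @morley_deg _ _ _ _ mp; have degp' := @morley_deg _ _ _ _ mp'.
have norm_energy v v' : (forall k, k \in T -> total_degree_le 2 (v k)) ->
    (forall k, k \in N -> total_degree_le 2 (v' k)) ->
    norm_pw N (fun k => v' k - Defs.restrict T v k) ^+ 2 = energy N v' (Defs.restrict T v).
  move=> dv dv'; rewrite norm_pw_sqr// => k kN; apply: total_degree_le_sub; first exact: dv'.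
  have [t tT kt] := nvb_container nTN kN.
  by rewrite (restrictE _ rT tT (dN _ kN) kt); exact: dv.
set Ey := energy N y' (Defs.restrict T y); set Ep := energy N p' (Defs.restrict T p).
have Ey0 : 0 <= Ey by exact: energy_ge0.
have Ep0 : 0 <= Ep by exact: energy_ge0.
(* The volume residual involves the state alone, so [y'] is the function to be interpolated. *)
have [q [iq qE]] := morley_interpolation y rT rN nTN my'.
have mw := interpolation_morley rT rN my' my iq.
set w := (fun t => _) in mw.
have degw := @morley_deg _ _ _ _ mw.
have wE : \sum_(t <- T) area t * hsq (w t) = energy T q y.
  by rewrite /energy big_seq [RHS]big_seq; apply: eq_bigr => t tT; rewrite /w tT.
pose K := C0 * norm_pw T w.
have K0 : 0 <= K by rewrite mulr_ge0// sqrtr_ge0.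
have K2 : K ^+ 2 = C0 ^+ 2 * energy T q y by rewrite exprMn norm_pw_sqr// wE.
have wy t x : t \in (T `&` N)%fset -> ev (y' t) x - ev (y t) x = ev (w t) x.
  move=> tS; rewrite /w (ST _ tS) ev_sub.
  by rewrite (interpolates_common rN my' iq (ST _ tS) (SN _ tS)).
have hK t z : t \in T -> z \in verts t -> `|ev (w t) z| <= K.
  by move=> tT zt; exact: companion_vertex_bound hOmega (hJ _ aT) mw tT zt.
have tO t : t \in T -> tint t `<=` Omega by move=> h; exact: (tint_Omega hOmega rT h).
pose du := \sum_(z : Z) (u' z - u z) ^+ 2.
have du0 : 0 <= du by apply: sumr_ge0 => z _; exact: sqr_ge0.
have closeS := source_estimator_close u u' ST dT.
have closeA := residual_estimator_close oO hyd shT (ltW kappa0) K0 ST dT tO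
  (fun t tS => degy t (ST _ tS)) (fun t tS => degy' t (SN _ tS)) degw wy hK.
have closeY := edge_estimator_close rT rN nTN kappa0 shN degy degy'.
have closeP := edge_estimator_close rT rN nTN kappa0 shN degp degp'.
have distE : distance T N y y' p p' u u' = Num.sqrt (du + Ey + Ep).
  by congr (Num.sqrt (_ + _ + _)); [exact: norm_energy degy degy'|exact: norm_energy degp degp'].
rewrite distE (estimatorE yd N) (estimatorE yd T).
have := sqrt_closeD (sqrt_closeD (sqrt_closeD closeS closeY) closeA) closeP.
apply: sqrt_close_dist.
- by rewrite addr_ge0.
- by rewrite !addr_ge0.
rewrite -mulr_suml areaT wE K2 -/du -/Ey -/Ep -/c.
have e0 : 0 <= energy T q y by exact: energy_ge0.
have h : (2 * A0 ^+ 3 * C0 ^+ 2 + 8 * kappa ^+ 2 * A0 ^+ 4) * energy T q y <=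
  (2 * A0 ^+ 3 * C0 ^+ 2 + 8 * kappa ^+ 2 * A0 ^+ 4) * Ey by exact: ler_wpM2l.
(* Every component constant is at most [X]; the energy of the interpolation error has already been
   replaced by [Ey]. *)
apply: (@le_trans _ _ (X * (du + Ey + Ep))); last first.
  rewrite ler_wpM2r ?addr_ge0//; nra.
move: h; rewrite /X; set r := 2 * A0 ^+ 3 * C0 ^+ 2 + 8 * kappa ^+ 2 * A0 ^+ 4.
have -> : 2 * A0 ^+ 3 * (C0 ^+ 2 * energy T q y) + 8 * kappa ^+ 2 * A0 ^+ 4 * energy T q y =
  r * energy T q y by rewrite /r; ring.
move: r0; rewrite -/r => r0 h.
have := mulr_ge0 A00 Ey0; have := mulr_ge0 A00 Ep0; have := mulr_ge0 c0 du0.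
have := mulr_ge0 r0 du0; have := mulr_ge0 r0 Ep0.
by move: h; lra.
Qed.
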